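(* Let $\Omega=B(0,1)$ be the unit ball in $\mathbb{R}^2$, $Y=\mathbb{R}^2$, $Z=\mathbb{R}^{2\times2}$. There is a function $L\colon\Omega\times Y\times Z\to\mathbb{R}$ of class $C^{1,1}_{\mathrm{loc}}$, strictly convex in $z$, and such that $$\inf_{h\in W^{1,2}(\Omega;\mathbb{R}^2)}\int_\Omega L(x,h(x),Dh(x))\,dx>\min_{(\mu,\mu_\partial)\in\mathcal M}\int_{\Omega\times Y\times Z}L\,d\mu ,$$ where $\mathcal M$ is the set of pairs of relaxed occupation measures and their boundary measures defined in the context.
   Context: A function is of class $C^{1,1}_{\mathrm{loc}}$ if it is continuously differentiable and its derivative is Lipschitz continuous on each compact set. $W^{1,2}(\Omega;\mathbb{R}^2)$ is the Sobolev space of weakly differentiable functions on $\Omega$ with values in $\mathbb{R}^2$ and weak derivative $Dh$ in $L^2(\Omega;Z)$. Strictly convex in $z$ means $z\mapsto L(x,y,z)$ is strictly convex for each $(x,y)$. $\mathcal M$ is the set of pairs $(\mu,\mu_\partial)$ of compactly supported, positive Radon measures on $\overline\Omega\times Y\times Z$ and $\partial\Omega\times Y$, respectively, satisfying $\mu(\Omega\times Y\times Z)=|\Omega|$ (the Lebesgue measure of $\Omega$) and, for all $\phi\in C^\infty(\overline\Omega\times Y)$ (functions extending to infinitely differentiable functions on an open set containing $\overline\Omega\times Y$) and $\ell=1,2$, $$\int_{\Omega\times Y\times Z}\left(\frac{\partial\phi}{\partial x_\ell}(x,y)+\sum_{i=1}^2\frac{\partial\phi}{\partial y_i}(x,y)\,z_{i\ell}\right)d\mu(x,y,z)=\int_{\partial\Omega\times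 Y}\phi(x,y)\,\mathbf n_\ell(x)\,d\mu_\partial(x,y),$$ where $\mathbf n$ is the exterior unit normal vector to $\partial\Omega$. *)

(* Defs.v *)
From HB Require Import structures.
From mathcomp Require Import all_boot all_order all_algebra.
From mathcomp Require Import all_classical all_reals all_analysis.

Set Implicit Arguments.
Unset Strict Implicit.
Unset Printing Implicit Defensive.
Import Order.TTheory GRing.Theory Num.Theory.
Import numFieldNormedType.Exports.
Local Open Scope classical_set_scope.
Local Open Scope ring_scope.

(* R^2 is [R * R] and R^{2x2} is [(R * R) * (R * R)], a pair of rows: these
   types carry both a norm and the product sigma-algebra, which is the Borel
   one.  The norm is the sup norm, so Euclidean balls are written out by hand;
   topology, differentiability and local Lipschitz continuity do not depend on
   the choice of the norm. *)
Notation R2 R := (R * R)%type.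
Notation R22 R := (R2 R * R2 R)%type.

Definition coord (T : Type) (i : 'I_2) (p : T * T) : T :=
  if i == ord0 then p.1 else p.2.

Definition basis2 (R : realType) (i : 'I_2) : R2 R :=
  ((i == ord0)%:R, (i == ord_max)%:R).

Definition entry (R : realType) (z : R22 R) (i l : 'I_2) : R :=
  coord l (coord i z).

Definition leb2 (R : realType) :
    {measure set (measurableTypeR R * measurableTypeR R)%type -> \bar R} :=
  (@lebesgue_measure R \x @lebesgue_measure R)%E.

Definition unit_disc (R : realType) : set (R2 R) :=
  [set x | x.1 ^+ 2 + x.2 ^+ 2 < 1].

Definition boundary (T : topologicalType) (A : set T) : set T :=
  closure A `\` interior A.

(* At a point x of the unit circle the exterior unit normal of the disc is x
   itself; only the values on the circle matter. *)
Definition unit_disc_normal (R : realType) (x : R2 R) : R2 R := x.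

Section Regularity.
Variables (R : realType) (V : normedModType R).

(* Only used with U open and V finite-dimensional, where this is the usual
   class C^n: all iterated directional derivatives up to order n exist and
   are continuous on U. *)
Fixpoint Ck (n : nat) (U : set V) (f : V -> R) : Prop :=
  match n with
  | 0%N => forall x, U x -> {for x, continuous f}
  | m.+1 => (forall x, U x -> differentiable f x) /\
            (forall v : V, Ck m U ('D_v f))
  end.

Definition smooth (U : set V) (f : V -> R) : Prop := forall n, Ck n U f.

(* The bound is linear in |v|, so this is Lipschitz continuity of x |-> 'd f x
   for the operator norm. *)
Definition C11loc (U : set V) (f : V -> R) : Prop :=
  Ck 1 U f /\
  forall K : set V, compact K -> K `<=` U ->
    exists k : R, forall v : V, (k * `|v|).-lipschitz_K ('D_v f).

Definition strictly_convex (f : V -> R) : Prop :=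
  forall (z w : V) (t : R), z != w -> 0 < t -> t < 1 ->
    f (t *: z + (1 - t) *: w) < t * f z + (1 - t) * f w.

End Regularity.

Section Sobolev.
Variables (R : realType) (Omega : set (R2 R)).

Definition test_function (phi : R2 R -> R) : Prop :=
  [/\ smooth setT phi,
      compact (closure [set x | phi x != 0]) &
      closure [set x | phi x != 0] `<=` Omega].

Definition loc_integrable (f : R2 R -> R) : Prop :=
  measurable_fun Omega f /\
  forall K, compact K -> K `<=` Omega ->
    (leb2 R).-integrable K (EFin \o f).

Definition weak_partial (l : 'I_2) (f g : R2 R -> R) : Prop :=
  [/\ loc_integrable f, loc_integrable g &
  forall phi, test_function phi ->
    (\int[leb2 R]_(x in Omega) (f x * 'D_(basis2 R l) phi x)%:E =
     - \int[leb2 R]_(x in Omega) (g x * phi x)%:E)%E].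

Definition square_integrable (f : R2 R -> R) : Prop :=
  measurable_fun Omega f /\
  (leb2 R).-integrable Omega (fun x => (f x ^+ 2)%:E).

(* h belongs to W^{1,2}(Omega; R^2) and Dh is (a version of) its weak
   derivative.  On a ball, h in L^1_loc with Dh in L^2 forces h in L^2. *)
Definition W12 (h : R2 R -> R2 R) (Dh : R2 R -> R22 R) : Prop :=
  forall i l : 'I_2,
    weak_partial l (fun x => coord i (h x)) (fun x => entry (Dh x) i l) /\
    square_integrable (fun x => entry (Dh x) i l).

Definition classical_values (L : R2 R * R2 R * R22 R -> R) : set (\bar R) :=
  [set e | exists h Dh, W12 h Dh /\
     e = (\int[leb2 R]_(x in Omega) (L (x, h x, Dh x))%:E)%E].

End Sobolev.

Section RelaxedOccupationMeasures.
Variable R : realType.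

(* A measure on a closed set S is represented by a measure on the whole space
   which vanishes outside S.  Borel measures on a Euclidean space which are
   finite on compact sets are Radon; regularity is then automatic. *)
Definition radon (T : topologicalType) (mu : set T -> \bar R) : Prop :=
  forall K, compact K -> (mu K < +oo)%E.

Definition measure_support (T : topologicalType) (mu : set T -> \bar R) :
    set T :=
  [set p | forall U, open U -> U p -> (0 < mu U)%E].

Definition compactly_supported_radon_on (T : topologicalType) (S : set T)
    (mu : set T -> \bar R) : Prop :=
  [/\ radon mu, mu (~` S) = 0%E & compact (measure_support mu)].

(* [n] is the exterior unit normal of [Omega]; a smooth function on
   closure Omega x Y is given by an extension [phi] to a neighborhood [U]. *)
Definition relaxed_occupation (Omega : set (R2 R)) (n : R2 R -> R2 R)
    (mu : {measure set (R2 R * R2 R * R22 R)%type -> \bar R})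
    (mub : {measure set (R2 R * R2 R)%type -> \bar R}) : Prop :=
  [/\ compactly_supported_radon_on (closure Omega `*` setT `*` setT) mu,
      compactly_supported_radon_on (boundary Omega `*` setT) mub,
      mu (Omega `*` setT `*` setT) = leb2 R Omega &
  forall (U : set (R2 R * R2 R)) (phi : R2 R * R2 R -> R) (l : 'I_2),
    open U -> closure Omega `*` setT `<=` U -> smooth U phi ->
    (\int[mu]_(p in Omega `*` setT `*` setT)
       ('D_(basis2 R l, 0) phi p.1 +
        \sum_(i < 2) 'D_(0, basis2 R i) phi p.1 * entry p.2 i l)%:E =
     \int[mub]_(q in boundary Omega `*` setT)
       (phi q * coord l (n q.1))%:E)%E].

Definition relaxed_values (Omega : set (R2 R)) (n : R2 R -> R2 R)
    (L : R2 R * R2 R * R22 R -> R) : set (\bar R) :=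
  [set e | exists mu mub, relaxed_occupation Omega n mu mub /\
     e = (\int[mu]_(p in Omega `*` setT `*` setT) (L p)%:E)%E].

End RelaxedOccupationMeasures.

(* The library evaluates an integral whose positive and negative parts are
   both infinite to -oo; since [m] is finite, the values bounded below by [m]
   are genuine integrals. *)
Definition is_min (R : realType) (A : set (\bar R)) (m : R) : Prop :=
  A m%:E /\ lbound A m%:E.

(* Main.v *)
From HB Require Import structures.
Require Import Defs.
From mathcomp Require Import all_boot all_order all_algebra.
From mathcomp Require Import all_classical all_reals all_analysis.
From mathcomp Require Import measurable_realfun.
From mathcomp Require Import ring lra.

(** Let [J (y1, y2) = (- y2, y1)].  The Lagrangian is
<<
  gapL = |z_1|^2 + |z_2 - x1 J y|^2 + (|y|^2 - 1)^2
>>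
where [z_1] and [z_2] are the columns of [z].  It is a polynomial, strictly
convex in [z], and it vanishes exactly when [|y| = 1] and [z = (0, x1 J y)].  A
map [h] of zero energy would be parallel, with values in the unit circle, for
the connection [d - x1 J dx2].  This connection has non-zero curvature, so that
there is no such map; but it is a rotation, so that its parallel transport
preserves the uniform measure on the circle, and a measure that puts all unit
vectors [y] above every point [x] has zero energy.

Relaxed problem.  Let [mu] be the image of the Lebesgue measure of disc times
[[0, 1]] under [(x, t) |-> (x, y, z)] with [y = (cos (2 pi t), sin (2 pi t))] and
[z = (0, x1 J y)] ([disc_measure]), and let the boundary measure be the product
of the two uniform measures on circles ([circle_measure]).  In the constraint of
[relaxed_occupation], the derivatives in [x] give the boundary term, by the
divergence theorem for every fixed [y] ([disc_green1], [disc_green2]).  The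
derivatives in [y] are the derivative of the test function along the closed
orbit [t |-> y], whose integral vanishes for every fixed [x] ([integral_F2]).
This is [holonomy_identity], and zero, a lower bound for all energies, is
attained ([relaxed_min]).

Classical problem.  Put [p = d1 h] and [r = d2 h - x1 J h].  The equality of the
mixed second derivatives of [h] gives
<<
  J h = d2 p - d1 r - x1 J p ,
>>
where the left-hand side is the curvature term.  Tested against a bump, it
bounds the mean of [h] by the integrals of [|p|] and [|r|] ([mean_le]).  The
oscillation of [h] about its mean is bounded by the integrals of its first
derivatives [p] and [r + x1 J h] ([oscillation_le]), where [x1] is small on the
square in use.  If the energy is small, then [p], [r] and [|h|^2 - 1] are small
in the mean: both the mean and the oscillation of [h] are small, and [|h|] is
close to one, which is a contradiction.  The constants are followed up to
[majorant_lower_bound], and [classical_lower_bound] is an explicit positive lower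
bound for the energy.

All of this concerns functions with weak derivatives only.  The test functions
are tensor products of smooth functions of one variable, supported in the
square.  For the oscillation, the tests show that a signed measure, built from
[h], [p], [d2 h] and an explicit kernel, vanishes on tensor products of smooth
functions; by a pi-lambda argument it vanishes on all bounded Borel functions
([tensor_functional_eq0]), in particular on the sign of [h] minus its mean. *)

Set Implicit Arguments.
Unset Strict Implicit.
Unset Printing Implicit Defensive.
Import Order.TTheory GRing.Theory Num.Theory.
Import numFieldNormedType.Exports.
Local Open Scope classical_set_scope.
Local Open Scope ring_scope.

(** * Borel measurability in products of lines *)

Definition has_countable_base (T : topologicalType) (M : set (set T)) : Prop :=
  exists B : nat -> set T, (forall n, M (B n)) /\
    forall U, open U -> forall x, U x -> exists n, B n x /\ B n `<=` U.

Lemma countable_base_real (R : realType) :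
  @has_countable_base R (@measurable _ R).
Proof.
pose B n : set R := if unpickle n is Some qr then
  [set` `]ratr (qr : rat * rat).1 : R, ratr qr.2 : R[] else set0.
exists B; split.
  by rewrite /B => n; case: unpickle => // qr; exact: measurable_itv.
move=> U oU x Ux.
have /nbhs_ballP [e /= e0 xeU] : nbhs x U by exact: open_nbhs_nbhs.
have [|q /andP[/= xq qx]] := @rat_in_itvoo R (x - e) x.
  by rewrite ltrBlDr ltrDl.
have [|r /andP[/= xr rx]] := @rat_in_itvoo R x (x + e); first by rewrite ltrDl.
rewrite !bnd_simp in xq qx xr rx.
exists (pickle (q, r)); rewrite /B pickleK; split => /=.
  by rewrite in_itv/= qx xr.
move=> y /=; rewrite in_itv/= => /andP[qy yr]; apply: xeU.
by rewrite /ball/= ltr_distl; apply/andP; split; lra.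
Qed.

Lemma countable_base_prod (T1 T2 : topologicalType) (M1 : set (set T1))
    (M2 : set (set T2)) (M : set (set (T1 * T2))) :
  (forall A B, M1 A -> M2 B -> M (A `*` B)) ->
  has_countable_base M1 -> has_countable_base M2 -> has_countable_base M.
Proof.
move=> MX [B1 [MB1 hB1]] [B2 [MB2 hB2]].
pose B n : set (T1 * T2) :=
  if unpickle n is Some (i, j) then B1 i `*` B2 j else B1 0%N `*` B2 0%N.
exists B; split.
  by rewrite /B => n; case: unpickle => [[i j]|]; exact: MX.
move=> U oU [x y] Uxy.
have [[P Q] /= [Px Qy] PQU] : nbhs (x, y) U by exact: open_nbhs_nbhs.
move: Px; rewrite nbhsE => -[P' [oP' P'x] P'P].
move: Qy; rewrite nbhsE => -[Q' [oQ' Q'y] Q'Q].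
have [i [B1x B1P]] := hB1 _ oP' _ P'x.
have [j [B2y B2Q]] := hB2 _ oQ' _ Q'y.
exists (pickle (i, j)); rewrite /B pickleK; split => //.
by move=> [a b] [/= /B1P /P'P Pa /B2Q /Q'Q Qb]; exact: PQU.
Qed.

(** Second countability is what makes an open set of a product measurable for
the product sigma-algebra: it is a countable union of measurable boxes. *)
Lemma countable_base_open (T : topologicalType) (M : set (set T)) :
  M set0 -> (forall F : nat -> set T, (forall n, M (F n)) ->
    M (\bigcup_n F n)) ->
  has_countable_base M -> forall U, open U -> M U.
Proof.
move=> M0 MU [B [MB hB]] U oU.
rewrite (_ : U = \bigcup_n (if `[< B n `<=` U >] then B n else set0)).
  by apply: MU => n; case: ifP.
apply/seteqP; split => [x Ux|x [n _]].
  have [n [Bnx BU]] := hB _ oU _ Ux.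
  by exists n => //; rewrite ifT//; apply/asboolP.
by case: ifPn => // /asboolP; exact.
Qed.

Section euclidean_borel.
Variable R : realType.

Let base_R2 : has_countable_base (@measurable _ (R2 R)).
Proof.
by apply: countable_base_prod (countable_base_real R) (countable_base_real R);
  exact: measurableX.
Qed.

Let base_R4 : has_countable_base (@measurable _ (R2 R * R2 R)%type).
Proof. by apply: countable_base_prod base_R2 base_R2; exact: measurableX. Qed.

Lemma open_measurable_R2R (U : set (R2 R * R)) : open U -> measurable U.
Proof.
apply: countable_base_open => //; first exact: bigcupT_measurable.
by apply: countable_base_prod base_R2 (countable_base_real R); exact: measurableX.
Qed.

Lemma open_measurable_R8 (U : set (R2 R * R2 R * R22 R)) :
  open U -> measurable U.
Proof.
apply: countable_base_open => //; first exact: bigcupT_measurable.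
by apply: countable_base_prod base_R4 base_R4; exact: measurableX.
Qed.

Lemma open_measurable_R4 (U : set (R2 R * R2 R)) : open U -> measurable U.
Proof.
by apply: countable_base_open => //; exact: bigcupT_measurable.
Qed.

Lemma open_measurable_R2 (U : set (R2 R)) : open U -> measurable U.
Proof.
by apply: countable_base_open => //; exact: bigcupT_measurable.
Qed.

End euclidean_borel.

(** Continuity is only required at the points of [D], as functions on the
ambient space, so that the preimage of an open set is the trace of its
interior. *)
Lemma continuous_at_measurable (R : realType) (T : topologicalType) d
    (S : measurableType d) (e : S -> T) (D : set S) (f : T -> R) :
  (forall U, open U -> measurable (D `&` e @^-1` U)) ->
  (forall s, D s -> {for e s, continuous f}) ->
  measurable_fun D (f \o e).
Proof.
move=> oM cf; apply: (measurability _ (RGenOpens.measurableE R)).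
move=> _ [_ [a [b ->] <-]].
rewrite (_ : _ `&` _ = D `&` e @^-1` (interior (f @^-1` `]a, b[))).
  by apply: oM; exact: open_interior.
apply/seteqP; split=> x [Dx fx]; split => //; last exact: interior_subset fx.
by apply: cf => //; apply: open_nbhs_nbhs; split => //; exact: interval_open.
Qed.

(** * The Lagrangian *)

Section lagrangian_regularity.
Context {R : realType} {V : normedModType R}.

(** A form of [C11loc] with explicit bounds on balls, on [f] as well as on its
derivatives, so that it is stable under products. *)
Definition locally_C11 (f : V -> R) : Prop :=
  (forall x, differentiable f x) /\
  forall r : R, exists k : R, 0 <= k /\
    (forall x, `|x| <= r ->
       `|f x| <= k /\ forall v, `|'D_v f x| <= k * `|v|) /\
    (forall x y, `|x| <= r -> `|y| <= r ->
       `|f x - f y| <= k * `|x - y| /\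
       forall v, `|'D_v f x - 'D_v f y| <= k * `|v| * `|x - y|).

Lemma locally_C11_cst (c : R) : locally_C11 (cst c).
Proof.
split=> [x|r]; first exact: differentiable_cst.
exists `|c|; split => //; split => [x xr|x y xr yr].
  by split => // v; rewrite derive_cst normr0 mulr_ge0.
by rewrite subrr normr0 mulr_ge0//; split => // v; rewrite !derive_cst subrr normr0 !mulr_ge0.
Qed.

Lemma locally_C11D f g : locally_C11 f -> locally_C11 g -> locally_C11 (f \+ g).
Proof.
move=> [df hf] [dg hg]; split=> [x|r]; first exact: differentiableD.
have [k [k0 [kf kf']]] := hf r; have [l [l0 [lg lg']]] := hg r.
have DD x v : 'D_v (f \+ g) x = 'D_v f x + 'D_v g x.
  by rewrite deriveD//; exact: diff_derivable.
exists (k + l); split; first exact: addr_ge0.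
split => [x xr|x y xr yr].
  have [fk fk'] := kf x xr; have [gk gk'] := lg x xr.
  split=> [|v]; first exact: le_trans (ler_normD _ _) (lerD _ _).
  by rewrite DD mulrDl; exact: le_trans (ler_normD _ _) (lerD _ _).
have [fk fk'] := kf' x y xr yr; have [gk gk'] := lg' x y xr yr.
split=> [|v]; first by rewrite opprD addrACA mulrDl; exact: le_trans (ler_normD _ _) (lerD _ _).
by rewrite !DD opprD addrACA !mulrDl; exact: le_trans (ler_normD _ _) (lerD _ _).
Qed.

Lemma locally_C11M f g : locally_C11 f -> locally_C11 g -> locally_C11 (f \* g).
Proof.
move=> [df hf] [dg hg]; split=> [x|r]; first exact: differentiableM.
have [k [k0 [kf kf']]] := hf r; have [l [l0 [lg lg']]] := hg r.
have DM x v : 'D_v (f \* g) x = f x * 'D_v g x + g x * 'D_v f x.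
  by rewrite deriveM//; exact: diff_derivable.
exists (4 * (k * l)); split; first by rewrite !mulr_ge0.
have kl0 : 0 <= k * l by rewrite mulr_ge0.
split => [x xr|x y xr yr].
  have [fk fk'] := kf x xr; have [gk gk'] := lg x xr.
  split=> [|v].
    by rewrite normrM (le_trans (ler_pM _ _ fk gk))// ler_peMl//; lra.
  rewrite DM (le_trans (ler_normD _ _))// !normrM.
  have := ler_pM (normr_ge0 _) (normr_ge0 _) fk (gk' v).
  have := ler_pM (normr_ge0 _) (normr_ge0 _) gk (fk' v).
  have := normr_ge0 v; nra.
have bil (a b a' b' A B : R) : `|a| <= A -> `|b'| <= B ->
    `|a * b - a' * b'| <= A * `|b - b'| + B * `|a - a'|.
  move=> aA bB; rewrite (_ : _ - _ = a * (b - b') + b' * (a - a')); last by ring.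
  by rewrite (le_trans (ler_normD _ _))// !normrM lerD// ler_wpM2r.
have [fk fk'] := kf x xr; have [gk gk'] := lg x xr.
have [fy fy'] := kf y yr; have [gy gy'] := lg y yr.
have [fl fl'] := kf' x y xr yr; have [gl gl'] := lg' x y xr yr.
have n0 := normr_ge0 (x - y).
split=> [|v].
  apply: le_trans (bil _ _ _ _ _ _ fk gy) _.
  have := ler_wpM2l k0 gl; have := ler_wpM2l l0 fl.
  have := mulr_ge0 kl0 n0; lra.
rewrite !DM opprD addrACA (le_trans (ler_normD _ _))//.
apply: le_trans (lerD (bil _ _ _ _ _ _ fk (gy' v)) (bil _ _ _ _ _ _ gk (fy' v))) _.
have v0 := normr_ge0 v.
have := ler_wpM2l k0 (gl' v); have := ler_wpM2l l0 (fl' v).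
have := ler_wpM2l (mulr_ge0 l0 v0) fl; have := ler_wpM2l (mulr_ge0 k0 v0) gl.
have := mulr_ge0 (mulr_ge0 kl0 n0) v0; lra.
Qed.

Lemma locally_C11_linear (f : {linear V -> R}) :
  (forall v, `|f v| <= `|v|) -> locally_C11 f.
Proof.
move=> fN; have cf : continuous f.
  move=> x; apply/cvgrPdist_le => /= e e0.
  have : \forall y \near nbhs x, `|x - y| <= e.
    by apply: cvgr_dist_le; [exact: cvg_id|].
  by apply: filterS => y xy; rewrite -raddfB (le_trans (fN _)).
split=> [x|r]; first exact: linear_differentiable.
have Df x v : 'D_v f x = f v.
  by rewrite deriveE ?diff_lin//; exact: linear_differentiable.
exists (Num.max r 1); have m0 : 1 <= Num.max r 1 by rewrite le_max lexx orbT.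
have m1 : 0 <= Num.max r 1 by rewrite (le_trans _ m0).
split=> //; split=> [x xr|x y xr yr].
  split=> [|v]; first by rewrite (le_trans (fN _))// le_max xr.
  by rewrite Df (le_trans (fN _))// ler_peMl.
split=> [|v].
  by rewrite -raddfB (le_trans (fN _))// ler_peMl.
by rewrite !Df subrr normr0 !mulr_ge0.
Qed.

Lemma locally_C11_C11loc (U : set V) f : locally_C11 f -> C11loc U f.
Proof.
move=> [df hf].
have lip r : exists k : R, forall v x y, `|x| <= r -> `|y| <= r ->
    `|'D_v f x - 'D_v f y| <= k * `|v| * `|x - y|.
  have [k [_ [_ hk]]] := hf r; exists k => v x y xr yr.
  by have [_] := hk x y xr yr.
split; last first.
  move=> K cK KU; have [M [Mreal MK]] := compact_bounded cK.
  have [k hk] := lip (M + 1); exists k => v [x y] [/= Kx Ky].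
  by apply: hk; apply: (MK (M + 1)) => //; rewrite ltrDl.
split=> [x _|v x _]; first exact: df.
have [k hk] := lip (`|x| + 1); have xr : `|x| <= `|x| + 1 by rewrite lerDl.
have kv0 : 0 < 1 + `|k| * `|v| by rewrite ltr_pwDl// mulr_ge0.
apply/cvgrPdist_le => /= e e0; near=> y.
have xy : `|x - y| <= e / (1 + `|k| * `|v|).
  by near: y; apply: cvgr_dist_le; [exact: cvg_id|rewrite divr_gt0].
have yr : `|y| <= `|x| + 1.
  rewrite -[y](subrK x) addrC (le_trans (ler_normD _ _))// lerD2l distrC.
  by near: y; apply: cvgr_dist_le; [exact: cvg_id|].
apply: le_trans (hk _ _ _ xr yr) _.
have kk : k * `|v| <= 1 + `|k| * `|v|.
  by rewrite (le_trans (ler_wpM2r _ (ler_norm k)))// lerDr.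
rewrite (le_trans (ler_wpM2r _ kk))// (le_trans (ler_wpM2l (ltW kv0) xy))//.
by rewrite mulrC divfK ?lt0r_neq0.
Unshelve. all: by end_near. Qed.

End lagrangian_regularity.

(** The rotating field [x1 J y], [J (y1, y2) = (-y2, y1)], is the target of the
second column of [z], and zero is the target of the first one. *)
Definition gapL (R : realType) (p : R2 R * R2 R * R22 R) : R :=
  let: ((x, y), z) := p in
  z.1.1 ^+ 2 + z.2.1 ^+ 2 + (z.1.2 + x.1 * y.2) ^+ 2 +
  (z.2.2 - x.1 * y.1) ^+ 2 + (y.1 ^+ 2 + y.2 ^+ 2 - 1) ^+ 2.

Lemma gapL_C11loc (R : realType) (U : set (R2 R * R2 R * R22 R)%type) :
  C11loc U (@gapL R).
Proof.
apply: locally_C11_C11loc.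
have nfst (A B : normedModType R) (x : A * B) : `|x.1| <= `|x|.
  by rewrite prod_normE le_max lexx.
have nsnd (A B : normedModType R) (x : A * B) : `|x.2| <= `|x|.
  by rewrite prod_normE le_max lexx orbT.
pose V := (R2 R * R2 R * R22 R)%type.
have x1 : @locally_C11 R V ((fst \o fst) \o fst).
  apply: locally_C11_linear => v /=.
  exact: le_trans (nfst _ _ _) (le_trans (nfst _ _ _) (nfst _ _ _)).
have y1 : @locally_C11 R V ((fst \o snd) \o fst).
  apply: locally_C11_linear => v /=.
  exact: le_trans (nfst _ _ _) (le_trans (nsnd _ _ _) (nfst _ _ _)).
have y2 : @locally_C11 R V ((snd \o snd) \o fst).
  apply: locally_C11_linear => v /=.
  exact: le_trans (nsnd _ _ _) (le_trans (nsnd _ _ _) (nfst _ _ _)).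
have z11 : @locally_C11 R V ((fst \o fst) \o snd).
  apply: locally_C11_linear => v /=.
  exact: le_trans (nfst _ _ _) (le_trans (nfst _ _ _) (nsnd _ _ _)).
have z12 : @locally_C11 R V ((snd \o fst) \o snd).
  apply: locally_C11_linear => v /=.
  exact: le_trans (nsnd _ _ _) (le_trans (nfst _ _ _) (nsnd _ _ _)).
have z21 : @locally_C11 R V ((fst \o snd) \o snd).
  apply: locally_C11_linear => v /=.
  exact: le_trans (nfst _ _ _) (le_trans (nsnd _ _ _) (nsnd _ _ _)).
have z22 : @locally_C11 R V ((snd \o snd) \o snd).
  apply: locally_C11_linear => v /=.
  exact: le_trans (nsnd _ _ _) (le_trans (nsnd _ _ _) (nsnd _ _ _)).
have sq (f : V -> R) : locally_C11 f -> locally_C11 (f \* f).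
  by move=> hf; exact: locally_C11M.
have := locally_C11D (locally_C11D (locally_C11D (locally_C11D (sq _ z11)
  (sq _ z21)) (sq _ (locally_C11D z12 (locally_C11M x1 y2))))
  (sq _ (locally_C11D z22 (locally_C11M (locally_C11_cst (-1))
    (locally_C11M x1 y1)))))
  (sq _ (locally_C11D (locally_C11D (sq _ y1) (sq _ y2))
    (locally_C11_cst (-1)))).
by congr locally_C11; apply/funext => -[[x y] z] /=; rewrite !expr2 !mulN1r.
Qed.

Lemma gapL_strictly_convex (R : realType) (x y : R2 R) :
  strictly_convex (fun z : R22 R => gapL (x, y, z)).
Proof.
move=> [[z11 z12] [z21 z22]] [[w11 w12] [w21 w22]] t zw t0 t1 /=.
rewrite -subr_gt0 (_ : _ - _ = t * (1 - t) * ((z11 - w11) ^+ 2 +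
  (z21 - w21) ^+ 2 + (z12 - w12) ^+ 2 + (z22 - w22) ^+ 2)); last first.
  by rewrite /GRing.scale/=; ring.
rewrite mulr_gt0 ?mulr_gt0 ?subr_gt0// lt_neqAle.
rewrite !addr_ge0 ?sqr_ge0// andbT eq_sym.
apply: contra zw.
rewrite !paddr_eq0 ?addr_ge0 ?sqr_ge0// !sqrf_eq0 !subr_eq0.
by move=> /andP[/andP[/andP[/eqP-> /eqP->] /eqP->] /eqP->].
Qed.

Lemma gapL_ge0 (R : realType) (p : R2 R * R2 R * R22 R) : 0 <= gapL p.
Proof. by case: p => -[x y] z /=; rewrite !addr_ge0 ?sqr_ge0. Qed.

(** * Smooth functions of one variable and their tensor products *)

Section smooth1.
Context {R : realType}.
Implicit Types f g : R -> R.

Fixpoint Ck1 (n : nat) (f : R -> R) : Prop :=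
  match n with
  | 0%N => continuous f
  | m.+1 => (forall x, derivable f x 1) /\ Ck1 m (derive1 f)
  end.

Definition smooth1 f := forall n, Ck1 n f.

Lemma derive1_add f g x : derivable f x 1 -> derivable g x 1 ->
  derive1 (f \+ g) x = derive1 f x + derive1 g x.
Proof. by move=> df dg; rewrite !derive1E (deriveD df dg). Qed.

Lemma derive1_mul f g x : derivable f x 1 -> derivable g x 1 ->
  derive1 (f \* g) x = f x * derive1 g x + g x * derive1 f x.
Proof. by move=> df dg; rewrite !derive1E (deriveM df dg). Qed.

Lemma Ck1_continuous n f : Ck1 n f -> continuous f.
Proof.
case: n => [//|n] [df _] x; apply: differentiable_continuous.
exact/derivable1_diffP.
Qed.

Lemma Ck1W n f : Ck1 n.+1 f -> Ck1 n f.
Proof.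
elim: n f => [|n IH] f; first exact: (@Ck1_continuous 1).
by move=> [df /IH df'].
Qed.

Lemma Ck1D n f g : Ck1 n f -> Ck1 n g -> Ck1 n (f \+ g).
Proof.
elim: n f g => [|n IH] f g /=.
  by move=> cf cg x; apply: cvgD; [exact: cf|exact: cg].
move=> [df df'] [dg dg']; split; first by move=> x; exact: derivableD.
rewrite (_ : derive1 _ = (derive1 f) \+ (derive1 g)); first exact: IH.
by apply/funext => x; exact: derive1_add.
Qed.

Lemma Ck1M n f g : Ck1 n f -> Ck1 n g -> Ck1 n (f \* g).
Proof.
elim: n f g => [|n IH] f g /=.
  by move=> cf cg x; apply: cvgM; [exact: cf|exact: cg].
move=> [df df'] [dg dg']; split; first by move=> x; exact: derivableM.
rewrite (_ : derive1 _ = (f \* (derive1 g)) \+ (g \* (derive1 f))).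
  have cf := Ck1W (conj df df'); have cg := Ck1W (conj dg dg').
  exact: Ck1D (IH _ _ cf dg') (IH _ _ cg df').
by apply/funext => x; exact: derive1_mul.
Qed.

Lemma Ck1_cst n (c : R) : Ck1 n (cst c).
Proof.
elim: n c => [|n IH] c /=; first exact: cst_continuous.
split=> [x|]; first exact: derivable_cst.
by rewrite (_ : derive1 _ = cst 0)//; apply/funext => x; rewrite derive1_cst.
Qed.

Lemma smooth1_cst (c : R) : smooth1 (cst c).
Proof. by move=> n; exact: Ck1_cst. Qed.

Lemma smooth1D f g : smooth1 f -> smooth1 g -> smooth1 (f \+ g).
Proof. by move=> sf sg n; exact: Ck1D. Qed.

Lemma smooth1M f g : smooth1 f -> smooth1 g -> smooth1 (f \* g).
Proof. by move=> sf sg n; exact: Ck1M. Qed.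

Lemma smooth1_derivable f x : smooth1 f -> derivable f x 1.
Proof. by move=> /(_ 1%N)[]. Qed.

Lemma smooth1_derive f : smooth1 f -> smooth1 (derive1 f).
Proof. by move=> sf n; have [] := sf n.+1. Qed.

Lemma smooth1_continuous f : smooth1 f -> continuous f.
Proof. by move=> /(_ 0%N). Qed.

Lemma smooth1_primitive f F :
  smooth1 f -> (forall x : R, derivable F x 1 /\ (derive1 F) x = f x) -> smooth1 F.
Proof.
move=> sf dF.
case=> [|n] /=; last first.
  split=> [x|]; first by have [] := dF x.
  by rewrite (_ : (derive1 F) = f)//; apply/funext => x; have [] := dF x.
move=> x; apply: differentiable_continuous; apply/derivable1_diffP.
by have [] := dF x.
Qed.

Lemma Ck1_affine n f (a b : R) : Ck1 n f -> Ck1 n (fun x => f (a * x + b)).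
Proof.
have dA (x : R) : is_derive x 1 (fun x : R => a * x + b) a.
  by apply: is_derive_eq; rewrite addr0 /GRing.scale/= mulr1.
elim: n f => [|n IH] f /=.
  move=> cf x; apply: continuous_comp; last exact: cf.
  by apply: differentiable_continuous; apply/derivable1_diffP.
move=> [df df'].
have dfa (x : R) : is_derive x 1 (fun x => f (a * x + b)) (a * (derive1 f) (a * x + b)).
  have df1 : is_derive (a * x + b) 1 f ((derive1 f) (a * x + b)).
    by rewrite derive1E; exact/derivableP.
  have := @is_derive1_comp _ f (fun x : R => a * x + b) x _ _ df1 (dA x).
  by rewrite mulrC.
split => [x|]; first by have [] := dfa x.
rewrite (_ : derive1 _ = cst a \* (fun x => (derive1 f) (a * x + b))).
  by apply: Ck1M; [exact: Ck1_cst|exact: IH].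
by apply/funext => x; rewrite derive1E; have [_ ->] := dfa x.
Qed.

Lemma smooth1_affine f (a b : R) : smooth1 f -> smooth1 (fun x => f (a * x + b)).
Proof. by move=> sf n; exact: Ck1_affine. Qed.

Lemma smooth1_id : smooth1 (@id R).
Proof.
apply: (@smooth1_primitive (cst 1)); first exact: smooth1_cst.
by move=> x; split; [exact: derivable_id|rewrite derive1E derive_id].
Qed.

End smooth1.

Section flat.
Context {R : realType}.

(** [flat k] is [u |-> u^-k exp (-1/u)] extended by zero to [u <= 0]; the
family is closed under differentiation up to linear combinations. *)
Definition flat (k : nat) (u : R) : R :=
  if 0 < u then u^-1 ^+ k * expR (- u^-1) else 0.

Lemma flat_ge0 k u : 0 <= flat k u.
Proof.
rewrite /flat; case: ifPn => // u0.
by rewrite mulr_ge0 ?expR_ge0// exprn_ge0// invr_ge0 ltW.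
Qed.

(** The exponential dominates the term of degree [k.+1] of its series. *)
Lemma flat_le_id k (u : R) : 0 <= u -> flat k u <= (k.+1)`!%:R * u.
Proof.
rewrite le_eqVlt => /predU1P[<-|u0]; first by rewrite /flat ltxx mulr0.
rewrite /flat u0; set y := u^-1; have y0 : 0 < y by rewrite invr_gt0.
have := @expR_ge1Dxn _ _ k (ltW y0); set c : R := (k.+1)`!%:R => h.
have c0 : 0 < c by rewrite ltr0n fact_gt0.
have {h} : y ^+ k.+1 / c <= expR y by rewrite (le_trans _ h)// lerDr.
rewrite ler_pdivrMr// => h.
rewrite expRN ler_pdivrMr ?expR_gt0// -(invrK u) -/y mulrAC ler_pdivlMr//.
by rewrite -exprSr mulrC.
Qed.

(** Away from the origin this is a computation; at the origin the difference
quotient of [flat k] is [flat k.+1], which tends to zero. *)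
Lemma is_derive_flat k (u : R) :
  is_derive u 1 (flat k) (flat k.+2 u - k%:R * flat k.+1 u).
Proof.
have [u0|u0|<-] := ltrgtP 0 u.
- have e : is_derive u 1 (fun v : R => v^-1 ^+ k * expR (- v^-1))
      (flat k.+2 u - k%:R * flat k.+1 u).
    have un0 : u != 0 by rewrite gt_eqF.
    have dV : is_derive u 1 (fun v : R => v^-1) (- u^-1 ^+ 2).
      have := @is_deriveV _ (id : R -> R) u 1 1 un0 (is_derive_id _ _).
      by rewrite /GRing.scale/= mulr1 -exprVn.
    have dE : is_derive u 1 (fun v : R => expR (- v^-1))
        (expR (- u^-1) * u^-1 ^+ 2).
      have dN := is_deriveN dV.
      have := @is_derive1_comp _ expR (fun v : R => - v^-1) u _ _
        (is_derive_expR (- u^-1)) dN.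
      by rewrite opprK.
    have := is_deriveM (is_deriveX k dV) dE.
    rewrite (_ : _ * (fun v : R => expR _) =
      (fun v : R => v^-1 ^+ k * expR (- v^-1))); last first.
      by apply/funext => v; rewrite [LHS]/GRing.mul/= exprfctE.
    congr is_derive; rewrite exprfctE /flat u0 /GRing.scale/=.
    by case: k => [|k] /=; [ring|rewrite !exprS; ring].
  apply: near_eq_is_derive e.
  by near=> v; rewrite /flat ifT//; near: v; exact: lt_nbhsr.
- rewrite [X in is_derive _ _ _ X](_ : _ = 0); last first.
    by rewrite /flat !ltNge (ltW u0)/= mulr0 subr0.
  have c0 : is_derive u 1 (cst (0 : R)) 0 by exact: is_derive_cst.
  apply: near_eq_is_derive c0.
  near=> v; rewrite /flat ifF//; apply/negbTE; rewrite -leNgt ltW//.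
  near: v; exact: lt_nbhsl.
- rewrite {2 3}/flat ltxx mulr0 subr0.
  have dl : (h^-1 *: (flat k (h + 0) - flat k 0)) @[h --> 0^'] --> (0 : R).
    apply/cvgr0Pnorm_le => e e0; near=> h.
    have h0 : h != 0 by near: h; exact: nbhs_dnbhs_neq.
    rewrite addr0 {2}/flat ltxx subr0 normrZ normfV.
    have hle : `|h| <= e / (k.+2)`!%:R.
      near: h; apply: dnbhs0_le; rewrite divr_gt0// ltr0n fact_gt0//.
    have [h_gt0|h_le0] := ltP 0 h; last first.
      by rewrite /flat ltNge h_le0/= normr0 mulr0 ltW.
    rewrite (gtr0_norm h_gt0) ger0_norm ?flat_ge0//.
    have -> : h^-1 * flat k h = flat k.+1 h.
      by rewrite /flat h_gt0 exprS mulrA.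
    rewrite (le_trans (flat_le_id _ (ltW h_gt0)))// mulrC -ler_pdivlMr ?ltr0n ?fact_gt0//.
    by rewrite -(gtr0_norm h_gt0).
  have dl' : (h^-1 *: (flat k (h *: 1 + 0) - flat k 0)) @[h --> 0^'] --> (0 : R).
    by under eq_fun do rewrite -[_ *: 1]/(_ * 1) mulr1.
  apply: DeriveDef; first by apply/cvg_ex; exists 0.
  exact/cvg_lim.
Unshelve. all: by end_near. Qed.

Lemma smooth1_flat : smooth1 (flat 0).
Proof.
move=> n; move: 0%N => k; elim: n k => [|n IH] k /=.
  move=> x; apply: differentiable_continuous; apply/derivable1_diffP.
  by have [] := is_derive_flat k x.
split=> [x|]; first by have [] := is_derive_flat k x.
rewrite (_ : derive1 _ = flat k.+2 \+ (cst (- k%:R) \* flat k.+1)).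
  by apply: Ck1D => //; apply: Ck1M => //; exact: Ck1_cst.
apply/funext => x; rewrite derive1E /= mulNr.
by have [_ ->] := is_derive_flat k x.
Qed.

Lemma flat_le1 (u : R) : flat 0 u <= 1.
Proof.
rewrite /flat; case: ifP => // u0.
by rewrite expr0 mul1r -expR0 ler_expR oppr_le0 invr_ge0 ltW.
Qed.

(** These functions increase to the indicator of the open half-line. *)
Lemma flat_cvg_indic (a x : R) :
  (flat 0 (n%:R * x + n%:R * - a) @[n --> \oo] --> (\1_`]a, +oo[ x : R)).
Proof.
rewrite indicE; have [xa|ax] := leP x a.
  rewrite memNset; last by rewrite /= in_itv/= ltNge xa.
  rewrite (_ : (fun n => _) = cst 0); first exact: cvg_cst.
  apply/funext => n; rewrite /flat -mulrDr ltNge.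
  by rewrite mulr_ge0_le0 ?subr_le0 ?ler0n.
rewrite mem_set /=; last by rewrite in_itv/= ax.
have xa : 0 < x - a by rewrite subr_gt0.
apply/cvgrPdist_le => /= e e0.
near=> n.
have n0 : (0 < n)%N by near: n; exact: nbhs_infty_gt.
rewrite ger0_norm ?subr_ge0 ?flat_le1// /flat -mulrDr mulr_gt0 ?ltr0n//.
rewrite expr0 mul1r lerBlDr -lerBlDl.
rewrite (le_trans _ (expR_ge1Dx _))// lerD2l lerN2 invfM.
rewrite mulrC ler_pdivrMr ?ltr0n// mulrC -ler_pdivrMr// ltW//.
by near: n; exact: nbhs_infty_gtr.
Unshelve. all: by end_near. Qed.

End flat.

Section tensor.
Context {R : realType}.
Implicit Types f g : R -> R.

Definition tensor f g : R2 R -> R := fun x => f x.1 * g x.2.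

Lemma Ck_setTD (V : normedModType R) n (f g : V -> R) :
  Ck n setT f -> Ck n setT g -> Ck n setT (f \+ g).
Proof.
elim: n f g => [|n IH] f g /=.
  by move=> cf cg x _; apply: cvgD; [exact: cf|exact: cg].
move=> [df df'] [dg dg']; split.
  by move=> x _; apply: differentiableD; [exact: df|exact: dg].
move=> v; rewrite (_ : 'D_v _ = 'D_v f \+ 'D_v g); first exact: IH.
apply/funext => x; rewrite deriveD//; apply: diff_derivable; [exact: df|exact: dg].
Qed.

Lemma Ck_setTZ (V : normedModType R) n (c : R) (f : V -> R) :
  Ck n setT f -> Ck n setT (c *: f).
Proof.
elim: n f => [|n IH] f /=.
  by move=> cf x _; apply: cvgZr; exact: cf.
move=> [df df']; split; first by move=> x _; apply: differentiableZ; exact: df.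
move=> v; rewrite (_ : 'D_v _ = c *: 'D_v f); first exact: IH.
by apply/funext => x; rewrite deriveZ//; apply: diff_derivable; exact: df.
Qed.

Let derive_comp_linear (l : {linear R2 R -> R}) f (x : R2 R) : continuous l ->
  derivable f (l x) 1 -> differentiable (f \o l) x /\
  forall v, 'D_v (f \o l) x = l v * derive1 f (l x).
Proof.
move=> cl /derivable1_diffP df.
have dl : differentiable l x by exact: linear_differentiable.
split; first exact: differentiable_comp.
move=> v; rewrite deriveE; last exact: differentiable_comp.
rewrite diff_comp//= diff_lin// derive1E'//.
by rewrite -[in LHS](mulr1 (l v)) -[l v * 1]/(l v *: 1) linearZ.
Qed.

Lemma derive_tensor f g (x : R2 R) :
  (forall t, derivable f t 1) -> (forall t, derivable g t 1) ->
  differentiable (tensor f g) x /\ forall v, 'D_v (tensor f g) x =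
    v.1 * tensor (derive1 f) g x + v.2 * tensor f (derive1 g) x.
Proof.
move=> df dg.
have [d1 D1] := @derive_comp_linear fst f x (fun=> cvg_fst) (df _).
have [d2 D2] := @derive_comp_linear snd g x (fun=> cvg_snd) (dg _).
have -> : tensor f g = (f \o fst) * (g \o snd) by [].
split; first exact: differentiableM.
move=> v; rewrite deriveM; [|exact: diff_derivable|exact: diff_derivable].
by rewrite D1 D2 /tensor /GRing.scale/=; ring.
Qed.

Lemma smooth_tensor f g : smooth1 f -> smooth1 g -> smooth setT (tensor f g).
Proof.
move=> sf sg n; have {sf sg} : Ck1 n f /\ Ck1 n g by [].
elim: n f g => [|n IH] f g /= [].
  move=> cf cg x _; apply: cvgM.
    by apply: cvg_comp; [exact: cvg_fst|exact: cf].
  by apply: cvg_comp; [exact: cvg_snd|exact: cg].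
move=> [df df'] [dg dg']; split.
  by move=> x _; have [] := derive_tensor x df dg.
have cf := Ck1W (conj df df'); have cg := Ck1W (conj dg dg').
move=> v; rewrite (_ : 'D_v _ =
  (v.1 *: tensor (derive1 f) g) \+ (v.2 *: tensor f (derive1 g))).
  by apply: Ck_setTD; apply: Ck_setTZ; exact: IH.
by apply/funext => x; have [_ ->] := derive_tensor x df dg.
Qed.

End tensor.

(** The constant puts the square of the [small] points well inside the disc; it
also makes the term [x1 J h] of the rotating field small against [h], so that
it can be absorbed. *)
Definition small {R : realType} (t : R) : Prop := `|t| <= 8^-1.

Section square.
Context {R : realType}.

Definition supported (f : R -> R) : Prop := forall t, ~ small t -> f t = 0.

Definition square : set (R2 R) := [set x | small x.1 /\ small x.2].

Lemma smallE : [set t : R | small t] = `[- 8^-1, 8^-1]%classic.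
Proof. by apply/seteqP; split => t /=; rewrite in_itv/= /small ler_norml. Qed.

Lemma squareE : square = [set t : R | small t] `*` [set t | small t].
Proof. by []. Qed.

Lemma compact_square : compact square.
Proof. by rewrite squareE smallE; apply: compact_setX; exact: segment_compact. Qed.

Lemma square_sub_disc : square `<=` @unit_disc R.
Proof.
move=> x [x1 x2]; rewrite /unit_disc /=.
have sq (t : R) : small t -> t ^+ 2 <= 8^-1 ^+ 2.
  by move=> st; rewrite -real_normK ?num_real// ler_sqr ?nnegrE// invr_ge0.
have := sq _ x1; have := sq _ x2; lra.
Qed.

Lemma tensor_test_function f g : smooth1 f -> smooth1 g ->
  supported f -> supported g -> test_function (@unit_disc R) (tensor f g).
Proof.
move=> sf sg zf zg.
have csq : closed square.
  by apply: compact_closed compact_square; exact: norm_hausdorff.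
have sub : closure [set x | tensor f g x != 0] `<=` square.
  rewrite (closure_id square).1//; apply: closure_subset => x /= fg0.
  split; apply: contrapT => nx; case/negP: fg0; rewrite /tensor.
    by rewrite zf ?mul0r.
  by rewrite zg ?mulr0.
split; first exact: smooth_tensor.
  by apply: subclosed_compact compact_square sub; exact: closed_closure.
exact: subset_trans sub square_sub_disc.
Qed.

End square.

(** * Functionals continuous for bounded pointwise convergence *)

Section bounded_convergence.
Context {R : realType}.

Definition bmeas d (S : measurableType d) (g : S -> R) : Prop :=
  measurable_fun setT g /\ forall s, `|g s| <= 1.

(** The functionals that integrate against a finite signed measure have these
two properties, which are all that the pi-lambda argument below uses. *)
Definition bc_functional d (S : measurableType d) (T : (S -> R) -> R) : Prop :=
  (forall g1 g2, bmeas g1 -> bmeas g2 -> T (g1 \- g2) = T g1 - T g2) /\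
  (forall (g_ : nat -> S -> R) g, (forall n, bmeas (g_ n)) -> bmeas g ->
     (forall s, g_ n s @[n --> \oo] --> g s) -> T (g_ n) @[n --> \oo] --> T g).

Lemma bc_functionalD d (S : measurableType d) (T U : (S -> R) -> R) :
  bc_functional T -> bc_functional U -> bc_functional (fun g => T g + U g).
Proof.
move=> [lT cT] [lU cU]; split=> [g1 g2 b1 b2|g_ g b_ b gg].
  by rewrite lT// lU//; ring.
by apply: cvgD; [exact: cT|exact: cU].
Qed.

Lemma bmeas_indic d (S : measurableType d) (A : set S) :
  measurable A -> bmeas (\1_A : S -> R).
Proof.
move=> mA; split; first exact: measurable_indic.
by move=> s; rewrite indicE; case: (_ \in _); rewrite ?normr1 ?normr0.
Qed.

Lemma integrable_bounded d (Z : measurableType d)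
    (mu : {measure set Z -> \bar R}) (D : set Z) (W k : Z -> R) (M : R) :
  measurable D -> mu.-integrable D (EFin \o W) -> measurable_fun D k ->
  (forall z, D z -> `|k z| <= M) ->
  mu.-integrable D (EFin \o (fun z => W z * k z)).
Proof.
move=> mD iW mk kM.
have mW : measurable_fun D W by apply/measurable_EFinP; case/integrableP : iW.
have iMW : mu.-integrable D (EFin \o (fun z => M * W z)).
  by apply: eq_integrable (integrableZl mD M iW).
apply: le_integrable iMW => //.
  by apply/measurable_EFinP; exact: measurable_funM.
move=> z Dz /=; rewrite lee_fin !normrM mulrC ler_wpM2r//.
by rewrite (le_trans (kM _ Dz))// ler_norm.
Qed.

Lemma bc_functional_integral dS (S : measurableType dS) dZ
    (Z : measurableType dZ) (mu : {measure set Z -> \bar R}) (W : Z -> R)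
    (pi : Z -> S) :
  mu.-integrable setT (EFin \o W) -> measurable_fun setT pi ->
  bc_functional (fun g => \int[mu]_z (W z * g (pi z))).
Proof.
move=> iW mpi.
have mW : measurable_fun setT W by apply/measurable_EFinP; case/integrableP : iW.
have mgpi g : bmeas g -> measurable_fun setT (g \o pi).
  by move=> [mg _]; exact: measurableT_comp.
have iWg g : bmeas g -> mu.-integrable setT (EFin \o (fun z => W z * g (pi z))).
  move=> bg; apply: (@integrable_bounded _ _ _ _ _ (g \o pi) 1) => //.
    exact: mgpi.
  by move=> z _; exact: bg.2.
split=> [g1 g2 b1 b2|g_ g b_ b gg].
  by under eq_Rintegral do rewrite mulrBr; rewrite RintegralB//; exact: iWg.
apply: fine_cvg.
rewrite fineK; last by apply: integrable_fin_num => //; exact: iWg.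
have [] := @dominated_convergence _ _ _ mu setT measurableT
  (fun n z => (W z * g_ n (pi z))%:E) (fun z => (W z * g (pi z))%:E)
  (fun z => `|W z|%:E) => //.
- move=> n; apply/measurable_EFinP/measurable_funM => //.
  exact: mgpi (b_ n).
- by apply/measurable_EFinP/measurable_funM => //; exact: mgpi.
- apply: aeW => z _; apply: cvg_EFin; first by near=> n.
  by apply: cvgM; [exact: cvg_cst|exact: gg].
- exact: integrable_abse iW.
- apply: aeW => z n _; rewrite abse_EFin lee_fin normrM ler_piMr//.
  exact: (b_ n).2.
Unshelve. all: by end_near. Qed.

(** The sets on whose indicators [T] vanishes form a lambda-system. *)
Lemma bc_functional_eq0 d (S : measurableType d) (G : set (set S))
    (T : (S -> R) -> R) :
  (@measurable _ S) `<=` <<s G >> -> G `<=` @measurable _ S -> setI_closed G ->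
  bc_functional T -> T (cst 1) = 0 -> (forall A, G A -> T \1_A = 0) ->
  forall A, measurable A -> T \1_A = 0.
Proof.
move=> GS mG GI [lT cT] T1 TG A /GS.
suff : <<s G >> `<=` [set A | measurable A /\ T \1_A = 0].
  by move=> /[apply] -[].
apply: lambda_system_subset => //; last first.
  by move=> B GB; split; [exact: mG|exact: TG].
split => //.
- split => //; rewrite (_ : \1_ _ = cst 1)//.
  by apply/funext => s; rewrite indicT.
- move=> B C CB [mB TB] [mC TC]; split; first exact: measurableD.
  rewrite (_ : \1_ _ = (\1_B : S -> R) \- \1_C).
    by rewrite lT ?TB ?TC ?subrr//; exact: bmeas_indic.
  apply/funext => s /=; rewrite !indicE.
  have [Bs|Bs] := boolP (s \in B); have [Cs|Cs] := boolP (s \in C).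
  + by rewrite memNset ?subrr// => -[_]; apply; exact: set_mem.
  + rewrite mem_set ?subr0//; split; first exact: set_mem.
    by move/mem_set; exact/negP.
  + by case/negP : Bs; apply/mem_set/CB/set_mem.
  + by rewrite memNset ?subrr// => -[/mem_set Bs' _]; move/negP : Bs.
- move=> F ndF TF; have mF n : measurable (F n) by have [] := TF n.
  have mU : measurable (\bigcup_n F n) by exact: bigcupT_measurable.
  split => //.
  have : T \1_(F n) @[n --> \oo] --> T \1_(\bigcup_n F n).
    apply: cT => [n| |s]; [exact: bmeas_indic|exact: bmeas_indic|].
    rewrite [X in _ --> X]indicE.
    have [/set_mem[n _ Fns]|Fs] := boolP (s \in \bigcup_n F n).
      apply: cvg_near_cst; near=> m; rewrite indicE mem_set//.
      have /subsetPset : (F n <= F m)%O.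
        by apply: ndF; near: m; exact: nbhs_infty_ge.
      exact.
    apply: cvg_near_cst; near=> m; rewrite indicE memNset// => Fms.
    by case/negP : Fs; apply/mem_set; exists m.
  have -> : (fun n => T \1_(F n)) = cst 0 by apply/funext => n; have [] := TF n.
  by move/(cvg_lim (@Rhausdorff R)); rewrite lim_cst//; exact: Rhausdorff.
Unshelve. all: by end_near. Qed.

End bounded_convergence.

Section tensor_functional.
Context {R : realType}.
Local Notation MR := (measurableTypeR R).

Definition ray : set (set R) :=
  [set A | A = setT \/ exists a, A = `]a, +oo[%classic].

Lemma ray_approx A : ray A -> exists b : nat -> R -> R, forall n,
  [/\ smooth1 (b n), forall t, 0 <= b n t <= 1 &
      forall t, b k t @[k --> \oo] --> (\1_A t : R)].
Proof.
case=> [->|[a ->]].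
  exists (fun _ _ => 1) => n; split.
  - exact: smooth1_cst.
  - by move=> t; rewrite ler01 lexx.
  - by move=> t; rewrite indicT; exact: cvg_cst.
exists (fun n t => flat 0 (n%:R * t + n%:R * - a)) => n; split.
- exact: smooth1_affine smooth1_flat.
- by move=> t; rewrite flat_ge0 flat_le1.
- by move=> t; exact: flat_cvg_indic.
Qed.

Let quarter := [set A `*` B | A in ray & B in ray].

Let quarter_generates :
  (@measurable _ (MR * MR)%type) `<=` <<s quarter >>.
Proof.
have mf (f : g_sigma_algebraType quarter -> R) :
    (forall a, quarter (f @^-1` `]a, +oo[%classic)) ->
    measurable_fun setT f.
  move=> qf; apply: (measurability _ (RGenOInfty.measurableE R)).
  move=> _ [_ [a ->] <-]; rewrite setTI.
  by apply: sub_sigma_algebra; exact: qf.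
apply: smallest_sub; first exact: smallest_sigma_algebra.
move=> _ [] [A mA <-].
  apply: (mf fst) => // a; exists `]a, +oo[%classic; first by right; exists a.
  by exists setT; [left|rewrite setXT].
apply: (mf snd) => // a; exists setT; first by left.
by exists `]a, +oo[%classic; [right; exists a|rewrite setTX].
Qed.

Lemma ray_setI : setI_closed ray.
Proof.
move=> A B [->|[a ->]]; first by rewrite setTI.
move=> [->|[b ->]]; first by rewrite setIT; right; exists a.
right; exists (Num.max a b); apply/seteqP; split => t /=.
  by rewrite !in_itv/= !andbT gt_max => -[-> ->].
by rewrite !in_itv/= !andbT gt_max => /andP[].
Qed.

(** Tensor products of smooth functions are total in the space of bounded Borel
functions for bounded pointwise convergence: they approximate the indicators of
open quarter planes, which are stable under intersection and generate the Borel
sets. *)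
Lemma tensor_functional_eq0 (T : (MR * MR -> R) -> R) :
  bc_functional T ->
  (forall b c, smooth1 b -> smooth1 c -> (forall t, 0 <= b t <= 1) ->
     (forall t, 0 <= c t <= 1) -> T (tensor b c) = 0) ->
  forall A, measurable A -> T \1_A = 0.
Proof.
move=> bT Tbc; apply: (bc_functional_eq0 quarter_generates) => //.
- move=> _ [A rA [B rB <-]].
  have mr (C : set MR) : ray C -> measurable C.
    by move=> [->|[a ->]] //; exact: measurable_itv.
  by apply: measurableX; exact: mr.
- move=> _ _ [A rA [B rB <-]] [C rC [D rD <-]]; rewrite -setXI.
  by exists (A `&` C); [exact: ray_setI|exists (B `&` D) => //; exact: ray_setI].
- rewrite (_ : cst 1 = tensor (cst 1) (cst 1)).
    by apply: Tbc => [||t|t]; rewrite ?ler01 ?lexx//; exact: smooth1_cst.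
  by apply/funext => x; rewrite /tensor mul1r.
- move=> _ [A rA [B rB <-]].
  have [b hb] := ray_approx rA; have [c hc] := ray_approx rB.
  have b01 n t : 0 <= b n t <= 1 by have [] := hb n.
  have c01 n t : 0 <= c n t <= 1 by have [] := hc n.
  have [_ cT] := bT.
  have : T (tensor (b n) (c n)) @[n --> \oo] --> T \1_(A `*` B).
    apply: cT => [n| |s].
    + have [sb _ _] := hb n; have [sc _ _] := hc n; split.
        apply: measurable_funM; apply: measurableT_comp => //.
          by apply: continuous_measurable_fun; exact: smooth1_continuous.
        by apply: continuous_measurable_fun; exact: smooth1_continuous.
      move=> s; rewrite /tensor normrM.
      have /andP[b0 b1] := b01 n s.1; have /andP[c0 c1] := c01 n s.2.
      by rewrite !ger0_norm// mulr_ile1.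
    + apply: bmeas_indic; apply: measurableX.
        by case: rA => [->|[a ->]] //; exact: measurable_itv.
      by case: rB => [->|[a ->]] //; exact: measurable_itv.
    + rewrite (_ : \1_(A `*` B) s = \1_A s.1 * \1_B s.2).
        have [_ _ bA] := hb 0%N; have [_ _ cB] := hc 0%N.
        by apply: cvgM; [exact: bA|exact: cB].
      by rewrite !indicE in_setX -natrM mulnb.
  rewrite (_ : (fun n => T _) = cst 0).
    by move/(cvg_lim (@Rhausdorff R)); rewrite lim_cst//; exact: Rhausdorff.
  apply/funext => n; have [sb _ _] := hb n; have [sc _ _] := hc n.
  exact: Tbc.
Qed.

End tensor_functional.

(** * Fubini for kernels dominated by a product *)

Section kernel.
Context {R : realType} d1 d2 (T1 : measurableType d1) (T2 : measurableType d2).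
Variables (m1 : {sigma_finite_measure set T1 -> \bar R})
          (m2 : {sigma_finite_measure set T2 -> \bar R}).
Implicit Types (F : T1 -> R) (W : T2 -> R) (k : T1 * T2 -> R).

Let intM d (T : measurableType d) (m : {measure set T -> \bar R}) (f : T -> R) :
  m.-integrable setT (EFin \o f) -> measurable_fun setT f.
Proof. by move=> /integrableP[/measurable_EFinP]. Qed.

Lemma integrable_tensor F W :
  m1.-integrable setT (EFin \o F) -> m2.-integrable setT (EFin \o W) ->
  (m1 \x m2)%E.-integrable setT (EFin \o (fun z => F z.1 * W z.2)).
Proof.
move=> iF iW; have mF := intM iF; have mW := intM iW.
apply/integrable12ltyP => /=.
  apply/measurable_EFinP/measurable_funM.
    exact: measurableT_comp.
  exact: measurableT_comp.
under eq_integral => x _.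
  under eq_integral => y _ do rewrite normrM EFinM.
  rewrite ge0_integralZl//; last first.
    by apply/measurable_EFinP; exact: measurableT_comp.
  over.
rewrite /= ge0_integralZr//; last 2 first.
- by apply/measurable_EFinP; exact: measurableT_comp.
- by apply: integral_ge0 => y _; rewrite lee_fin.
case/integrableP : iF => _ /= iF; case/integrableP : iW => _ /= iW.
by rewrite lte_mul_pinfty// ?integral_ge0// ge0_fin_numE// integral_ge0.
Qed.

Lemma integrable_kernel F W k :
  m1.-integrable setT (EFin \o F) -> m2.-integrable setT (EFin \o W) ->
  measurable_fun setT k -> (forall z, `|k z| <= 1) ->
  (m1 \x m2)%E.-integrable setT (EFin \o (fun z => F z.1 * W z.2 * k z)).
Proof.
move=> iF iW mk k1.
by apply: integrable_bounded (integrable_tensor iF iW) mk _ => // z _.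
Qed.

Lemma Rintegral_kernel F W k :
  m1.-integrable setT (EFin \o F) -> m2.-integrable setT (EFin \o W) ->
  measurable_fun setT k -> (forall z, `|k z| <= 1) ->
  \int[(m1 \x m2)%E]_z (F z.1 * W z.2 * k z) =
  \int[m1]_x (F x * \int[m2]_y (W y * k (x, y))).
Proof.
move=> iF iW mk k1; rewrite /Rintegral -integral12_prod_meas1; last first.
  exact: integrable_kernel.
congr fine; apply: eq_integral => x _; rewrite /fubini_F/=.
have iWk : m2.-integrable setT (EFin \o (fun y => W y * k (x, y))).
  apply: (integrable_bounded measurableT iW _ (fun z _ => k1 (x, z))).
  exact: measurableT_comp.
rewrite EFinM fineK; last exact: integrable_fin_num.
rewrite -integralZl//; apply: eq_integral => y _ /=.
by rewrite -EFinM mulrA.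
Qed.

Lemma Rintegral_tensor F W :
  m1.-integrable setT (EFin \o F) -> m2.-integrable setT (EFin \o W) ->
  \int[(m1 \x m2)%E]_z (F z.1 * W z.2) = \int[m1]_x F x * \int[m2]_y W y.
Proof.
move=> iF iW.
have k1 (z : T1 * T2) : `|(cst 1 z : R)| <= 1 by rewrite normr1.
have := Rintegral_kernel iF iW (measurable_cst _) k1.
under eq_Rintegral do rewrite mulr1.
move=> ->; under eq_Rintegral do under eq_Rintegral do rewrite mulr1.
by rewrite RintegralZr.
Qed.

Lemma le_Rintegral_kernel F W k :
  m1.-integrable setT (EFin \o F) -> m2.-integrable setT (EFin \o W) ->
  measurable_fun setT k -> (forall z, `|k z| <= 1) ->
  `|\int[(m1 \x m2)%E]_z (F z.1 * W z.2 * k z)| <=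
  \int[m1]_x `|F x| * \int[m2]_y `|W y|.
Proof.
move=> iF iW mk k1; have ik := integrable_kernel iF iW mk k1.
have iF' : m1.-integrable setT (EFin \o (fun x => `|F x|)).
  exact: (integrable_abse iF).
have iW' : m2.-integrable setT (EFin \o (fun x => `|W x|)).
  exact: (integrable_abse iW).
rewrite -(Rintegral_tensor iF' iW') (le_trans (le_normr_Rintegral _ ik))//.
apply: le_Rintegral => //.
- exact: (integrable_abse ik).
- exact: (integrable_tensor iF' iW').
- by move=> z _; rewrite !normrM ler_piMr// mulr_ge0.
Qed.

End kernel.

Section area.
Variable R : realType.
Local Notation MR := (measurableTypeR R).

(** The same function as [leb2 R], but a constant of its own to which a
sigma-finite structure can be attached. *)
Definition area : set (MR * MR) -> \bar R :=
  (@lebesgue_measure R \x @lebesgue_measure R)%E.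

HB.instance Definition _ := Measure.copy area
  (@lebesgue_measure R \x @lebesgue_measure R)%E.

Let area_sigma_finite : sigma_finite setT area.
Proof.
have /sigma_finiteP[F [TF ndF Foo]] := sigma_finiteT (@lebesgue_measure R).
exists (fun n => F n `*` F n) => [|n].
  rewrite -setXTT TF predeqE => -[x y]; split.
    move=> [/= [n _ Fnx] [k _ Fky]]; exists (maxn n k) => //; split.
    - by move: x Fnx; exact/subsetPset/ndF/leq_maxl.
    - by move: y Fky; exact/subsetPset/ndF/leq_maxr.
  by move=> [n _ []/= ? ?]; split; exists n.
have [mF Foon] := Foo n; split; first exact: measurableX.
by rewrite /area product_measure1E// lte_mul_pinfty// ge0_fin_numE.
Qed.

HB.instance Definition _ := @Measure_isSigmaFinite.Build _ _ R area
  area_sigma_finite.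

End area.
Arguments area {R}.

Lemma Rintegral_area_tensor (R : realType) (f g : R -> R) :
  lebesgue_measure.-integrable setT (EFin \o f) ->
  lebesgue_measure.-integrable setT (EFin \o g) ->
  \int[@area R]_x tensor f g x =
  \int[lebesgue_measure]_t f t * \int[lebesgue_measure]_t g t.
Proof. exact: Rintegral_tensor. Qed.

Lemma integrable_area_tensor (R : realType) (f g : R -> R) :
  lebesgue_measure.-integrable setT (EFin \o f) ->
  lebesgue_measure.-integrable setT (EFin \o g) ->
  (@area R).-integrable setT (EFin \o tensor f g).
Proof. exact: integrable_tensor. Qed.

(** * Bumps and their primitives *)

Section supported.
Context {R : realType}.
Local Notation lam := (@lebesgue_measure R).
Implicit Types f g : R -> R.

Lemma supported_bounded f : continuous f -> supported f ->
  exists2 M, 0 <= M & forall t, `|f t| <= M.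
Proof.
move=> cf sf.
have : compact (f @` `[- 8^-1, 8^-1]%classic).
  apply: continuous_compact; last exact: segment_compact.
  exact: continuous_subspaceT.
move=> /compact_bounded[M [Mreal MK]].
exists (`|M| + 1) => [|t]; first by rewrite addr_ge0.
have [st|/sf ->] := pselect (small t); last by rewrite normr0 addr_ge0.
apply: (MK (`|M| + 1)); first by rewrite ltr_pwDr// ler_norm.
by exists t => //; rewrite -smallE.
Qed.

Lemma supported_integrable f : continuous f -> supported f ->
  lam.-integrable setT (EFin \o f).
Proof.
move=> cf sf.
have -> : EFin \o f = (EFin \o f) \_ `[- 8^-1, 8^-1]%classic.
  apply/funext => t; rewrite patchE -smallE; case: ifPn => //.
  by rewrite notin_setE /= => /sf ->.
apply/(integrable_mkcond _ _).1; first exact: measurable_itv.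
apply: continuous_compact_integrable; first exact: segment_compact.
exact: continuous_subspaceT.
Qed.

Lemma supportedM f g : supported f -> supported (f \* g).
Proof. by move=> sf t /sf /= ->; rewrite mul0r. Qed.

Lemma supported_derive f : supported f -> supported (derive1 f).
Proof.
move=> sf t nt; rewrite derive1E.
have nt' : 8^-1 < `|t| by rewrite ltNge; exact/negP.
have c0 : is_derive t 1 (cst (0 : R)) 0 by exact: is_derive_cst.
suff /near_eq_is_derive/(_ c0)[] : \near t, cst 0 t = f t by [].
have : \forall u \near t, 8^-1 < `|u|.
  exact: (cvgr_gt _ (@norm_continuous _ R t) _ nt').
by apply: filterS => u u8; rewrite /= sf// /small; apply/negP; rewrite -ltNge.
Qed.

Definition prim f (r : R) : R := \int[lam]_(t in `]-oo, r]%classic) f t.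

Lemma primE f r : prim f r = \int[lam]_t (f t * (t <= r)%R%:R).
Proof.
rewrite /prim Rintegral_mkcond; apply: eq_Rintegral => t _.
rewrite patchE; have [tr|tr] := leP t r.
  by rewrite mem_set ?mulr1//= in_itv/=.
by rewrite memNset ?mulr0//= in_itv/= leNgt tr.
Qed.

Lemma is_derive_prim f : continuous f -> supported f ->
  forall r, derivable (prim f) r 1 /\ derive1 (prim f) r = f r.
Proof.
move=> cf sf r; apply: (@continuous_FTC1 _ f -oo%O r (r + 1)).
- by rewrite ltrDl.
- by apply: integrableS (supported_integrable cf sf).
- by rewrite ltNyr.
- exact: cf.
Qed.

Lemma prim_eq0 f r : supported f -> r < - 8^-1 -> prim f r = 0.
Proof.
move=> sf r8; rewrite primE.
under eq_Rintegral => t _.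
  rewrite (_ : _ * _ = 0); last first.
    have [tr|] := leP t r; last by rewrite mulr0.
    rewrite sf ?mul0r// /small ler_norml => /andP[] ; lra.
  over.
by rewrite Rintegral_cst// mul0r.
Qed.

Lemma prim_full f r : supported f -> 8^-1 < r -> prim f r = \int[lam]_t f t.
Proof.
move=> sf r8; rewrite primE; apply: eq_Rintegral => t _.
have [tr|rt] := leP t r; first by rewrite mulr1.
by rewrite mulr0 sf// /small ler_norml => /andP[]; lra.
Qed.

Lemma bump_exists : exists a : R -> R,
  [/\ smooth1 a, supported a, forall t, 0 <= a t & \int[lam]_t a t = 1].
Proof.
pose b (t : R) : R := flat 0 (1 * t + 8^-1) * flat 0 (-1 * t + 8^-1).
have sb : smooth1 b.
  by apply: smooth1M; exact: smooth1_affine smooth1_flat.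
have supb : supported b.
  move=> t /negP; rewrite -ltNge lter_normr => /orP[] t8; rewrite /b /flat.
    by rewrite [in X in _ * X]ltNge (_ : _ <= 0) ?mulr0//; lra.
  by rewrite ltNge (_ : _ <= 0) ?mul0r//; lra.
have b0 t : 0 <= b t by rewrite mulr_ge0 ?flat_ge0.
have ib := supported_integrable (smooth1_continuous sb) supb.
have Ib : 0 < \int[lam]_t b t.
  (* On [-1/16, 1/16] both factors of [b] are at least [expR (-16)]. *)
  pose c : R := expR (- 16) * expR (-16).
  have : \int[lam]_(t in `[- 16^-1, 16^-1]%classic) c <= \int[lam]_t b t.
    rewrite Rintegral_mkcond; apply: le_Rintegral => //.
      have : lam.-integrable `[- 16^-1, 16^-1]%classic (EFin \o cst c).
        apply: continuous_compact_integrable; first exact: segment_compact.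
        by apply: continuous_subspaceT; exact: cst_continuous.
      rewrite -restrict_EFin.
      by move=> ic; apply/(integrable_mkcond _ _).1 => //; exact: measurable_itv.
    move=> t _; rewrite patchE; case: ifPn => // /set_mem/=.
    rewrite in_itv/= => /andP[t1 t2].
    have f16 (u : R) : 16^-1 <= u -> expR (-16) <= flat 0 u.
      move=> u16; have u0 : 0 < u by rewrite (lt_le_trans _ u16).
      by rewrite /flat u0 expr0 mul1r ler_expR lerN2 -[leRHS]invrK lef_pV2 ?posrE.
    by apply: ler_pM; rewrite ?expR_ge0//; apply: f16; lra.
  apply: lt_le_trans; rewrite Rintegral_cst; last exact: measurable_itv.
  rewrite [X in _ * fine X](_ : _ = (8^-1)%:E); last first.
    apply: etrans (lebesgue_measure_itv _) _.
    rewrite /= lte_fin ifT; last by lra.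
    by rewrite -EFinD; congr EFin; lra.
  by rewrite mulr_gt0 ?mulr_gt0 ?expR_gt0 /= ?invr_gt0.
exists (fun t => (\int[lam]_t b t)^-1 * b t); split.
- by apply: smooth1M => //; exact: smooth1_cst.
- by move=> t /supb ->; rewrite mulr0.
- by move=> t; rewrite mulr_ge0// invr_ge0 ltW.
- by rewrite RintegralZl// mulVf// gt_eqF.
Qed.

End supported.

(** * Weak derivatives tested against tensor products *)

Section weak_tensor.
Context {R : realType}.
Implicit Types (f g p q : R2 R -> R) (a b : R -> R).

Lemma measurable_square : measurable (@square R : set (R2 (measurableTypeR R))).
Proof.
by rewrite squareE smallE; apply: measurableX; exact: measurable_itv.
Qed.

(** A locally integrable function on the disc becomes integrable on the plane
once it is cut off to the square; against test functions supported in the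
square nothing changes. *)
Definition on_square f : R2 R -> R := f \_ square.

Lemma on_square_integrable f : loc_integrable (@unit_disc R) f ->
  (@area R).-integrable setT (EFin \o on_square f).
Proof.
move=> [_ /(_ square compact_square (@square_sub_disc R)) fi].
rewrite /on_square -restrict_EFin.
by apply/(integrable_mkcond _ measurable_square).1.
Qed.

Lemma on_square_tensor f a b x : supported a -> supported b ->
  on_square f x * tensor a b x = f x * tensor a b x.
Proof.
move=> sa sb; rewrite /on_square patchE; case: ifPn => //.
rewrite notin_setE => nx; rewrite mul0r /tensor.
have [s1|/sa ->] := pselect (small x.1); last by rewrite mul0r mulr0.
have [s2|/sb ->] := pselect (small x.2); last by rewrite !mulr0.
by case: nx.
Qed.

Lemma derive_basis_tensor l a b x : smooth1 a -> smooth1 b ->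
  'D_(basis2 R l) (tensor a b) x =
  if l == ord0 then tensor (derive1 a) b x else tensor a (derive1 b) x.
Proof.
move=> sa sb.
have [_ ->] := @derive_tensor R a b x (fun t => smooth1_derivable sa)
  (fun t => smooth1_derivable sb).
case: l => -[|[|//]] l2 /=; rewrite /basis2/=.
  by rewrite mul1r mul0r addr0.
by rewrite mul1r mul0r add0r.
Qed.

Let weak_tensor l f g a b : weak_partial (@unit_disc R) l f g ->
  smooth1 a -> smooth1 b -> supported a -> supported b ->
  \int[area]_x (on_square f x * if l == ord0 then tensor (derive1 a) b x
                          else tensor a (derive1 b) x) =
  - \int[area]_x (on_square g x * tensor a b x).
Proof.
move=> [_ _ fg] sa sb za zb.
have := fg _ (tensor_test_function sa sb za zb).
have mk (k : R2 R -> R) c d : supported c -> supported d ->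
    (\int[leb2 R]_(x in @unit_disc R) (k x * tensor c d x)%:E =
     \int[area]_x (on_square k x * tensor c d x)%:E)%E.
  move=> zc zd; rewrite integral_mkcond; apply: eq_integral => x _.
  rewrite on_square_tensor// patchE; case: ifPn => //; rewrite notin_setE => nx.
  congr EFin; rewrite -(on_square_tensor k x zc zd) /on_square patchE memNset ?mul0r//.
  by move=> /square_sub_disc.
under eq_integral do rewrite derive_basis_tensor//.
move=> H.
have {}H : (\int[leb2 R]_(x in @unit_disc R) (f x * if l == ord0 then
  tensor (derive1 a) b x else tensor a (derive1 b) x)%:E =
  - \int[area]_x (on_square g x * tensor a b x)%:E)%E by rewrite H mk.
move: H; have da := supported_derive za; have db := supported_derive zb.
by case: (l == ord0) => /=; rewrite mk// => H; rewrite /Rintegral H fineN.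
Qed.

Lemma weak_tensor1 f g a b : weak_partial (@unit_disc R) ord0 f g ->
  smooth1 a -> smooth1 b -> supported a -> supported b ->
  \int[area]_x (on_square f x * tensor (derive1 a) b x) =
  - \int[area]_x (on_square g x * tensor a b x).
Proof. exact: (@weak_tensor ord0). Qed.

Lemma weak_tensor2 f g a b : weak_partial (@unit_disc R) ord_max f g ->
  smooth1 a -> smooth1 b -> supported a -> supported b ->
  \int[area]_x (on_square f x * tensor a (derive1 b) x) =
  - \int[area]_x (on_square g x * tensor a b x).
Proof. exact: (@weak_tensor ord_max). Qed.

End weak_tensor.

(** * Oscillation of a weakly differentiable function *)

Lemma measurable_le_indic (R : realType) d (Z : measurableType d) (u v : Z -> R) :
  measurable_fun setT u -> measurable_fun setT v ->
  measurable_fun setT (fun z => (u z <= v z)%R%:R : R).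
Proof.
move=> mu mv.
rewrite (_ : (fun z => _) = \1_(setT `&` [set z | u z <= v z])).
  by apply: measurable_indic; exact: measurable_fun_le.
apply/funext => z; rewrite indicE setTI; congr (nat_of_bool _)%:R.
by apply/idP/idP => [uv|/set_mem//]; exact/mem_set.
Qed.

Section oscillation.
Context {R : realType}.
Local Notation lam := (@lebesgue_measure R).
Variables (al : R -> R) (f p q : R2 R -> R).
Hypotheses (sal : smooth1 al) (zal : supported al) (al0 : forall t, 0 <= al t)
  (al1 : \int[lam]_t al t = 1).
Hypotheses (fp : weak_partial (@unit_disc R) ord0 f p)
  (fq : weak_partial (@unit_disc R) ord_max f q).

Let A := prim al.

Let sA : smooth1 A.
Proof.
by apply: (smooth1_primitive sal) => r; apply: is_derive_prim zal r;
  exact: smooth1_continuous.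
Qed.

Let ial : lam.-integrable setT (EFin \o al).
Proof. exact: supported_integrable (smooth1_continuous sal) zal. Qed.

Let integrable_al_le (b : R -> R) r : smooth1 b ->
  lam.-integrable setT (EFin \o (fun t => al t * b t * (t <= r)%R%:R)).
Proof.
move=> sb; apply: (integrable_bounded (M := 1)) => //.
- apply: supported_integrable; last exact: supportedM.
  by apply: smooth1_continuous; exact: smooth1M.
- exact: measurable_le_indic.
- by move=> t _; case: (t <= r); rewrite ?normr0 ?normr1.
Qed.

Let A01 r : 0 <= A r <= 1.
Proof.
rewrite /A primE; apply/andP; split.
  by apply: Rintegral_ge0 => t _; rewrite mulr_ge0.
rewrite -[leRHS]al1; apply: le_Rintegral => //.
  apply: eq_integrable (integrable_al_le r (smooth1_cst 1)) => //.
  by move=> t _ /=; rewrite mulr1.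
by move=> t _; case: (t <= r); rewrite ?mulr0 ?mulr1.
Qed.

(** The kernel of the integral operator that inverts [d/dr] on functions whose
average against [al] vanishes. *)
Let K (t r : R) : R := (t <= r)%R%:R - A r.

Let K1 t r : `|K t r| <= 1.
Proof.
have /andP[a0 a1] := A01 r; rewrite /K ler_norml.
by case: (t <= r) => /=; apply/andP; split; lra.
Qed.

Let mK d (Z : measurableType d) (u v : Z -> R) : measurable_fun setT u ->
  measurable_fun setT v -> measurable_fun setT (fun z => K (u z) (v z)).
Proof.
move=> mu mv; apply: measurable_funB; first exact: measurable_le_indic.
apply: measurableT_comp mv.
by apply: continuous_measurable_fun; exact: smooth1_continuous.
Qed.

(** A primitive of [al (b - c)], with [c] the average of [b] against [al]; it has
compact support because the average has been removed. *)
Let osc (b : R -> R) : R -> R :=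
  prim (al \* b) \- (cst (\int[lam]_t (al t * b t)) \* A).

Let oscP b : smooth1 b -> [/\ smooth1 (osc b), supported (osc b),
  forall r, derive1 (osc b) r =
    al r * b r - (\int[lam]_t (al t * b t)) * al r &
  forall r, \int[lam]_t (al t * b t * K t r) = osc b r].
Proof.
move=> sb; have sab : smooth1 (al \* b) by exact: smooth1M.
have zab : supported (al \* b) by exact: supportedM.
have cab := smooth1_continuous sab; have cal := smooth1_continuous sal.
have iab := supported_integrable cab zab.
set c := \int[lam]_t (al t * b t).
have oscE : osc b = prim (al \* b) \+ (cst (- c) \* A).
  by apply/funext => r; rewrite /osc /= mulNr.
have sosc : smooth1 (osc b).
  rewrite oscE; apply: smooth1D.
    by apply: (smooth1_primitive sab) => r; exact: is_derive_prim.
  by apply: smooth1M => //; exact: smooth1_cst.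
have dosc r : derive1 (osc b) r = al r * b r - c * al r.
  have [d1 e1] := is_derive_prim cab zab r.
  have [d2 e2] := is_derive_prim cal zal r.
  have dc : derivable (cst (- c) : R -> R) r 1 by exact: derivable_cst.
  rewrite oscE (derive1_add d1 (derivableM dc d2)).
  by rewrite (derive1_mul dc d2) e1 e2 derive1_cst mulr0 addr0 mulNr.
split => //.
  move=> r /negP; rewrite -ltNge lter_normr => /orP[] r8; rewrite /osc /A /=.
    by rewrite !prim_full// al1 mulr1 subrr.
  by rewrite !prim_eq0 ?mulr0 ?subrr//; lra.
move=> r; rewrite /osc/= primE -/c.
under [LHS]eq_Rintegral do rewrite /K mulrBr.
rewrite RintegralB//; [|exact: integrable_al_le|].
  by rewrite RintegralZr.
apply: (integrable_bounded (M := 1)) => // t _.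
by have /andP[a0 a1] := A01 r; rewrite ger0_norm.
Qed.

Let if_ : loc_integrable (@unit_disc R) f. Proof. by case: fp. Qed.
Let ip : loc_integrable (@unit_disc R) p. Proof. by case: fp. Qed.
Let iq : loc_integrable (@unit_disc R) q. Proof. by case: fq. Qed.

Let mc (a : R -> R) : smooth1 a -> measurable_fun setT (a : measurableTypeR R -> R).
Proof.
by move=> sa; apply: continuous_measurable_fun; exact: smooth1_continuous.
Qed.

Let mt (a b : R -> R) : smooth1 a -> smooth1 b ->
  measurable_fun setT (tensor a b : R2 (measurableTypeR R) -> R).
Proof.
by move=> sa sb; apply: measurable_funM; apply: measurableT_comp => //; exact: mc.
Qed.

Lemma integrable_on_square_tensor g a b : loc_integrable (@unit_disc R) g ->
  smooth1 a -> smooth1 b -> supported a -> supported b ->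
  (@area R).-integrable setT (EFin \o (fun x => on_square g x * tensor a b x)).
Proof.
move=> ig sa sb za zb.
have [Ma Ma0 hMa] := supported_bounded (smooth1_continuous sa) za.
have [Mb Mb0 hMb] := supported_bounded (smooth1_continuous sb) zb.
apply: (integrable_bounded (M := Ma * Mb)) => //; first exact: on_square_integrable.
  exact: mt.
by move=> x _; rewrite normrM ler_pM.
Qed.

Let m := \int[area]_x (on_square f x * tensor al al x).

Let ita : (@area R).-integrable setT (EFin \o tensor al al).
Proof. exact: integrable_area_tensor. Qed.

Let W1 (x : R2 R) := on_square f x * tensor al al x - m * tensor al al x.

Let iW1 : (@area R).-integrable setT (EFin \o W1).
Proof.
have i1 := integrable_on_square_tensor if_ sal sal zal zal.
have i2 : (@area R).-integrable setT (EFin \o (fun x => m * tensor al al x)).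
  exact: eq_integrable (integrableZl measurableT m ita).
by apply: eq_integrable (integrableB measurableT i1 i2).
Qed.

(** With [m] the average of [f], the function [f - m] at [(t, u)] is an average
over [y] of increments of [f] from [y] to [(t, u)].  A path made of a segment in
the direction of [x1] and a segment in the direction of [x2] expresses them
through [p] and [q]; averaging turns the oriented segments into the kernel [K].
Weakly, this says that [T1 + T2 + T3] vanishes on every function [g], where [T1]
integrates [g] against [(f - m) al al], and [T2] and [T3] integrate it against
the contributions of [p] and [q]. *)
Let P (x : R2 R) := on_square p x * al x.2.
Let Q (x : R2 R) := on_square q x * al x.1.

Let iP : (@area R).-integrable setT (EFin \o P).
Proof.
have [M M0 hM] := supported_bounded (smooth1_continuous sal) zal.
apply: (integrable_bounded (M := M)) => //; first exact: on_square_integrable.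
by apply: measurableT_comp => //; exact: mc.
Qed.

Let iQ : (@area R).-integrable setT (EFin \o Q).
Proof.
have [M M0 hM] := supported_bounded (smooth1_continuous sal) zal.
apply: (integrable_bounded (M := M)) => //; first exact: on_square_integrable.
by apply: measurableT_comp => //; exact: mc.
Qed.

Local Notation X := (R2 (measurableTypeR R)).
Local Notation area2 := (@area R \x @area R)%E.

Let T1 (g : X -> R) := \int[area]_x (W1 x * g x).
Let T2 (g : X -> R) := \int[area2]_z
  (P z.1 * tensor al al z.2 * K z.2.1 z.1.1 * g (z.2.1, z.1.2)).
Let T3 (g : X -> R) := \int[area2]_z
  (Q z.1 * tensor al al z.2 * K z.2.2 z.1.2 * g z.2).

Let mpi : measurable_fun setT (fun z : X * X => (z.2.1, z.1.2) : X).
Proof.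
apply: measurable_fun_pair.
  exact: (measurableT_comp measurable_fst measurable_snd).
exact: (measurableT_comp measurable_snd measurable_fst).
Qed.

Let mK2 : measurable_fun setT (fun z : X * X => K z.2.1 z.1.1).
Proof.
apply: mK; first exact: (measurableT_comp measurable_fst measurable_snd).
exact: (measurableT_comp measurable_fst measurable_fst).
Qed.

Let mK3 : measurable_fun setT (fun z : X * X => K z.2.2 z.1.2).
Proof.
apply: mK; first exact: (measurableT_comp measurable_snd measurable_snd).
exact: (measurableT_comp measurable_snd measurable_fst).
Qed.

Let T_bc : bc_functional (fun g => T1 g + T2 g + T3 g).
Proof.
apply: bc_functionalD; first apply: bc_functionalD.
- exact: (@bc_functional_integral _ _ _ _ _ _ _ id).
- exact: (bc_functional_integral (integrable_kernel iP ita mK2 (fun z => K1 _ _)) mpi).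
- exact: (bc_functional_integral (integrable_kernel iQ ita mK3 (fun z => K1 _ _)) measurable_snd).
Qed.

(** On a tensor product the vanishing follows from the definition of the weak
derivatives, tested on [osc b (al c)] and on [al (osc c)]. *)
Let T_tensor b c : smooth1 b -> smooth1 c -> (forall t, 0 <= b t <= 1) ->
  (forall t, 0 <= c t <= 1) ->
  T1 (tensor b c) + T2 (tensor b c) + T3 (tensor b c) = 0.
Proof.
move=> sb sc b01 c01.
have [sB zB dB KB] := oscP sb; have [sC zC dC KC] := oscP sc.
set cb := \int[lam]_t (al t * b t) in dB *.
set cc := \int[lam]_t (al t * c t) in dC *.
have sab : smooth1 (al \* b) by exact: smooth1M.
have sac : smooth1 (al \* c) by exact: smooth1M.
have zab : supported (al \* b) by exact: supportedM.
have zac : supported (al \* c) by exact: supportedM.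
have iab := supported_integrable (smooth1_continuous sab) zab.
have iac := supported_integrable (smooth1_continuous sac) zac.
have n1 (d : R -> R) t : (forall t, 0 <= d t <= 1) -> `|d t| <= 1.
  by move=> /(_ t) /andP[d0 d1]; rewrite ger0_norm.
have E1 : T1 (tensor b c) =
    \int[area]_x (on_square f x * tensor (al \* b) (al \* c) x) - m * (cb * cc).
  transitivity (\int[area]_x (on_square f x * tensor (al \* b) (al \* c) x -
      m * tensor (al \* b) (al \* c) x)).
    by apply: eq_Rintegral => x _; rewrite /W1 /tensor/=; ring.
  rewrite RintegralB//.
  - rewrite RintegralZl//; last exact: integrable_area_tensor.
    by rewrite Rintegral_area_tensor.
  - exact: integrable_on_square_tensor.
  - apply: eq_integrable (integrableZl measurableT m
      (integrable_area_tensor iab iac)) => //.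
have E2 : T2 (tensor b c) = \int[area]_x (on_square p x * tensor (osc b) (al \* c) x).
  rewrite /T2.
  under eq_Rintegral do rewrite -mulrA.
  rewrite (@Rintegral_kernel R _ _ _ _ area area P (tensor al al)
    (fun z => K z.2.1 z.1.1 * tensor b c (z.2.1, z.1.2)))//; last 2 first.
  - by apply: measurable_funM => //; apply: measurableT_comp mpi; exact: mt.
  - move=> z; rewrite normrM mulr_ile1// /tensor normrM mulr_ile1//; exact: n1.
  apply: eq_Rintegral => x _ /=.
  transitivity (P x * (\int[area]_y (c x.2 *
      tensor (fun t => al t * b t * K t x.1) al y))).
    by congr (_ * _); apply: eq_Rintegral => y _; rewrite /tensor/=; ring.
  have iabK : lam.-integrable setT (EFin \o (fun t => al t * b t * K t x.1)).
    by apply: (integrable_bounded (M := 1)) => //; exact: mK.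
  rewrite RintegralZl//; last exact: integrable_area_tensor.
  by rewrite Rintegral_area_tensor// KB al1 /P /tensor/=; ring.
have E3 : T3 (tensor b c) = cb * \int[area]_x (on_square q x * tensor al (osc c) x).
  rewrite /T3.
  under eq_Rintegral do rewrite -mulrA.
  rewrite (@Rintegral_kernel R _ _ _ _ area area Q (tensor al al)
    (fun z => K z.2.2 z.1.2 * tensor b c z.2))//; last 2 first.
  - by apply: measurable_funM => //; apply: measurableT_comp => //; exact: mt.
  - move=> z; rewrite normrM mulr_ile1// /tensor normrM mulr_ile1//; exact: n1.
  rewrite -RintegralZl//; last exact: integrable_on_square_tensor.
  apply: eq_Rintegral => x _ /=.
  transitivity (Q x * (\int[area]_y
      tensor (al \* b) (fun t => al t * c t * K t x.2) y)).
    by congr (_ * _); apply: eq_Rintegral => y _; rewrite /tensor/=; ring.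
  have iacK : lam.-integrable setT (EFin \o (fun t => al t * c t * K t x.2)).
    by apply: (integrable_bounded (M := 1)) => //; exact: mK.
  have cbE : \int[lam]_t (al \* b) t = cb by [].
  rewrite Rintegral_area_tensor// KC cbE.
  by rewrite /Q /tensor/=; ring.
have F1 := weak_tensor1 fp sB sac zB zac.
have F2 := weak_tensor2 fq sal sC zal zC.
have G1 : \int[area]_x (on_square f x * tensor (derive1 (osc b)) (al \* c) x) =
    \int[area]_x (on_square f x * tensor (al \* b) (al \* c) x) -
    cb * \int[area]_x (on_square f x * tensor al (al \* c) x).
  rewrite -RintegralZl//; last exact: integrable_on_square_tensor.
  rewrite -RintegralB//; last 2 first.
  - exact: integrable_on_square_tensor.
  - apply: eq_integrable (integrableZl measurableT cb
      (integrable_on_square_tensor if_ sal sac zal zac)) => //.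
  by apply: eq_Rintegral => x _; rewrite /tensor dB /=; ring.
have G2 : \int[area]_x (on_square f x * tensor al (derive1 (osc c)) x) =
    \int[area]_x (on_square f x * tensor al (al \* c) x) - cc * m.
  rewrite /m -RintegralZl//; last exact: integrable_on_square_tensor.
  rewrite -RintegralB//; last 2 first.
  - exact: integrable_on_square_tensor.
  - apply: eq_integrable (integrableZl measurableT cc
      (integrable_on_square_tensor if_ sal sal zal zal)) => //.
  by apply: eq_Rintegral => x _; rewrite /tensor dC /=; ring.
have alg (x y u v k l n : R) :
    x - k * y = - u -> y - l * n = - v -> x - n * (k * l) + u + k * v = 0.
  move=> xy yv; have -> : u = k * y - x by rewrite -opprB xy opprK.
  have -> : v = l * n - y by rewrite -opprB yv opprK.
  by ring.
rewrite E1 E2 E3; exact: alg (etrans (esym G1) F1) (etrans (esym G2) F2).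
Qed.

(** Testing the vanishing functional on the sign of [f - m] bounds the weighted
oscillation of [f] about its mean, the kernel being bounded by one. *)
Lemma oscillation_le :
  \int[area]_x (tensor al al x * `|on_square f x - m|) <=
  \int[area]_x `|on_square p x * al x.2| +
  \int[area]_x `|on_square q x * al x.1|.
Proof.
have T0 := tensor_functional_eq0 T_bc T_tensor.
have mf : measurable_fun setT (fun x : X => on_square f x - m).
  apply: measurable_funB => //.
  by apply/measurable_EFinP; case/integrableP : (on_square_integrable if_).
pose A1 : set X := setT `&` [set x | 0 <= on_square f x - m].
have mA1 : measurable A1 by exact: measurable_fun_le.
pose g : X -> R := (\1_A1 : X -> R) \- \1_(~` A1).
have mA1' : measurable (~` A1) by exact: measurableC.
have b1 := @bmeas_indic R _ _ _ mA1; have b2 := @bmeas_indic R _ _ _ mA1'.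
have gE x : g x = if 0 <= on_square f x - m then 1 else -1.
  rewrite /g /= !indicE in_setC /A1 setTI.
  case: ifPn => h; first by rewrite mem_set ?subr0.
  by rewrite memNset ?sub0r//; exact/negP.
have g1 x : `|g x| <= 1 by rewrite gE; case: ifP; rewrite ?normrN normr1.
have mg : measurable_fun setT g.
  by apply: measurable_funB; [exact: b1.1|exact: b2.1].
have Tg : T1 g + T2 g + T3 g = 0.
  by rewrite (T_bc.1 _ _ b1 b2) !T0// subrr.
have -> : \int[area]_x (tensor al al x * `|on_square f x - m|) = T1 g.
  apply: eq_Rintegral => x _; rewrite gE; set u := on_square f x - m.
  have -> : W1 x = tensor al al x * u by rewrite /W1 /u; ring.
  rewrite -mulrA; congr (_ * _).
  have [u0|u0] := leP 0 u; first by rewrite ger0_norm ?mulr1.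
  by rewrite ltr0_norm ?mulrN1.
have -> : T1 g = - T2 g - T3 g by move: Tg; lra.
have ta1 : \int[area]_y `|tensor al al y| = 1.
  under eq_Rintegral do rewrite ger0_norm ?mulr_ge0//.
  by rewrite Rintegral_area_tensor// al1 mulr1.
have h2 : `|T2 g| <= \int[area]_x `|P x|.
  rewrite /T2; under eq_Rintegral do rewrite -mulrA.
  rewrite -[leRHS]mulr1 -ta1.
  apply: (@le_Rintegral_kernel R _ _ _ _ area area P (tensor al al)
    (fun z => K z.2.1 z.1.1 * g (z.2.1, z.1.2))) => //.
    by apply: measurable_funM => //; exact: measurableT_comp.
  by move=> z; rewrite normrM mulr_ile1.
have h3 : `|T3 g| <= \int[area]_x `|Q x|.
  rewrite /T3; under eq_Rintegral do rewrite -mulrA.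
  rewrite -[leRHS]mulr1 -ta1.
  apply: (@le_Rintegral_kernel R _ _ _ _ area area Q (tensor al al)
    (fun z => K z.2.2 z.1.2 * g z.2)) => //.
    by apply: measurable_funM => //; exact: measurableT_comp.
  by move=> z; rewrite normrM mulr_ile1.
move: h2 h3; rewrite !ler_norml => /andP[h2 _] /andP[h3 _].
by rewrite lerD// lerNl.
Qed.

End oscillation.

(** * The classical energy is bounded below *)

(** The final computation: [U] and [S] are weighted integrals of the components
of [h], [S] being bounded below because [|h|] is close to one, and above because
the means [m] and the oscillations are small.  Since [3 / 2 * 4^-1 * 8^-1] is
less than [2^-1], the two bounds are incompatible unless [g2], a multiple of the
integral of the majorant, is not small. *)
Lemma numeric_bound (R : realType) (g1 g2 S1 S2 U1 U2 m1 m2 : R) :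
  g1 <= g2 -> 0 <= g1 -> S1 <= m1 + 2 * g1 + 8^-1 * U2 ->
  S2 <= m2 + 2 * g1 + 8^-1 * U1 -> m1 <= 3 * g2 -> m2 <= 3 * g2 ->
  U1 + U2 <= 3 / 2 * 4^-1 + 2^-1 * g1 -> 2^-1 - 2^-1 * g2 <= S1 + S2 ->
  1 <= 32 * g2.
Proof. by move=> *; lra. Qed.

Lemma lebesgue_measure_small (R : realType) :
  @lebesgue_measure R `[- 8^-1, 8^-1]%classic = (4^-1)%:E.
Proof.
apply: etrans (lebesgue_measure_itv _) _.
rewrite /= lte_fin ifT; last by lra.
by rewrite -EFinD; congr EFin; lra.
Qed.

Lemma integrable_indic_small (R : realType) :
  (@lebesgue_measure R).-integrable setT
    (EFin \o (\1_`[- 8^-1, 8^-1]%classic : R -> R)).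
Proof.
apply/integrableP; split.
  by apply/measurable_EFinP/measurable_indic; exact: measurable_itv.
under eq_integral do rewrite /= ger0_norm//.
rewrite integral_indic//.
rewrite setIT [X in (X < _)%E](lebesgue_measure_small R : _ = _).
exact: ltry.
Qed.

Lemma Rintegral_indic_small (R : realType) :
  \int[@lebesgue_measure R]_t (\1_`[- 8^-1, 8^-1]%classic t : R) = 4^-1.
Proof.
rewrite /Rintegral integral_indic//.
by rewrite setIT; exact: (congr1 fine (lebesgue_measure_small R)).
Qed.

Section classical_bound.
Context {R : realType}.
Local Notation lam := (@lebesgue_measure R).
Local Notation X := (R2 (measurableTypeR R)).

Lemma integrable_dominated (u G : X -> R) :
  measurable_fun setT u -> (@area R).-integrable setT (EFin \o G) ->
  (forall x, `|u x| <= G x) -> (@area R).-integrable setT (EFin \o u).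
Proof.
move=> mu iG uG; apply: le_integrable iG => //; first exact/measurable_EFinP.
by move=> x _ /=; rewrite lee_fin (le_trans (uG x))// ler_norm.
Qed.

Lemma weighted_le (u w G : X -> R) (C : R) :
  measurable_fun setT u -> (@area R).-integrable setT (EFin \o G) ->
  measurable_fun setT w -> (forall x, `|w x| <= C) ->
  (forall x, `|u x| <= G x) ->
  \int[area]_x `|u x * w x| <= C * \int[area]_x G x.
Proof.
move=> mu iG mw wC uG; have iu := integrable_dominated mu iG uG.
rewrite -RintegralZl//; apply: le_Rintegral => //.
- exact: (integrable_abse (integrable_bounded measurableT iu mw (fun x _ => wC x))).
- exact: eq_integrable (integrableZl measurableT C iG).
- by move=> x _; rewrite normrM mulrC ler_pM.
Qed.

Lemma weighted_norm_le (u w G : X -> R) (C : R) :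
  measurable_fun setT u -> (@area R).-integrable setT (EFin \o G) ->
  measurable_fun setT w -> (forall x, `|w x| <= C) ->
  (forall x, `|u x| <= G x) ->
  `|\int[area]_x (u x * w x)| <= C * \int[area]_x G x.
Proof.
move=> mu iG mw wC uG; rewrite (le_trans _ (weighted_le mu iG mw wC uG))//.
apply: le_normr_Rintegral => //.
exact: (integrable_bounded measurableT (integrable_dominated mu iG uG) mw
  (fun x _ => wC x)).
Qed.

Lemma measurable_on_square (g : X -> R) : loc_integrable (@unit_disc R) g ->
  measurable_fun setT (on_square g).
Proof.
by move=> /on_square_integrable /integrableP[/measurable_EFinP].
Qed.

Variables (al : R -> R) (M : R).
Hypotheses (sal : smooth1 al) (zal : supported al) (al0 : forall t, 0 <= al t)
  (al1 : \int[lam]_t al t = 1).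
Hypotheses (M1 : 1 <= M) (alM : forall t, `|al t| <= M)
  (dalM : forall t, `|derive1 al t| <= M).

Let mt (a b : R -> R) : smooth1 a -> smooth1 b ->
  measurable_fun setT (tensor a b : R2 (measurableTypeR R) -> R).
Proof.
move=> sa sb; apply: measurable_funM; apply: measurableT_comp => //.
  by apply: continuous_measurable_fun; exact: smooth1_continuous.
by apply: continuous_measurable_fun; exact: smooth1_continuous.
Qed.

Let tM (a b : R -> R) (x : R2 R) : (forall t, `|a t| <= M) -> (forall t, `|b t| <= M) ->
  `|tensor a b x| <= M ^+ 2.
Proof. by move=> aM bM; rewrite normrM expr2 ler_pM. Qed.

Definition mean (f : R2 R -> R) := \int[area]_x (on_square f x * tensor al al x).

(** If [d2 f = s x1 k + r] with [s = 1] or [s = -1], the equality of the mixed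
second derivatives of [f] reads [s k = d2 (d1 f) - s x1 (d1 k) - d1 r]: the
mean of [k] is controlled by [d1 f], [d1 k] and [r]. *)
Lemma mean_le (s : R) (f p q k pk : R2 R -> R) (G : X -> R) :
  `|s| = 1 ->
  weak_partial (@unit_disc R) ord0 f p ->
  weak_partial (@unit_disc R) ord_max f q ->
  weak_partial (@unit_disc R) ord0 k pk ->
  (@area R).-integrable setT (EFin \o G) ->
  (forall x, `|on_square p x| <= G x) ->
  (forall x, `|on_square pk x| <= G x) ->
  (forall x, `|on_square q x - s * x.1 * on_square k x| <= G x) ->
  `|mean k| <= 3 * M ^+ 2 * \int[area]_x G x.
Proof.
move=> s1 fp fq kp iG pG pkG rG.
have sd := smooth1_derive sal; have zd := supported_derive zal.
have [if_ ip _] := fp; have [_ iq _] := fq; have [ik ipk _] := kp.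
pose tal := @id R \* al.
have stal : smooth1 tal by apply: smooth1M => //; exact: smooth1_id.
have ztal : supported tal by move=> t /zal; rewrite /tal /= => ->; rewrite mulr0.
have talM t : `|tal t| <= M.
  have [st|/ztal ->] := pselect (small t); last by rewrite normr0 (le_trans _ M1).
  rewrite /tal /= normrM -[leRHS]mul1r ler_pM// (le_trans st)//; lra.
have dtal t : derive1 tal t = al t + t * derive1 al t.
  rewrite derive1_mul; [|exact: derivable_id|exact: smooth1_derivable].
  by rewrite [derive1 id t]derive1E derive_id mulr1 addrC.
have w1 := weak_tensor1 fp sal sd zal zd.
have w2 := weak_tensor2 fq sd sal zd zal.
have w3 := weak_tensor1 kp stal sal ztal zal.
pose r (x : X) := on_square q x - s * x.1 * on_square k x.
have mr : measurable_fun setT r.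
  apply: measurable_funB; first exact: measurable_on_square.
  apply: measurable_funM; last exact: measurable_on_square.
  exact: measurable_funM.
pose dk := \int[area]_x (on_square k x * tensor (@id R \* derive1 al) al x).
have sid : smooth1 (@id R \* derive1 al) by apply: smooth1M => //; exact: smooth1_id.
have zid : supported (@id R \* derive1 al).
  by move=> t /zd /= ->; rewrite mulr0.
have ik1 := integrable_on_square_tensor ik sal sal zal zal.
have ik2 := integrable_on_square_tensor ik sid sal zid zal.
have iq1 := integrable_on_square_tensor iq sd sal zd zal.
have e3 : \int[area]_x (on_square k x * tensor (derive1 tal) al x) = mean k + dk.
  rewrite /mean /dk -RintegralD//; apply: eq_Rintegral => x _.
  by rewrite /tensor dtal /=; ring.
have er : \int[area]_x (r x * tensor (derive1 al) al x) =
    \int[area]_x (on_square q x * tensor (derive1 al) al x) - s * dk.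
  rewrite /dk -RintegralZl// -RintegralB//; last first.
    exact: eq_integrable (integrableZl measurableT s ik2).
  by apply: eq_Rintegral => x _; rewrite /r /tensor/=; ring.
have b1 := weighted_norm_le (measurable_on_square ip) iG (mt sal sd)
  (fun x => tM x alM dalM) pG.
have b2 := weighted_norm_le (measurable_on_square ipk) iG (mt stal sal)
  (fun x => tM x talM alM) pkG.
have b3 := weighted_norm_le mr iG (mt sd sal) (fun x => tM x dalM alM) rG.
rewrite -[`|mean k|]mul1r -s1 -normrM.
have -> : s * mean k = \int[area]_x (r x * tensor (derive1 al) al x) -
    s * \int[area]_x (on_square pk x * tensor tal al x) -
    \int[area]_x (on_square p x * tensor al (derive1 al) x).
  have p2 : \int[area]_x (on_square p x * tensor al (derive1 al) x) =
      \int[area]_x (on_square q x * tensor (derive1 al) al x).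
    by apply: oppr_inj; rewrite -w1 -w2.
  rewrite p2 er (_ : \int[area]_x (on_square pk x * tensor tal al x) =
    - (mean k + dk)); last by rewrite -e3 w3 opprK.
  by ring.
rewrite (le_trans (ler_normB _ _))// (le_trans (lerD (ler_normB _ _) b1))//.
rewrite normrM s1 mul1r (le_trans (lerD (lerD b3 b2) (lexx _)))//.
by rewrite -mulrA [leRHS]mulr_natl !mulrSr mulr0n add0r.
Qed.

Let mal1 : measurable_fun setT (fun x : X => al x.1).
Proof.
apply: measurableT_comp measurable_fst.
by apply: continuous_measurable_fun; exact: smooth1_continuous.
Qed.

Let mal2 : measurable_fun setT (fun x : X => al x.2).
Proof.
apply: measurableT_comp measurable_snd.
by apply: continuous_measurable_fun; exact: smooth1_continuous.
Qed.

Let ial := supported_integrable (smooth1_continuous sal) zal.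

Let itt := integrable_area_tensor ial ial.

Let tt1 : \int[area]_x tensor al al x = 1.
Proof. by rewrite Rintegral_area_tensor// al1 mulr1. Qed.

Let tt0 x : 0 <= tensor al al x.
Proof. by rewrite mulr_ge0. Qed.

(** The weighted norm of [f] is at most its mean plus its oscillation.  In the
bound of the oscillation by [p] and [q], the latter is replaced by its distance
to [s x1 k], at the cost of [8^-1 |k|]. *)
Lemma weighted_component_le (s : R) (f p q k pk : R2 R -> R) (G : X -> R) :
  `|s| = 1 ->
  weak_partial (@unit_disc R) ord0 f p ->
  weak_partial (@unit_disc R) ord_max f q ->
  weak_partial (@unit_disc R) ord0 k pk ->
  (@area R).-integrable setT (EFin \o G) ->
  (forall x, `|on_square p x| <= G x) ->
  (forall x, `|on_square q x - s * x.1 * on_square k x| <= G x) ->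
  \int[area]_x (tensor al al x * `|on_square f x|) <= `|mean f| +
    2 * M * \int[area]_x G x + 8^-1 * \int[area]_x `|on_square k x * al x.1|.
Proof.
move=> s1 fp fq kp iG pG rG.
have [if_ ip _] := fp; have [_ iq _] := fq; have [ik ipk _] := kp.
have bnd (g w : X -> R) : loc_integrable (@unit_disc R) g ->
    measurable_fun setT w -> (forall x, `|w x| <= M) ->
    (@area R).-integrable setT (EFin \o (fun x => `|on_square g x * w x|)).
  move=> ig mw wM; apply: (@integrable_abse _ _ _ _ _ (EFin \o _)).
  exact: (integrable_bounded measurableT (on_square_integrable ig) mw (fun x _ => wM x)).
have ikl := bnd _ _ ik mal1 (fun x => alM x.1).
have iql := bnd _ _ iq mal1 (fun x => alM x.1).
pose r (x : X) := on_square q x - s * x.1 * on_square k x.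
have mr : measurable_fun setT r.
  apply: measurable_funB; first exact: measurable_on_square.
  apply: measurable_funM; last exact: measurable_on_square.
  exact: measurable_funM.
have irl : (@area R).-integrable setT (EFin \o (fun x => `|r x * al x.1|)).
  apply: (@integrable_abse _ _ _ _ _ (EFin \o _)).
  exact: (integrable_bounded measurableT (integrable_dominated mr iG rG) mal1
    (fun x _ => alM x.1)).
have bq : \int[area]_x `|on_square q x * al x.1| <=
    M * \int[area]_x G x + 8^-1 * \int[area]_x `|on_square k x * al x.1|.
  rewrite (le_trans _ (lerD (weighted_le mr iG mal1 (fun x => alM x.1) rG) (lexx _)))//.
  have i8 : (@area R).-integrable setT
      (EFin \o (fun x => 8^-1 * `|on_square k x * al x.1|)).
    exact: eq_integrable (integrableZl measurableT 8^-1 ikl).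
  rewrite -RintegralZl// -RintegralD//; apply: le_Rintegral => //.
    exact: eq_integrable (integrableD measurableT irl i8).
  move=> x _; rewrite !normrM mulrA -mulrDl ler_wpM2r//.
  rewrite -[on_square q x](subrK (s * x.1 * on_square k x)).
  rewrite (le_trans (ler_normD _ _))// lerD2l !normrM s1 mul1r.
  rewrite /on_square !patchE.
  case: ifPn => [/set_mem[x1 _]|_]; last by rewrite normr0 !mulr0.
  by rewrite ler_wpM2r.
have bp := weighted_le (measurable_on_square ip) iG mal2 (fun x => alM x.2) pG.
have := oscillation_le sal zal al0 al1 fp fq.
rewrite -/(mean f) => osc.
have ifm : (@area R).-integrable setT
    (EFin \o (fun x => tensor al al x * `|on_square f x - mean f|)).
  have i1 := integrable_on_square_tensor if_ sal sal zal zal.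
  have i2 : (@area R).-integrable setT (EFin \o (fun x => mean f * tensor al al x)).
    exact: eq_integrable (integrableZl measurableT _ itt).
  apply: eq_integrable (integrable_abse (integrableB measurableT i1 i2)) => //.
  move=> x _ /=; rewrite -mulrBl normrM [X in _ * X]ger0_norm//.
  by rewrite mulrC.
have im : (@area R).-integrable setT (EFin \o (fun x => tensor al al x * `|mean f|)).
  exact: eq_integrable (integrableZr measurableT _ itt).
have : \int[area]_x (tensor al al x * `|on_square f x|) <=
    \int[area]_x (tensor al al x * `|on_square f x - mean f|) + `|mean f|.
  rewrite -[X in _ <= _ + X]mul1r -tt1 -RintegralZr// -RintegralD//.
  apply: le_Rintegral => //.
  - have := integrable_abse (integrable_on_square_tensor if_ sal sal zal zal).
    apply: eq_integrable => // x _ /=.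
    by rewrite normrM [X in _ * X]ger0_norm// mulrC.
  - exact: eq_integrable (integrableD measurableT ifm im).
  - move=> x _; rewrite -mulrDr ler_wpM2l//.
    by rewrite -[in leLHS](subrK (mean f) (on_square f x)) ler_normD.
lra.
Qed.

(** The lower bound for the energy, with the energy density replaced by a
function [G] that controls the quantities entering the argument. *)
Lemma majorant_lower_bound (h1 h2 p1 p2 q1 q2 : R2 R -> R) (G : X -> R) :
  weak_partial (@unit_disc R) ord0 h1 p1 ->
  weak_partial (@unit_disc R) ord_max h1 q1 ->
  weak_partial (@unit_disc R) ord0 h2 p2 ->
  weak_partial (@unit_disc R) ord_max h2 q2 ->
  (@area R).-integrable setT (EFin \o G) ->
  (forall x, `|on_square p1 x| <= G x) ->
  (forall x, `|on_square p2 x| <= G x) ->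
  (forall x, `|on_square q1 x + x.1 * on_square h2 x| <= G x) ->
  (forall x, `|on_square q2 x - x.1 * on_square h1 x| <= G x) ->
  (forall x, square x -> `|h1 x| + `|h2 x| <= 3 / 2 + G x / 2) ->
  (forall x, square x -> (1 - G x) / 2 <= `|h1 x| + `|h2 x|) ->
  1 <= 32 * M ^+ 2 * \int[area]_x G x.
Proof.
move=> hp1 hq1 hp2 hq2 iG bp1 bp2 br1 br2 up low.
have G0 x : 0 <= G x by rewrite (le_trans _ (bp1 x)).
have [ih1 _ _] := hp1; have [ih2 _ _] := hp2.
have br1' x : `|on_square q1 x - -1 * x.1 * on_square h2 x| <= G x.
  by rewrite !mulN1r mulNr opprK.
have br2' x : `|on_square q2 x - 1 * x.1 * on_square h1 x| <= G x.
  by rewrite mul1r.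
have n1 : `|-1 : R| = 1 by rewrite normrN normr1.
have n2 : `|1 : R| = 1 by rewrite normr1.
have c1 := weighted_component_le n1 hp1 hq1 hp2 iG bp1 br1'.
have c2 := weighted_component_le n2 hp2 hq2 hp1 iG bp2 br2'.
have m1 := mean_le n2 hp2 hq2 hp1 iG bp2 bp1 br2'.
have m2 := mean_le n1 hp1 hq1 hp2 iG bp1 bp2 br1'.
pose g := \int[area]_x G x; rewrite -/g in c1 c2 m1 m2 *.
have g0 : 0 <= g by apply: Rintegral_ge0.
have iabs (f : R2 R -> R) : loc_integrable (@unit_disc R) f ->
    (@area R).-integrable setT (EFin \o (fun x => `|on_square f x * al x.1|)).
  move=> ig; apply: (@integrable_abse _ _ _ _ _ (EFin \o _)).
  exact: (integrable_bounded measurableT (on_square_integrable ig) mal1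
    (fun x _ => alM x.1)).
have itabs (f : R2 R -> R) : loc_integrable (@unit_disc R) f ->
    (@area R).-integrable setT (EFin \o (fun x => tensor al al x * `|on_square f x|)).
  move=> ig; have := integrable_abse (integrable_on_square_tensor ig sal sal zal zal).
  apply: eq_integrable => // x _ /=.
  by rewrite normrM [X in _ * X]ger0_norm// mulrC.
have mG : measurable_fun setT G by case/integrableP : iG => /measurable_EFinP.
have GG x : `|G x| <= G x by rewrite ger0_norm.
have bG1 := weighted_le mG iG mal1 (fun x => alM x.1) GG.
have bG2 := weighted_le mG iG (mt sal sal) (fun x => tM x alM alM) GG.
rewrite -/g in bG1 bG2.
have iG1 : (@area R).-integrable setT (EFin \o (fun x => `|G x * al x.1|)).
  apply: (@integrable_abse _ _ _ _ _ (EFin \o _)).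
  exact: (integrable_bounded measurableT iG mal1 (fun x _ => alM x.1)).
have iG2 : (@area R).-integrable setT (EFin \o (fun x => `|G x * tensor al al x|)).
  apply: (@integrable_abse _ _ _ _ _ (EFin \o _)).
  exact: (integrable_bounded measurableT iG (mt sal sal) (fun x _ => tM x alM alM)).
pose one8 : R -> R := \1_`[- 8^-1, 8^-1]%classic.
have i8 : lam.-integrable setT (EFin \o one8).
  exact: integrable_indic_small.
have I8 : \int[lam]_t one8 t = 4^-1.
  exact: Rintegral_indic_small.
have ia8 := integrable_area_tensor ial i8.
have Ia8 : \int[area]_x tensor al one8 x = 4^-1.
  by rewrite Rintegral_area_tensor// al1 mul1r I8.
have U : \int[area]_x `|on_square h1 x * al x.1| +
    \int[area]_x `|on_square h2 x * al x.1| <= 3 / 2 * 4^-1 + 2^-1 * (M * g).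
  have j1 : (@area R).-integrable setT (EFin \o (fun x => 3 / 2 * tensor al one8 x)).
    exact: eq_integrable (integrableZl measurableT _ ia8).
  have j2 : (@area R).-integrable setT (EFin \o (fun x => 2^-1 * `|G x * al x.1|)).
    exact: eq_integrable (integrableZl measurableT _ iG1).
  have b2 : 2^-1 * \int[area]_x `|G x * al x.1| <= 2^-1 * (M * g).
    by rewrite ler_wpM2l.
  rewrite (le_trans _ (lerD (lexx _) b2))// -Ia8 -!RintegralZl//.
  rewrite -!RintegralD//; try exact: iabs.
  apply: le_Rintegral => //.
  - exact: eq_integrable (integrableD measurableT (iabs _ ih1) (iabs _ ih2)).
  - exact: eq_integrable (integrableD measurableT j1 j2).
  move=> x _; rewrite !normrM -mulrDl (ger0_norm (al0 _)) (ger0_norm (G0 _)).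
  rewrite /on_square !patchE; case: ifPn => [/set_mem sx|_]; last first.
    by rewrite normr0 addr0 mul0r addr_ge0// !mulr_ge0.
  rewrite /tensor /one8 indicE mem_set; last by rewrite -smallE; case: sx.
  rewrite mulr1 (le_trans (ler_wpM2r (al0 x.1) (up x sx)))// mulrDl lerD2l.
  by rewrite mulrAC mulrC.
have S : 2^-1 - 2^-1 * (M ^+ 2 * g) <=
    \int[area]_x (tensor al al x * `|on_square h1 x|) +
    \int[area]_x (tensor al al x * `|on_square h2 x|).
  have j1 : (@area R).-integrable setT (EFin \o (fun x => 2^-1 * tensor al al x)).
    exact: eq_integrable (integrableZl measurableT _ itt).
  have j2 : (@area R).-integrable setT (EFin \o (fun x => 2^-1 * `|G x * tensor al al x|)).
    exact: eq_integrable (integrableZl measurableT _ iG2).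
  have b2 : 2^-1 * \int[area]_x `|G x * tensor al al x| <= 2^-1 * (M ^+ 2 * g).
    by rewrite ler_wpM2l.
  rewrite (le_trans (lerB (lexx _) b2))// -[X in X - _]mulr1.
  rewrite -[X in _ * X - _]tt1 -!RintegralZl//.
  rewrite -RintegralB// -RintegralD//; try exact: itabs.
  apply: le_Rintegral => //.
  - exact: eq_integrable (integrableB measurableT j1 j2).
  - exact: eq_integrable (integrableD measurableT (itabs _ ih1) (itabs _ ih2)).
  move=> x _; rewrite -mulrDr normrM (ger0_norm (G0 _)) (ger0_norm (tt0 _)).
  have [sx|nx] := pselect (square x); last first.
    rewrite (_ : tensor al al x = 0) ?mulr0 ?mul0r ?subr0//.
    rewrite /tensor; have [s1|/zal ->] := pselect (small x.1); last by rewrite mul0r.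
    have [s2|/zal ->] := pselect (small x.2); last by rewrite mulr0.
    by case: nx.
  rewrite /on_square !patchE mem_set//.
  apply: le_trans (ler_wpM2l (tt0 x) (low x sx)).
  by rewrite le_eqVlt; apply/orP; left; apply/eqP; field.
have M2 : M <= M ^+ 2 by rewrite expr2 ler_peMl// (le_trans _ M1).
have Mg := ler_wpM2r g0 M2.
have Mg0 : 0 <= M * g by rewrite mulr_ge0// (le_trans _ M1).
rewrite -(mulrA 2) in c1 c2; rewrite -(mulrA 3) in m1 m2; rewrite -(mulrA 32).
exact: numeric_bound Mg Mg0 c1 c2 m1 m2 U S.
Qed.

End classical_bound.

Section pointwise.
Context {R : realType}.
Implicit Types t l e : R.

(** Linear growth in [l] is what keeps the majorant integrable with an integral
controlled by the energy; the price is the constant [e], which is chosen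
small. *)
Lemma norm_le_majorant t l e : 0 < e -> t ^+ 2 <= l -> `|t| <= e + l / e.
Proof.
move=> e0 tl; rewrite -(ler_pM2r e0) mulrDl divfK ?gt_eqF//.
have : `|t| ^+ 2 <= l by rewrite real_normK ?num_real.
have := sqr_ge0 (`|t| - e); have := normr_ge0 t; nra.
Qed.

Lemma norm2_le_majorant (a b G : R) :
  a ^+ 2 + b ^+ 2 - 1 <= G -> `|a| + `|b| <= 3 / 2 + G / 2.
Proof.
rewrite -(real_normK (num_real a)) -(real_normK (num_real b)) => h.
by have := sqr_ge0 (`|a| - 1); have := sqr_ge0 (`|b| - 1); nra.
Qed.

Lemma norm2_ge_majorant (a b G : R) :
  (a ^+ 2 + b ^+ 2 - 1) ^+ 2 <= G -> (1 - G) / 2 <= `|a| + `|b|.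
Proof.
rewrite -(real_normK (num_real a)) -(real_normK (num_real b)).
have := normr_ge0 a; have := normr_ge0 b.
move: `|a| `|b| => {}a {}b b0 a0 h.
have [ab|ab] := leP (2^-1) (a + b).
  by have := sqr_ge0 (a ^+ 2 + b ^+ 2 - 1); lra.
have s1 : a ^+ 2 + b ^+ 2 <= (a + b) ^+ 2 by nra.
have s2 : (a + b) ^+ 2 <= a + b by nra.
have : 1 - 2 * (a ^+ 2 + b ^+ 2) <= G by apply: le_trans h; nra.
lra.
Qed.

End pointwise.

Lemma gapL_ge_squares (R : realType) (x y : R2 R) (z : R22 R) :
  [/\ z.1.1 ^+ 2 <= gapL (x, y, z), z.2.1 ^+ 2 <= gapL (x, y, z),
      (z.1.2 + x.1 * y.2) ^+ 2 <= gapL (x, y, z),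
      (z.2.2 - x.1 * y.1) ^+ 2 <= gapL (x, y, z) &
      (y.1 ^+ 2 + y.2 ^+ 2 - 1) ^+ 2 <= gapL (x, y, z)].
Proof.
have le5 (a b c d e : R) : 0 <= a -> 0 <= b -> 0 <= c -> 0 <= d -> 0 <= e ->
    [/\ a <= a + b + c + d + e, b <= a + b + c + d + e,
        c <= a + b + c + d + e, d <= a + b + c + d + e &
        e <= a + b + c + d + e].
  by move=> *; split; lra.
by apply: le5; exact: sqr_ge0.
Qed.

(** [M] bounds the bump and its derivative.  With [eta = (4 M^2)^-1] and a square
of area [4^-1 * 4^-1], the constant part of the majorant contributes exactly one
half to the right-hand side; the energy has to provide the other half. *)
Lemma energy_of_majorant (R : realType) (M E : R) : 1 <= M ->
  1 <= 32 * M ^+ 2 * ((4 * M ^+ 2)^-1 * (4^-1 * 4^-1) + E / (4 * M ^+ 2)^-1) ->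
  ((16 * M ^+ 2) ^+ 2)^-1 <= E.
Proof.
move=> M1; have M0 : 0 < M by exact: lt_le_trans M1.
have -> : 32 * M ^+ 2 * ((4 * M ^+ 2)^-1 * (4^-1 * 4^-1) + E / (4 * M ^+ 2)^-1) =
    (1 + (16 * M ^+ 2) ^+ 2 * E) / 2 by field; rewrite gt_eqF.
have K0 : 0 < (16 * M ^+ 2) ^+ 2 by rewrite exprn_gt0// mulr_gt0// exprn_gt0.
move: K0; set K := (_ ^+ 2) => K0 h.
rewrite -div1r ler_pdivrMr//; lra.
Qed.

Lemma open_unit_disc (R : realType) : open (@unit_disc R).
Proof.
have c (x : R2 R) : {for x, continuous (fun x : R2 R => x.1 ^+ 2 + x.2 ^+ 2)}.
  by apply: cvgD; apply: (@continuous_comp _ _ _ _ (fun t : R => t ^+ 2));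
    (exact: cvg_fst || exact: cvg_snd || exact: exprn_continuous).
rewrite (_ : unit_disc (R:=R) = (fun x : R2 R => x.1 ^+ 2 + x.2 ^+ 2) @^-1`
  [set t | t < 1]) //.
by apply: open_comp => [x _|]; [exact: c|exact: open_lt].
Qed.

Lemma measurable_unit_disc (R : realType) :
  measurable (@unit_disc R : set (R2 (measurableTypeR R))).
Proof. exact: (open_measurable_R2 (@open_unit_disc R)). Qed.

Section classical_lower_bound.
Variable R : realType.
Local Notation X := (R2 (measurableTypeR R)).

(** The energy density [l] bounds the squares of [d1 h] and of [d2 h - x1 J h], so
that [eta + l / eta] on the square is a majorant for them; it also controls
[|h|] from both sides. *)
Lemma classical_lower_bound : exists2 c : R, 0 < c &
  forall e, classical_values (@unit_disc R) (@gapL R) e -> (c%:E <= e)%E.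
Proof.
have [al [sal zal al0 al1]] := @bump_exists R.
have [M0 M00 hM0] := supported_bounded (smooth1_continuous sal) zal.
have [M1 M10 hM1] := supported_bounded
  (smooth1_continuous (smooth1_derive sal)) (supported_derive zal).
pose M := 1 + M0 + M1; have M1le : 1 <= M by rewrite /M; lra.
have alM t : `|al t| <= M by rewrite (le_trans (hM0 t))// /M; lra.
have dalM t : `|derive1 al t| <= M by rewrite (le_trans (hM1 t))// /M; lra.
have M2 : 1 <= M ^+ 2 by rewrite exprn_ege1.
pose eta : R := (4 * M ^+ 2)^-1.
have eta0 : 0 < eta by rewrite invr_gt0; lra.
have eta1 : eta <= 1 by rewrite invf_le1; lra.
exists ((16 * M ^+ 2) ^+ 2)^-1.
  by rewrite invr_gt0 exprn_gt0// mulr_gt0// (lt_le_trans ltr01).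
move=> _ [h [Dh [hDh ->]]].
pose l (x : X) : R := gapL (x, h x, Dh x).
have l0 x : 0 <= l x by exact: gapL_ge0.
have ihp1 : weak_partial (@unit_disc R) ord0 (fun x => (h x).1)
  (fun x => (Dh x).1.1) := (hDh ord0 ord0).1.
have ihq1 : weak_partial (@unit_disc R) ord_max (fun x => (h x).1)
  (fun x => (Dh x).1.2) := (hDh ord0 ord_max).1.
have ihp2 : weak_partial (@unit_disc R) ord0 (fun x => (h x).2)
  (fun x => (Dh x).2.1) := (hDh ord_max ord0).1.
have ihq2 : weak_partial (@unit_disc R) ord_max (fun x => (h x).2)
  (fun x => (Dh x).2.2) := (hDh ord_max ord_max).1.
have [[mh1 _] [mp1 _] _] := ihp1; have [[mh2 _] [mp2 _] _] := ihp2.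
have [_ [mq1 _] _] := ihq1; have [_ [mq2 _] _] := ihq2.
have mD : measurable (@unit_disc R : set X).
  exact: measurable_unit_disc.
have ml : measurable_fun (@unit_disc R : set X) l.
  have mx : measurable_fun (@unit_disc R : set X) (fun x : X => x.1).
    exact: measurable_funS measurable_fst.
  rewrite /l /gapL; apply: measurable_funD; first apply: measurable_funD;
    first apply: measurable_funD; first apply: measurable_funD;
    apply: measurable_funX.
  - exact: mp1.
  - exact: mp2.
  - by apply: measurable_funD mq1 _; exact: measurable_funM.
  - by apply: measurable_funB mq2 _; exact: measurable_funM.
  - apply: measurable_funB => //; apply: measurable_funD; exact: measurable_funX.
have sqD := @square_sub_disc R.
have msq := @measurable_square R.
have mls : measurable_fun (@square R : set X) l by exact: measurable_funS ml.
apply: (@le_trans _ _ (\int[leb2 R]_(x in @square R) (l x)%:E)%E); last first.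
  apply: ge0_subset_integral => //.
    exact/measurable_EFinP.
  by move=> x _; rewrite lee_fin.
have [Eoo|Eoo] := leP +oo%E (\int[leb2 R]_(x in @square R) (l x)%:E)%E.
  by rewrite (le_trans _ Eoo)// leey.
have il : (@area R).-integrable (@square R : set X) (EFin \o l).
  apply/integrableP; split; first exact/measurable_EFinP.
  by under eq_integral do rewrite /= ger0_norm//.
pose E := \int[area]_(x in @square R) l x.
have -> : (\int[leb2 R]_(x in @square R) (l x)%:E = E%:E)%E.
  by rewrite /E /Rintegral fineK//; exact: integrable_fin_num.
rewrite lee_fin.
pose G : X -> R := on_square (fun x => eta + l x / eta).
have area_sq : (@area R) (@square R) = ((4^-1 * 4^-1)%:E)%E.
  rewrite squareE smallE /area.
  apply: etrans (product_measure1E _ _ _ _) _; [exact: measurable_itv|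
    exact: measurable_itv|].
  rewrite EFinM; congr (_ * _)%E; exact: lebesgue_measure_small.
have icst : (@area R).-integrable (@square R : set X) (EFin \o cst eta).
  apply/integrableP; split; first exact/measurable_EFinP.
  under eq_integral do rewrite /= ger0_norm ?ltW//.
  rewrite integral_cst// [X in (_ * X)%E](area_sq : _ = _).
  by rewrite -EFinM ltry.
have ildiv : (@area R).-integrable (@square R : set X) (EFin \o (fun x => l x / eta)).
  exact: eq_integrable (integrableZr msq _ il).
have iG' : (@area R).-integrable (@square R : set X) (EFin \o (fun x => eta + l x / eta)).
  exact: eq_integrable (integrableD msq icst ildiv).
have iG : (@area R).-integrable setT (EFin \o G).
  rewrite /G /on_square -restrict_EFin.
  by apply/(integrable_mkcond _ msq).1.
have IG : \int[area]_x G x = eta * (4^-1 * 4^-1) + E / eta.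
  rewrite /G /on_square -Rintegral_mkcond RintegralD// RintegralZr//.
  congr (_ + _); apply: etrans (Rintegral_cst _ msq _) _; congr (_ * _).
  exact: (congr1 fine area_sq).
have Gsq x : square x -> G x = eta + l x / eta.
  by move=> sx; rewrite /G /on_square patchE mem_set.
have onle (k : X -> R) : (forall x, (k x) ^+ 2 <= l x) ->
    forall x, `|on_square k x| <= G x.
  move=> kl x; rewrite /G /on_square !patchE; case: ifPn => _.
    exact: norm_le_majorant.
  by rewrite normr0.
have lsq x := gapL_ge_squares x (h x) (Dh x).
have le1 x : (Dh x).1.1 ^+ 2 <= l x by have [] := lsq x.
have le2 x : (Dh x).2.1 ^+ 2 <= l x by have [] := lsq x.
have le3 x : ((Dh x).1.2 + x.1 * (h x).2) ^+ 2 <= l x by have [] := lsq x.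
have le4 x : ((Dh x).2.2 - x.1 * (h x).1) ^+ 2 <= l x by have [] := lsq x.
have le5 x : ((h x).1 ^+ 2 + (h x).2 ^+ 2 - 1) ^+ 2 <= l x by have [] := lsq x.
have r1 x : `|on_square (fun x => (Dh x).1.2) x +
    x.1 * on_square (fun x => (h x).2) x| <= G x.
  rewrite (_ : _ + _ =
    on_square (fun x => (Dh x).1.2 + x.1 * (h x).2) x); first exact: onle.
  by rewrite /on_square !patchE; case: ifP => _; rewrite ?mulr0 ?addr0.
have r2 x : `|on_square (fun x => (Dh x).2.2) x -
    x.1 * on_square (fun x => (h x).1) x| <= G x.
  rewrite (_ : _ - _ =
    on_square (fun x => (Dh x).2.2 - x.1 * (h x).1) x); first exact: onle.
  by rewrite /on_square !patchE; case: ifP => _; rewrite ?mulr0 ?subr0.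
have up x : square x -> `|(h x).1| + `|(h x).2| <= 3 / 2 + G x / 2.
  move=> sx; apply: norm2_le_majorant; rewrite Gsq//.
  by rewrite (le_trans (ler_norm _))// norm_le_majorant.
have low x : square x -> (1 - G x) / 2 <= `|(h x).1| + `|(h x).2|.
  move=> sx; apply: norm2_ge_majorant; rewrite Gsq// (le_trans (le5 x))//.
  rewrite -[leLHS]add0r lerD ?(ltW eta0)//.
  by rewrite ler_pdivlMr// ler_piMr.
have := majorant_lower_bound sal zal al0 al1 M1le alM dalM ihp1 ihq1 ihp2 ihq2
  iG (onle _ le1) (onle _ le2) r1 r2 up low.
by rewrite IG; exact: energy_of_majorant.
Qed.

End classical_lower_bound.

(** * The divergence theorem on the disc *)

Section line_integrals.
Context {R : realType}.
Local Notation lam := (@lebesgue_measure R).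
Implicit Types f g F dF : R -> R.

Lemma segment_integrable f a b : {in `[a, b]%classic, continuous f} ->
  lam.-integrable `[a, b]%classic (EFin \o f).
Proof.
move=> cf; apply: continuous_compact_integrable; first exact: segment_compact.
exact: continuous_in_subspaceT.
Qed.

Lemma Rintegral_itv_split f (a b c : R) : a <= b -> b <= c ->
  {in `[a, c]%classic, continuous f} ->
  \int[lam]_(t in `[a, c]%classic) f t =
  \int[lam]_(t in `[a, b]%classic) f t + \int[lam]_(t in `[b, c]%classic) f t.
Proof.
move=> ab bc cf; have iac := segment_integrable cf.
have ibc : lam.-integrable `]b, c]%classic (EFin \o f).
  apply: integrableS iac => //.
  by move=> t /=; rewrite !in_itv/= => /andP[/ltW/(le_trans ab) -> ->].
rewrite -(Rintegral_itv_obnd_cbnd ibc) -(Rintegral_itvB iac) ?bnd_simp//.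
by rewrite addrC subrK.
Qed.

(** Differentiability on the whole line makes the limits of [dF] at the end points
automatic. *)
Lemma Rintegral_subst_inc F dF f (a b : R) : a <= b ->
  {in `[a, b] &, {homo F : x y / x < y}} ->
  (forall x : R, is_derive x 1 F (dF x)) -> continuous dF ->
  {in `[F a, F b]%classic, continuous f} ->
  \int[lam]_(t in `[F a, F b]%classic) f t =
  \int[lam]_(t in `[a, b]%classic) (f (F t) * dF t).
Proof.
move=> ab Fi dFd cdF cf.
have dFE : derive1 F = dF.
  by apply/funext => x; rewrite derive1E; have [_ ->] := dFd x.
have cF : continuous F.
  move=> x; apply: differentiable_continuous; apply/derivable1_diffP.
  by have [] := dFd x.
rewrite /Rintegral integration_by_substitution_increasing//.
- by rewrite dFE.
- by rewrite dFE => x _; exact: cdF.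
- by rewrite dFE; apply/cvg_ex; exists (dF a); apply: cvg_at_right_filter; exact: cdF.
- by rewrite dFE; apply/cvg_ex; exists (dF b); apply: cvg_at_left_filter; exact: cdF.
- split; first by move=> x _; have [] := dFd x.
  + by apply: cvg_at_right_filter; exact: cF.
  + by apply: cvg_at_left_filter; exact: cF.
- exact: continuous_in_subspaceT.
Qed.

Lemma Rintegral_subst_dec F dF f (a b : R) : a <= b ->
  {in `[a, b] &, {homo F : x y /~ x < y}} ->
  (forall x : R, is_derive x 1 F (dF x)) -> continuous dF ->
  {in `[F b, F a]%classic, continuous f} ->
  \int[lam]_(t in `[F b, F a]%classic) f t =
  \int[lam]_(t in `[a, b]%classic) (f (F t) * - dF t).
Proof.
move=> ab Fi dFd cdF cf.
have dFE : derive1 F = dF.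
  by apply/funext => x; rewrite derive1E; have [_ ->] := dFd x.
have cF : continuous F.
  move=> x; apply: differentiable_continuous; apply/derivable1_diffP.
  by have [] := dFd x.
rewrite /Rintegral integration_by_substitution_decreasing//.
- by rewrite dFE.
- by rewrite dFE => x _; exact: cdF.
- by rewrite dFE; apply/cvg_ex; exists (dF a); apply: cvg_at_right_filter; exact: cdF.
- by rewrite dFE; apply/cvg_ex; exists (dF b); apply: cvg_at_left_filter; exact: cdF.
- split; first by move=> x _; have [] := dFd x.
  + by apply: cvg_at_right_filter; exact: cF.
  + by apply: cvg_at_left_filter; exact: cF.
- exact: continuous_in_subspaceT.
Qed.

End line_integrals.

Section circle.
Context {R : realType}.

Definition circle (t : R) : R2 R := (cos t, sin t).

Definition closed_disc : set (R2 R) := [set x | x.1 ^+ 2 + x.2 ^+ 2 <= 1].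

Lemma circle_closed_disc t : closed_disc (circle t).
Proof. by rewrite /closed_disc/= cos2Dsin2. Qed.

Lemma continuous_circle : continuous circle.
Proof.
by move=> t; exact: cvg_pair (@continuous_cos R t) (@continuous_sin R t).
Qed.

Definition flip (x : R2 R) : R2 R := (x.2, x.1).

(** The right and the left half of the circle, for [s = 1] and [s = -1], as graphs
over the second coordinate. *)
Definition half (s t : R) : R2 R := (s * Num.sqrt (1 - t ^+ 2), t).

Lemma half_disc s t : s ^+ 2 = 1 -> t \in `[-1, 1]%classic -> closed_disc (half s t).
Proof.
move=> s1; rewrite inE /= in_itv/= -ler_norml => t1.
rewrite /closed_disc /half/= exprMn s1 mul1r sqr_sqrtr ?subrK//.
by rewrite subr_ge0 -real_normK ?num_real// exprn_ile1.
Qed.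

End circle.

Section arcs.
Context {R : realType}.
Local Notation lam := (@lebesgue_measure R).
Variable psi : R2 R -> R.
Hypothesis cpsi : forall x, closed_disc x -> {for x, continuous psi}.

Lemma continuous_half (s : R) : s ^+ 2 = 1 -> {in `[-1, 1]%classic, continuous (psi \o half s)}.
Proof.
move=> s1 t t1; apply: continuous_comp; last by apply: cpsi; exact: half_disc.
have cs : {for t, continuous (fun t : R => s * Num.sqrt (1 - t ^+ 2))}.
  apply: cvgM; first exact: cvg_cst.
  apply: (@continuous_comp _ _ _ (fun t : R => 1 - t ^+ 2)).
    by apply: cvgB; [exact: cvg_cst|exact: exprn_continuous].
  exact: sqrt_continuous.
exact: cvg_pair cs cvg_id.
Qed.

(** An arc of the circle, run through by [t |-> (C t, S t)], that is a graph
over the second coordinate. *)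
Variables (C S : R -> R).
Hypotheses (CS : forall t, C t ^+ 2 + S t ^+ 2 = 1) (cC : continuous C)
  (dS : forall t : R, is_derive t 1 S (C t)).

Let S1 t : S t \in `[-1, 1]%classic.
Proof.
rewrite inE /= in_itv/= -ler_norml -(@ler_pXn2r _ 2) ?nnegrE//.
by rewrite real_normK ?num_real// expr1n -(CS t) lerDr sqr_ge0.
Qed.

Let sub_itv (a b : R) : (a \in `[-1, 1]%classic) -> (b \in `[-1, 1]%classic) ->
  `[a, b]%classic `<=` `[-1, 1]%classic.
Proof.
rewrite !inE/= !in_itv/= => /andP[a1 _] /andP[_ b1] t /=.
by rewrite !in_itv/= => /andP[/(le_trans a1) -> /le_trans]; apply.
Qed.

Let sqrtS t : Num.sqrt (1 - S t ^+ 2) = `|C t|.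
Proof. by rewrite -(CS t) addrK sqrtr_sqr. Qed.

Lemma arc_right (a b : R) : a <= b -> (forall t, a <= t <= b -> 0 <= C t) ->
  {in `[a, b] &, {homo S : x y / x < y}} ->
  \int[lam]_(t in `[a, b]%classic) (psi (C t, S t) * C t) =
  \int[lam]_(t in `[S a, S b]%classic) psi (half 1 t).
Proof.
move=> ab C0 Si.
rewrite (@Rintegral_subst_inc R S C (psi \o half 1) a b)//; last first.
  move=> t /set_mem /(sub_itv (S1 a) (S1 b)) t1.
  by apply: continuous_half; [rewrite expr1n|exact/mem_set].
apply: eq_Rintegral => t; rewrite inE/= in_itv/= => /C0 Ct.
by rewrite /half /= mul1r sqrtS ger0_norm.
Qed.

Lemma arc_left (a b : R) : a <= b -> (forall t, a <= t <= b -> C t <= 0) ->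
  {in `[a, b] &, {homo S : x y /~ x < y}} ->
  \int[lam]_(t in `[a, b]%classic) (psi (C t, S t) * C t) =
  - \int[lam]_(t in `[S b, S a]%classic) psi (half (-1) t).
Proof.
move=> ab C0 Si.
rewrite (@Rintegral_subst_dec R S C (psi \o half (-1)) a b)//; last first.
  move=> t /set_mem /(sub_itv (S1 b) (S1 a)) t1.
  by apply: continuous_half; [rewrite sqrrN expr1n|exact/mem_set].
rewrite -[RHS]mulN1r -RintegralZl.
- apply: eq_Rintegral => t; rewrite inE/= in_itv/= => /C0 Ct.
  by rewrite /half /= !mulN1r sqrtS ler0_norm// mulrN !opprK.
- exact: measurable_itv.
- apply: segment_integrable => t _.
  apply: cvgM; last by apply: cvgN; exact: cC.
  apply: (@continuous_comp _ _ _ (fun t => half (-1) (S t)) psi); last first.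
    by apply: cpsi; apply: half_disc; [rewrite sqrrN expr1n|exact: S1].
  have cS : {for t, continuous S}.
    apply: differentiable_continuous; apply/derivable1_diffP.
    by have [] := dS t.
  have cs : {for t, continuous (fun t : R => -1 * Num.sqrt (1 - S t ^+ 2))}.
    apply: cvgM; first exact: cvg_cst.
    apply: (@continuous_comp _ _ _ (fun t : R => 1 - S t ^+ 2)).
      apply: cvgB; first exact: cvg_cst.
      by apply: (@continuous_comp _ _ _ S (fun t => t ^+ 2)) => //; exact: exprn_continuous.
    exact: sqrt_continuous.
  exact: cvg_pair cs cS.
Qed.

End arcs.

Section circle_integrals.
Context {R : realType}.
Local Notation lam := (@lebesgue_measure R).
Variable psi : R2 R -> R.
Hypothesis cpsi : forall x, closed_disc x -> {for x, continuous psi}.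

Let ccirc (k : R -> R) : continuous k ->
  continuous (fun t => psi (circle t) * k t).
Proof.
move=> ck t; apply: cvgM; last exact: ck.
apply: continuous_comp; first exact: continuous_circle.
exact/cpsi/circle_closed_disc.
Qed.

Let half_int (s : R) : s ^+ 2 = 1 -> \int[lam]_(t in `[-1, 1]%classic) psi (half s t) =
  \int[lam]_(t in `[-1, 0]%classic) psi (half s t) +
  \int[lam]_(t in `[0, 1]%classic) psi (half s t).
Proof.
move=> s1; apply: Rintegral_itv_split => //; exact: continuous_half.
Qed.

(** The circle is cut at [- pi / 2] and [pi / 2]: the arc in the middle is the
right half, and the two others make up the left half. *)
Lemma circle_integral1 :
  \int[lam]_(t in `[- pi, pi]%classic) (psi (circle t) * cos t) =
  \int[lam]_(t in `[-1, 1]%classic) psi (half 1 t) -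
  \int[lam]_(t in `[-1, 1]%classic) psi (half (-1) t).
Proof.
have pi0 := @pi_gt0 R; have cc := ccirc (@continuous_cos R).
have in_pi (a b : R) x : x \in `[a, b] -> a <= x <= b by rewrite in_itv.
have ds (t : R) : is_derive t 1 (@sin R) (cos t) by exact: is_derive_sin.
have cs2 := @cos2Dsin2 R; have ccos := @continuous_cos R.
rewrite (@Rintegral_itv_split _ _ _ (- (pi / 2))); [|lra|lra|by move=> x _; exact: cc].
rewrite (@Rintegral_itv_split _ _ (- (pi / 2)) (pi / 2)); [|lra|lra|by move=> x _; exact: cc].
rewrite (arc_right cpsi cs2 ccos ds (_ : - (pi / 2) <= pi / 2)); last 3 first.
- lra.
- by move=> t; exact: cos_ge0_pihalf.
- by move=> x y xp yp; rewrite ltr_sin.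
rewrite (arc_left cpsi cs2 ccos ds (_ : - pi <= - (pi / 2))); last 3 first.
- lra.
- move=> t /andP[t1 t2]; rewrite -[cos t]opprK -cosDpi oppr_le0.
  by apply: cos_ge0_pihalf; apply/andP; split; lra.
- move=> x y /in_pi/andP[x1 x2] /in_pi/andP[y1 y2] yx.
  rewrite -(opprK (sin x)) -(opprK (sin y)) ltrN2 -!sinDpi ltr_sin ?ltrD2r//;
    by rewrite in_itv/=; apply/andP; split; lra.
rewrite (arc_left cpsi cs2 ccos ds (_ : pi / 2 <= pi)); last 3 first.
- lra.
- move=> t /andP[t1 t2]; rewrite -[t](subrK pi) cosDpi oppr_le0.
  by apply: cos_ge0_pihalf; apply/andP; split; lra.
- move=> x y /in_pi/andP[x1 x2] /in_pi/andP[y1 y2] yx.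
  rewrite -[x](subrK pi) -[y](subrK pi) !sinDpi ltrN2 ltr_sin ?ltrD2r//;
    by rewrite in_itv/=; apply/andP; split; lra.
rewrite !sinN sin_pihalf sinpi oppr0 (@half_int (-1)) ?sqrrN ?expr1n//; ring.
Qed.

(** The arcs [-pi, 0] and [0, pi] are graphs over the first coordinate; a
quarter turn makes them graphs over the second one. *)
Lemma circle_integral2 :
  \int[lam]_(t in `[- pi, pi]%classic) (psi (circle t) * sin t) =
  \int[lam]_(t in `[-1, 1]%classic) psi (flip (half 1 t)) -
  \int[lam]_(t in `[-1, 1]%classic) psi (flip (half (-1) t)).
Proof.
have pi0 := @pi_gt0 R; have cc := ccirc (@continuous_sin R).
have in_pi (a b : R) x : x \in `[a, b] -> a <= x <= b by rewrite in_itv.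
pose turn (x : R2 R) : R2 R := (x.2, - x.1).
have cturn x : closed_disc x -> {for x, continuous (psi \o turn)}.
  move=> dx; apply: (@continuous_comp _ _ _ turn psi); last first.
    by apply: cpsi; rewrite /closed_disc/= sqrrN addrC.
  have c1 : {for x, continuous (fun y : R2 R => y.2)} by exact: cvg_snd.
  have c2 : {for x, continuous (fun y : R2 R => - y.1)}.
    by apply: cvgN; exact: cvg_fst.
  exact: cvg_pair c1 c2.
have ds (t : R) : is_derive t 1 (@cos R) (- sin t) by exact: is_derive_cos.
have cs2 (t : R) : (- sin t) ^+ 2 + cos t ^+ 2 = 1 by rewrite sqrrN addrC cos2Dsin2.
have csin : continuous (fun t : R => - sin t).
  by move=> t; apply: cvgN; exact: continuous_sin.
rewrite (@Rintegral_itv_split _ _ _ 0); [|lra|lra|by move=> x _; exact: cc].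
have up : \int[lam]_(t in `[0, pi]%classic) (psi (circle t) * - sin t) =
    - \int[lam]_(t in `[-1, 1]%classic) psi (flip (half 1 t)).
  have := arc_left cturn cs2 csin ds (ltW pi0).
  rewrite cospi cos0 => al; apply: etrans (etrans (al _ _) _).
  - by apply: eq_Rintegral => t _; rewrite /turn/= opprK.
  - by move=> t /sin_ge0_pi; rewrite oppr_le0.
  - by move=> x y xp yp yx; rewrite ltr_cos.
  - by congr (- _); apply: eq_Rintegral => t _; rewrite /turn /half/= mulN1r mul1r opprK.
have down : \int[lam]_(t in `[- pi, 0]%classic) (psi (circle t) * - sin t) =
    \int[lam]_(t in `[-1, 1]%classic) psi (flip (half (-1) t)).
  have npi : - pi <= 0 :> R by rewrite oppr_le0 ltW.
  have := arc_right cturn cs2 csin ds npi.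
  rewrite cosN cospi cos0 => ar; apply: etrans (etrans (ar _ _) _).
  - by apply: eq_Rintegral => t _; rewrite /turn/= opprK.
  - move=> t /andP[t1 t2]; rewrite -sinN; apply: sin_ge0_pi.
    by apply/andP; split; lra.
  - move=> x y /in_pi/andP[x1 x2] /in_pi/andP[y1 y2] xy.
    rewrite -(cosN x) -(cosN y) ltr_cos ?ltrN2//;
      by rewrite in_itv/=; apply/andP; split; lra.
  - by apply: eq_Rintegral => t _; rewrite /turn /half/= mulN1r mul1r.
have neg (a b : R) : \int[lam]_(t in `[a, b]%classic) (psi (circle t) * sin t) =
    - \int[lam]_(t in `[a, b]%classic) (psi (circle t) * - sin t).
  rewrite -mulN1r -RintegralZl; last 2 first.
  - exact: measurable_itv.
  - by apply: segment_integrable => t _; apply: ccirc.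
  by apply: eq_Rintegral => t _; rewrite mulN1r mulrN opprK.
by rewrite !neg up down opprK addrC.
Qed.

End circle_integrals.

Section disc.
Context {R : realType}.
Local Notation lam := (@lebesgue_measure R).
Local Notation X := (R2 (measurableTypeR R)).

Lemma closed_closed_disc : closed (@closed_disc R).
Proof.
have c (x : R2 R) : {for x, continuous (fun x : R2 R => x.1 ^+ 2 + x.2 ^+ 2)}.
  by apply: cvgD; apply: (@continuous_comp _ _ _ _ (fun t : R => t ^+ 2));
    (exact: cvg_fst || exact: cvg_snd || exact: exprn_continuous).
rewrite (_ : closed_disc = (fun x : R2 R => x.1 ^+ 2 + x.2 ^+ 2) @^-1`
  [set t | t <= 1]) //.
by apply: closed_comp => [x _|]; [exact: c|exact: closed_le].
Qed.

Lemma closed_disc_sub : @closed_disc R `<=` `[-1, 1]%classic `*` `[-1, 1]%classic.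
Proof.
have h (a b : R) : a ^+ 2 + b ^+ 2 <= 1 -> -1 <= a <= 1.
  move=> ab; rewrite -ler_norml -(@ler_pXn2r _ 2) ?nnegrE//.
  rewrite real_normK ?num_real// expr1n (le_trans _ ab)// lerDl sqr_ge0//.
move=> x dx; split; rewrite /= in_itv/=; first exact: h dx.
by apply: (h _ x.1); rewrite addrC.
Qed.

Lemma compact_closed_disc : compact (@closed_disc R).
Proof.
apply: subclosed_compact closed_disc_sub; first exact: closed_closed_disc.
by apply: compact_setX; exact: segment_compact.
Qed.

Lemma unit_disc_closed_disc : @unit_disc R `<=` closed_disc.
Proof. by move=> x; exact: ltW. Qed.

Lemma area_disc_fin : (@area R (@unit_disc R) < +oo)%E.
Proof.
have m11 : measurable (`[-1, 1]%classic : set (measurableTypeR R)) by exact: measurable_itv.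
apply: (@le_lt_trans _ _ (@area R (`[-1, 1]%classic `*` `[-1, 1]%classic))).
  apply: le_measure; rewrite ?inE.
  - exact: measurable_unit_disc.
  - exact: measurableX.
  - exact: subset_trans unit_disc_closed_disc closed_disc_sub.
have l2 : lam `[-1, 1]%classic = (1 - (-1))%:E.
  apply: etrans (lebesgue_measure_itv _) _ => /=.
  by rewrite lte_fin ifT//; lra.
rewrite [X in (X < _)%E](product_measure1E lam lam m11 m11 : _ = _).
by rewrite [X in (X * X)%E](l2 : _ = _) -EFinM ltry.
Qed.

Lemma continuous_closed_disc_integrable (D : R2 R -> R) :
  (forall x, closed_disc x -> {for x, continuous D}) ->
  (@area R).-integrable (@unit_disc R) (EFin \o D).
Proof.
move=> cD; apply: measurable_bounded_integrable.
- exact: measurable_unit_disc.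
- exact: area_disc_fin.
- apply: (@continuous_at_measurable R _ _ _ (fun x : X => x : R2 R)).
    move=> U oU; apply: measurableI; first exact: measurable_unit_disc.
    exact: (open_measurable_R2 oU).
  by move=> x /unit_disc_closed_disc; exact: cD.
- have : compact (D @` @closed_disc R).
    apply: continuous_compact; last exact: compact_closed_disc.
    by apply: continuous_in_subspaceT => x /set_mem; exact: cD.
  move=> /compact_bounded[M [Mr hM]]; exists M; split => // N MN x dx.
  by apply: hM MN _ _; exists x => //; exact: unit_disc_closed_disc.
Qed.

(** The fundamental theorem of calculus on the chord at height [u].  For [|u| = 1]
the chord is empty, but its end points coincide and their contributions
cancel. *)
Lemma chord_integral (u : R) (g dg : R -> R) :
  (forall t, t ^+ 2 + u ^+ 2 <= 1 ->
     [/\ derivable g t 1, derive1 g t = dg t & {for t, continuous dg}]) ->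
  (\int[lam]_(t in [set t : R | (t ^+ 2 + u ^+ 2 < 1)%R]) (dg t)%:E =
   if (`|u| <= 1)%R then (g (Num.sqrt (1 - u ^+ 2)) - g (- Num.sqrt (1 - u ^+ 2)))%:E
   else 0)%E.
Proof.
move=> hg; set r := Num.sqrt _.
have r0 : 0 <= r by exact: sqrtr_ge0.
have [u1|u1] := ltP (u ^+ 2) 1; last first.
  rewrite (_ : [set _ | _] = set0) ?integral_set0; last first.
    rewrite -subset0 => t /= tu.
    by have := le_lt_trans u1 (le_lt_trans (_ : u ^+ 2 <= t ^+ 2 + u ^+ 2) tu);
      rewrite lerDr sqr_ge0 ltxx => /(_ isT).
  by rewrite /r ler0_sqrtr ?subr_le0// oppr0 subrr if_same.
have r2 : r ^+ 2 = 1 - u ^+ 2 by rewrite sqr_sqrtr// subr_ge0 ltW.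
have rgt0 : 0 < r by rewrite sqrtr_gt0 subr_gt0.
rewrite ifT; last first.
  by rewrite -(@ler_pXn2r _ 2) ?nnegrE// real_normK ?num_real// expr1n ltW.
have -> : [set t : R | t ^+ 2 + u ^+ 2 < 1] = `]- r, r[%classic.
  apply/seteqP; split => t /=; rewrite in_itv/= -ltr_norml -ltrBrDr -r2.
    by rewrite -[t ^+ 2]real_normK ?num_real// ltr_pXn2r ?nnegrE.
  by rewrite -[t ^+ 2]real_normK ?num_real// ltr_pXn2r ?nnegrE.
have hr t : t \in `[- r, r] -> t ^+ 2 + u ^+ 2 <= 1.
  rewrite in_itv/= -ler_norml => tr; rewrite -lerBrDr -r2.
  by rewrite -[t ^+ 2]real_normK ?num_real// ler_pXn2r ?nnegrE.
have cdg : {within `[- r, r], continuous dg}.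
  by apply: continuous_in_subspaceT => t; rewrite inE => /hr /hg [].
have mdg : measurable_fun (`[- r, r]%classic : set (measurableTypeR R)) (EFin \o dg).
  apply/measurable_EFinP; apply: subspace_continuous_measurable_fun cdg.
  exact: measurable_itv.
have mdg' : measurable_fun (`]- r, r]%classic : set (measurableTypeR R)) (EFin \o dg).
  apply: measurable_funS mdg => //.
  by apply: subset_itvr; rewrite bnd_simp.
rewrite integral_itv_bndo_bndc; last first.
  apply: measurable_funS mdg => //.
  by apply: subset_itv; rewrite bnd_simp.
rewrite integral_itv_obnd_cbnd//.
have cg t : t \in `[- r, r] -> {for t, continuous g}.
  move=> /hr /hg [d _ _]; apply: differentiable_continuous.
  exact/derivable1_diffP.
rewrite (@continuous_FTC2 R dg g)//.
- by rewrite gtrN.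
- split.
  + by move=> t tr; have [] := hg t (hr t (subset_itv_oo_cc tr)).
  + by apply: cvg_at_right_filter; apply: cg; rewrite in_itv/= lexx/=; lra.
  + by apply: cvg_at_left_filter; apply: cg; rewrite in_itv/= lexx andbT; lra.
- by move=> t tr; have [] := hg t (hr t (subset_itv_oo_cc tr)).
Qed.

Section green.
Variable psi : R2 R -> R.
Hypothesis dpsi : forall x, closed_disc x -> differentiable psi x.

Let cpsi x : closed_disc x -> {for x, continuous psi}.
Proof. by move=> /dpsi; exact: differentiable_continuous. Qed.

(** The difference quotients of [f \o k] at [t] are those of the directional
derivative of [f]. *)
Lemma derive1_line (f : R2 R -> R) (x v : R2 R) (t : R) (k : R -> R2 R) :
  (forall h, h *: v + x = k (h + t)) -> x = k t -> derivable f x v ->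
  derivable (f \o k) t 1 /\ derive1 (f \o k) t = 'D_v f x.
Proof.
move=> hk xk df; have E : (fun h => h^-1 *: ((f \o k) (h *: 1 + t) - (f \o k) t)) =
    (fun h => h^-1 *: (f (h *: v + x) - f x)).
  by apply/funext => h /=; rewrite hk -xk -[h *: 1]/(h * 1) mulr1.
split; first by rewrite /derivable E.
by rewrite derive1E /derive E.
Qed.

(** Fubini along the chords: their end points run through the two halves of the
circle, whose integrals are those of [circle_integral1]. *)
Lemma disc_green1 : (forall x, closed_disc x -> {for x, continuous ('D_(1, 0) psi)}) ->
  \int[area]_(x in @unit_disc R) 'D_(1, 0) psi x =
  \int[lam]_(t in `[- pi, pi]%classic) (psi (circle t) * cos t).
Proof.
move=> cD; have iD := continuous_closed_disc_integrable cD.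
have mdisc := @measurable_unit_disc R.
pose w := ('D_(1, 0) psi) \_ (@unit_disc R).
have iw : (@area R).-integrable setT (EFin \o w).
  by rewrite /w -restrict_EFin; apply/(integrable_mkcond _ mdisc).1.
have ch s : s ^+ 2 = 1 -> {in `[-1, 1]%classic, continuous (psi \o half s)}.
  exact: continuous_half.
have ih s : s ^+ 2 = 1 -> lam.-integrable `[-1, 1]%classic (EFin \o (psi \o half s)).
  by move=> s1; apply: segment_integrable; exact: ch.
have s1 : (1 : R) ^+ 2 = 1 by rewrite expr1n.
have sN : (-1 : R) ^+ 2 = 1 by rewrite sqrrN expr1n.
rewrite circle_integral1// -RintegralB//; [|exact: ih|exact: ih].
rewrite Rintegral_mkcond -/w /Rintegral -(integral21_prod_meas1 iw) /fubini_G.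
congr fine; rewrite [RHS]integral_mkcond; apply: eq_integral => u _.
have -> : (\int[lam]_t (EFin \o w) (t, u) =
    \int[lam]_(t in [set t : R | (t ^+ 2 + u ^+ 2 < 1)%R]) ('D_(1, 0) psi (t, u))%:E)%E.
  rewrite [RHS]integral_mkcond; apply: eq_integral => t _.
  rewrite /w /= !patchE.
  rewrite (_ : _ \in _ = (t \in [set t : R | t ^+ 2 + u ^+ 2 < 1])); last first.
    by apply/idP/idP => /set_mem h; apply/mem_set.
  by case: ifP.
rewrite (@chord_integral u (fun t => psi (t, u))).
  rewrite patchE /half mul1r mulN1r; have -> : (u \in `[-1, 1]%classic) = (`|u| <= 1).
    by rewrite ler_norml; apply/idP/idP => [/set_mem|ui]; rewrite ?inE /= in_itv.
  by case: ifP.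
move=> t tu; have ht (h : R) : h *: ((1, 0) : R2 R) + (t, u) = (h + t, u).
  by rewrite -[LHS]/(h * 1 + t, h * 0 + u) mulr1 mulr0 add0r.
have dv : derivable psi (t, u) (1, 0) by apply: diff_derivable; exact: dpsi.
have [d1 d2] := @derive1_line psi (t, u) (1, 0) t (fun t => (t, u)) ht erefl dv.
split; [exact: d1|exact: d2|].
apply: (@continuous_comp _ _ _ (fun t : R => (t, u) : R2 R) ('D_(1, 0) psi)).
  exact: cvg_pair cvg_id (cvg_cst u).
exact: cD.
Qed.

Lemma disc_green2 : (forall x, closed_disc x -> {for x, continuous ('D_(0, 1) psi)}) ->
  \int[area]_(x in @unit_disc R) 'D_(0, 1) psi x =
  \int[lam]_(t in `[- pi, pi]%classic) (psi (circle t) * sin t).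
Proof.
move=> cD; have iD := continuous_closed_disc_integrable cD.
have mdisc := @measurable_unit_disc R.
pose w := ('D_(0, 1) psi) \_ (@unit_disc R).
have iw : (@area R).-integrable setT (EFin \o w).
  by rewrite /w -restrict_EFin; apply/(integrable_mkcond _ mdisc).1.
have cflip x : closed_disc x -> {for x, continuous (psi \o flip)}.
  move=> dx; apply: (@continuous_comp _ _ _ flip psi); last first.
    by apply: cpsi; rewrite /closed_disc/= addrC.
  have c1 : {for x, continuous (fun y : R2 R => y.2)} by exact: cvg_snd.
  have c2 : {for x, continuous (fun y : R2 R => y.1)} by exact: cvg_fst.
  exact: cvg_pair c1 c2.
have ih s : s ^+ 2 = 1 ->
    lam.-integrable `[-1, 1]%classic (EFin \o ((psi \o flip) \o half s)).
  by move=> s1; apply: segment_integrable; exact: continuous_half.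
have s1 : (1 : R) ^+ 2 = 1 by rewrite expr1n.
have sN : (-1 : R) ^+ 2 = 1 by rewrite sqrrN expr1n.
rewrite circle_integral2// -RintegralB//; [|exact: ih|exact: ih].
rewrite Rintegral_mkcond -/w /Rintegral -(integral12_prod_meas1 iw) /fubini_F.
congr fine; rewrite [RHS]integral_mkcond; apply: eq_integral => u _.
have -> : (\int[lam]_t (EFin \o w) (u, t) =
    \int[lam]_(t in [set t : R | (t ^+ 2 + u ^+ 2 < 1)%R]) ('D_(0, 1) psi (u, t))%:E)%E.
  rewrite [RHS]integral_mkcond; apply: eq_integral => t _.
  rewrite /w /= !patchE.
  rewrite (_ : _ \in _ = (t \in [set t : R | t ^+ 2 + u ^+ 2 < 1])); last first.
    apply/idP/idP => /set_mem h; apply/mem_set; move: h;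
      by rewrite /unit_disc /= addrC.
  by case: ifP.
rewrite (@chord_integral u (fun t => psi (u, t))).
  rewrite patchE /flip /half/= mul1r mulN1r.
  have -> : (u \in `[-1, 1]%classic) = (`|u| <= 1).
    by rewrite ler_norml; apply/idP/idP => [/set_mem|ui]; rewrite ?inE /= in_itv.
  by case: ifP.
move=> t tu; have dd : closed_disc (u, t) by rewrite /closed_disc /= addrC.
have ht (h : R) : h *: ((0, 1) : R2 R) + (u, t) = (u, h + t).
  by rewrite -[LHS]/(h * 0 + u, h * 1 + t) mulr1 mulr0 add0r.
have dv : derivable psi (u, t) (0, 1) by apply: diff_derivable; exact: dpsi.
have [d1 d2] := @derive1_line psi (u, t) (0, 1) t (fun t => (u, t)) ht erefl dv.
split; [exact: d1|exact: d2|].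
apply: (@continuous_comp _ _ _ (fun t : R => (u, t) : R2 R) ('D_(0, 1) psi)).
  exact: cvg_pair (cvg_cst u) cvg_id.
exact: cD.
Qed.

End green.

End disc.

(** * Image measures *)

Section restricted_image.
Context {R : realType} dZ dY (Z : measurableType dZ) (Y : measurableType dY).
Variables (B : {measure set Z -> \bar R}) (D : set Z) (mD : measurable D).
Variables (Phi : Z -> Y) (mPhi : measurable_fun setT Phi).

(** The measure structure of a push-forward depends on the proof that the map is
measurable, which is why the structure is given by name. *)
Definition restricted_image : {measure set Y -> \bar R} :=
  measure_function_pushforward__canonical__measure_function_Measure
    (mrestr B mD) mPhi.

Let mrestr_integral (E : set Z) (f : Z -> \bar R) : measurable E -> D `<=` E ->
  measurable_fun E f -> B.-integrable D f ->
  (mrestr B mD).-integrable E f /\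
  (\int[mrestr B mD]_(z in E) f z = \int[B]_(z in D) f z)%E.
Proof.
move=> mE DE mf iD.
have mED : measurable (E `\` D) by exact: measurableD.
have ED0 : mrestr B mD (E `\` D) = 0%E.
  by rewrite /mrestr setIC setDIK measure0.
have EED : E `\` (E `\` D) = D by rewrite setDD setIidr.
have eqD (g : Z -> \bar R) :
    (\int[mrestr B mD]_(z in D) g z = \int[B]_(z in D) g z)%E.
  apply: eq_measure_integral => A mA AD.
  by rewrite [LHS]/(B (A `&` D)) setIidl.
have iE : (mrestr B mD).-integrable E f.
  apply/(negligible_integrable mED mE mf ED0); rewrite EED.
  apply/integrableP; split; first exact: measurable_funS mf.
  by rewrite eqD; case/integrableP : iD.
split=> //.
by rewrite (negligible_integral mED mE iE ED0) EED.
Qed.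

(** Outside [D] the restricted measure has no mass, so that integrability of
[f \o Phi] on [D] alone is enough. *)
Lemma integral_restricted_image (E : set Y) (f : Y -> \bar R) : measurable E ->
  D `<=` Phi @^-1` E -> measurable_fun E f -> B.-integrable D (f \o Phi) ->
  (\int[restricted_image]_(y in E) f y = \int[B]_(z in D) f (Phi z))%E.
Proof.
move=> mE DE mf iD.
have mEZ : measurable (Phi @^-1` E) by rewrite -[_ @^-1` _]setTI; exact: mPhi.
have mfE : measurable_fun setT (f \_ E) by exact/(measurable_restrictT _ mE).1.
have fD z : D z -> (f \_ E) (Phi z) = f (Phi z).
  by move=> Dz; rewrite patchE mem_set//; exact: DE.
have iD' : B.-integrable D ((f \_ E) \o Phi).
  by apply: eq_integrable iD => // z /set_mem Dz /=; rewrite fD.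
have [i1 e1] := mrestr_integral mEZ DE
  (measurable_funTS (measurableT_comp mfE mPhi)) iD'.
have -> : (\int[restricted_image]_(y in E) f y =
    \int[restricted_image]_(y in E) (f \_ E) y)%E.
  by apply: eq_integral => y Ey; rewrite patchE Ey.
rewrite /restricted_image integral_pushforward//.
rewrite [LHS]e1; apply: eq_integral => z /set_mem Dz; exact: fD.
Qed.

End restricted_image.

(** * The relaxed minimizer *)

Section disc_topology.
Context {R : realType}.

(** A point of the closed disc is the limit of its contractions [t *: x]. *)
Lemma closure_unit_disc : closure (@unit_disc R) = closed_disc.
Proof.
apply/seteqP; split.
  rewrite (closure_id closed_disc).1; last exact: closed_closed_disc.
  by apply: closure_subset; exact: unit_disc_closed_disc.
move=> x dx B; pose k (t : R) : R2 R := (t * x.1, t * x.2).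
have ck : {for 1, continuous k}.
  have c1 : {for 1, continuous (fun t : R => t * x.1)}.
    by apply: cvgM; [exact: cvg_id|exact: cvg_cst].
  have c2 : {for 1, continuous (fun t : R => t * x.2)}.
    by apply: cvgM; [exact: cvg_id|exact: cvg_cst].
  exact: cvg_pair c1 c2.
have xk : x = k 1 by rewrite /k !mul1r; case: (x).
rewrite [X in nbhs X]xk.
move=> /ck /nbhs_ballP [e /= e0 eB].
pose t := 1 - Num.min (e / 2) 2^-1.
have m0 : 0 < Num.min (e / 2) 2^-1 by rewrite lt_min divr_gt0//= invr_gt0.
have m1 : Num.min (e / 2) 2^-1 <= 2^-1 by rewrite ge_min lexx orbT.
have me : Num.min (e / 2) 2^-1 <= e / 2 by rewrite ge_min lexx.
exists (k t); split; last first.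
  apply: eB; rewrite /ball/= /t opprB addrC subrK gtr0_norm//; lra.
rewrite /unit_disc /k/= !exprMn -mulrDr.
have t0 : 0 <= t by rewrite /t; lra.
have t1 : t ^+ 2 < 1 by rewrite expr_lt1// /t; lra.
by rewrite (le_lt_trans _ t1)// ler_piMr// sqr_ge0.
Qed.

Lemma boundary_unit_disc :
  boundary (@unit_disc R) = [set x : R2 R | x.1 ^+ 2 + x.2 ^+ 2 = 1].
Proof.
rewrite /boundary closure_unit_disc ((interior_id _).1 (@open_unit_disc R)).
apply/seteqP; split => x.
  move=> [dx nx]; apply/eqP; rewrite eq_le; apply/andP; split => //.
  by rewrite leNgt; apply/negP.
by move=> /= x1; split; rewrite /closed_disc /unit_disc /= x1 ?ltxx.
Qed.

Lemma measurable_boundary_disc :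
  measurable (boundary (@unit_disc R) : set (R2 R)).
Proof.
rewrite /boundary; apply: measurableD.
  rewrite closure_unit_disc -[closed_disc]setCK; apply: measurableC.
  by apply: open_measurable_R2; apply: closed_openC; exact: closed_closed_disc.
by apply: open_measurable_R2; exact: open_interior.
Qed.

End disc_topology.

Lemma compact_measure_support (T : topologicalType) (R : realType)
    (mu : set T -> \bar R) (K : set T) : hausdorff_space T -> compact K ->
  mu (~` K) = 0%E -> compact (measure_support mu).
Proof.
move=> hT cK K0; have clK := compact_closed hT cK.
apply: subclosed_compact cK _.
  rewrite -[measure_support mu]setCK; apply: open_closedC.
  rewrite openE => p /existsNP[U /not_implyP[oU /not_implyP[Up nU]]].
  rewrite /interior /= nbhsE; exists U; first by [].
  by move=> q Uq /(_ U oU Uq).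
move=> p sp; apply: contrapT => nKp.
have := sp (~` K) (closed_openC clK) nKp.
by rewrite K0 ltxx.
Qed.

Lemma basis2_ord0 (R : realType) : basis2 R ord0 = (1, 0).
Proof. by []. Qed.

Lemma basis2_ord_max (R : realType) : basis2 R ord_max = (0, 1).
Proof. by []. Qed.

Section circle_motion.
Context {R : realType}.

Definition turn (t : R) : R2 R := circle (2 * pi * t).

Lemma continuous_turn : continuous turn.
Proof.
move=> t; apply: continuous_comp; last exact: continuous_circle.
by apply: cvgM; [exact: cvg_cst|exact: cvg_id].
Qed.

Lemma turn01 : turn 0 = turn 1.
Proof.
rewrite /turn mulr0 mulr1 /circle cos0 sin0 mulr_natl cos2pi sin2pi//.
Qed.

Lemma derive_along_turn (phi : R2 R * R2 R -> R) (x : R2 R) (t : R) :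
  differentiable phi (x, turn t) ->
  derivable (fun t => phi (x, turn t)) t 1 /\
  derive1 (fun t => phi (x, turn t)) t =
    2 * pi * ('D_(0, basis2 R ord0) phi (x, turn t) * - (turn t).2 +
              'D_(0, basis2 R ord_max) phi (x, turn t) * (turn t).1).
Proof.
move=> dphi; set w := 2 * pi.
have dl : is_derive t 1 (fun t : R => w * t) w.
  by apply: is_derive_eq; rewrite /GRing.scale/= mulr1.
have dc : is_derive t 1 (fun t : R => cos (w * t)) (- sin (w * t) * w).
  exact: (@is_derive1_comp _ cos (fun t : R => w * t)).
have ds : is_derive t 1 (fun t : R => sin (w * t)) (cos (w * t) * w).
  exact: (@is_derive1_comp _ sin (fun t : R => w * t)).
have diffc : differentiable (fun t : R => cos (w * t)) t.
  by apply/derivable1_diffP; have [] := dc.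
have diffs : differentiable (fun t : R => sin (w * t)) t.
  by apply/derivable1_diffP; have [] := ds.
have difft : differentiable turn t by exact: differentiable_pair.
have diffk : differentiable (fun t => (x, turn t)) t.
  by apply: differentiable_pair => //; exact: differentiable_cst.
have dcmp : differentiable (phi \o (fun t => (x, turn t))) t.
  exact: differentiable_comp.
split; first exact/derivable1_diffP.
rewrite derive1E'; last exact: dcmp.
have dk1 : 'd (fun t => (x, turn t)) t 1 =
    (0, (- sin (w * t) * w, cos (w * t) * w)).
  have diffx : differentiable (fun=> x : R2 R) t by exact: differentiable_cst.
  rewrite (diff_pair diffx difft).
  congr (_, _); first by rewrite diff_cst.
  rewrite (diff_pair diffc diffs); congr (_, _).
    by rewrite -deriveE//; have [_ ->] := dc.
  by rewrite -deriveE//; have [_ ->] := ds.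
rewrite -[(fun t => phi _)]/(phi \o (fun t => (x, turn t))) diff_comp//=.
rewrite dk1.
have comb (a b : R) : ((0, (a, b)) : R2 R * R2 R) =
    a *: ((0, basis2 R ord0) : R2 R * R2 R) + b *: ((0, basis2 R ord_max) : R2 R * R2 R).
  rewrite basis2_ord0 basis2_ord_max.
  have e : ((a, b) : R2 R) = a *: ((1, 0) : R2 R) + b *: ((0, 1) : R2 R).
    by rewrite -[RHS]/(a * 1 + b * 0, a * 0 + b * 1) !mulr0 !mulr1 addr0 add0r.
  rewrite -[RHS]/(a *: (0 : R2 R) + b *: (0 : R2 R),
    a *: ((1, 0) : R2 R) + b *: ((0, 1) : R2 R)).
  by rewrite -e !scaler0 addr0.
rewrite comb linearD !linearZ !(deriveE _ dphi).
set a := 'd phi _ _; set b := 'd phi _ _; rewrite -/w.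
rewrite -[LHS]/((- sin (w * t) * w) * a + (cos (w * t) * w) * b).
by move: (cos _) (sin _) a b => c s a b; ring.
Qed.

End circle_motion.

Section relaxed_minimizer.
Context {R : realType}.
Local Notation lam := (@lebesgue_measure R).
Local Notation MR := (measurableTypeR R).
Local Notation X := (R2 MR).
Local Notation Z := (X * MR)%type.
Local Notation vol := (@area R \x @lebesgue_measure R)%E.
Local Notation I01 := (`[0, 1]%classic : set R).

Definition cylinder : set Z := @unit_disc R `*` I01.

Definition torus_chart : set X := `[- pi, pi]%classic `*` I01.

Lemma measurable_I01 : measurable (I01 : set MR). Proof. exact: measurable_itv. Qed.

Lemma measurable_cylinder : measurable cylinder.
Proof. by apply: measurableX; [exact: measurable_unit_disc|exact: measurable_I01]. Qed.

Lemma measurable_torus_chart : measurable torus_chart.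
Proof. by apply: measurableX; [exact: measurable_itv|exact: measurable_I01]. Qed.

Lemma lam_I01 : lam I01 = 1%E.
Proof.
apply: etrans (lebesgue_measure_itv _) _ => /=.
by rewrite lte_fin ltr01 sube0.
Qed.

Lemma vol_cylinder : vol cylinder = area (@unit_disc R).
Proof.
rewrite [LHS](product_measure1E _ _ (@measurable_unit_disc R) measurable_I01 : _ = _).
by rewrite [X in (_ * X)%E](lam_I01 : _ = _) mule1.
Qed.

Lemma continuous_cylinder_integrable (F : R2 R * R -> R) :
  (forall z, closed_disc z.1 -> {for z, continuous F}) ->
  vol.-integrable cylinder (EFin \o F).
Proof.
move=> cF; apply: measurable_bounded_integrable.
- exact: measurable_cylinder.
- rewrite [X in (X < _)%E](vol_cylinder : _ = _); exact: area_disc_fin.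
- apply: (@continuous_at_measurable R _ _ _ (fun z : Z => z : R2 R * R)).
    move=> U oU; apply: measurableI; first exact: measurable_cylinder.
    exact: (open_measurable_R2R oU).
  by move=> z [/unit_disc_closed_disc dz _]; exact: cF.
- have : compact (F @` (@closed_disc R `*` I01)).
    apply: continuous_compact.
      by apply: continuous_in_subspaceT => z /set_mem[dz _]; exact: cF.
    by apply: compact_setX; [exact: compact_closed_disc|exact: segment_compact].
  move=> /compact_bounded[M [Mr hM]]; exists M; split => // N MN z [dz tz].
  by apply: hM MN _ _; exists z => //; split=> //; exact: unit_disc_closed_disc.
Qed.

Lemma continuous_torus_integrable (F : R2 R -> R) : continuous F ->
  area.-integrable torus_chart (EFin \o F).
Proof.
move=> cF.
have mp : measurable (`[- pi, pi]%classic : set MR) by exact: measurable_itv.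
have pi0 := @pi_gt0 R.
apply: measurable_bounded_integrable.
- exact: measurable_torus_chart.
- rewrite [X in (X < _)%E](product_measure1E _ _ mp measurable_I01 : _ = _).
  rewrite [X in (_ * X)%E](lam_I01 : _ = _) mule1.
  rewrite [X in (X < _)%E](_ : _ = (pi - (- pi))%:E); last first.
    by apply: etrans (lebesgue_measure_itv _) _; rewrite /= lte_fin ifT//; lra.
  exact: ltry.
- apply: (@continuous_at_measurable R _ _ _ (fun z : X => z : R2 R)).
    move=> U oU; apply: measurableI; first exact: measurable_torus_chart.
    exact: (open_measurable_R2 oU).
  by move=> z _; exact: cF.
- have : compact (F @` (`[- pi, pi]%classic `*` I01 : set (R2 R))).
    apply: continuous_compact; first exact: continuous_subspaceT.
    by apply: compact_setX; exact: segment_compact.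
  move=> /compact_bounded[M [Mr hM]]; exists M; split => // N MN z tz.
  by apply: hM MN _ _; exists z.
Qed.

(** Here [y] runs through the unit circle and [z] is the rotating field, the matrix
with columns [0] and [x1 J y], at which the Lagrangian vanishes. *)
Definition lift_disc (s : Z) : R2 R * R2 R * R22 R :=
  let y := turn s.2 in ((s.1, y), ((0, - (s.1.1 * y.2)), (0, s.1.1 * y.1))).

Definition lift_circle (s : X) : R2 R * R2 R := (circle s.1, turn s.2).

Lemma measurable_circle : measurable_fun setT (circle : MR -> R2 R).
Proof.
apply: measurable_fun_pair; apply: continuous_measurable_fun.
  exact: continuous_cos.
exact: continuous_sin.
Qed.

Lemma measurable_turn : measurable_fun setT (turn : MR -> R2 R).
Proof.
apply: (measurableT_comp measurable_circle).
by apply: continuous_measurable_fun => t; apply: cvgM; [exact: cvg_cst|exact: cvg_id].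
Qed.

Lemma measurable_lift_disc : measurable_fun setT lift_disc.
Proof.
have mt := measurableT_comp measurable_turn (@measurable_snd _ _ X MR).
have mx := measurableT_comp (@measurable_fst _ _ MR MR) (@measurable_fst _ _ X MR).
have mt1 := measurableT_comp (@measurable_fst _ _ R R) mt.
have mt2 := measurableT_comp (@measurable_snd _ _ R R) mt.
apply: measurable_fun_pair.
  exact: measurable_fun_pair measurable_fst mt.
have m0 := measurable_cst (0 : R).
apply: measurable_fun_pair; apply: (measurable_fun_pair (m0 _ _ _)).
  exact: measurable_funN (measurable_funM mx mt2).
exact: measurable_funM mx mt1.
Qed.

Lemma measurable_lift_circle : measurable_fun setT lift_circle.
Proof.
apply: measurable_fun_pair.
  exact: measurableT_comp measurable_circle measurable_fst.
exact: measurableT_comp measurable_turn measurable_snd.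
Qed.

Definition disc_measure :=
  restricted_image vol measurable_cylinder measurable_lift_disc.

Definition circle_measure :=
  restricted_image area measurable_torus_chart measurable_lift_circle.

End relaxed_minimizer.

Section supports.
Context {R : realType}.
Local Notation MR := (measurableTypeR R).
Local Notation X := (R2 MR).
Local Notation vol := (@area R \x @lebesgue_measure R)%E.

Let unit_square : set (R2 R) := `[-1, 1]%classic `*` `[-1, 1]%classic.

Let compact_unit_square : compact unit_square.
Proof. by apply: compact_setX; exact: segment_compact. Qed.

Let circle_square t : unit_square (@circle R t).
Proof. exact/closed_disc_sub/circle_closed_disc. Qed.

(** The mass sits on the image of the cylinder, all of whose coordinates lie in
[[-1, 1]]. *)
Lemma disc_measure_support :
  compactly_supported_radon_on (closure (@unit_disc R) `*` setT `*` setT)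
    (@disc_measure R).
Proof.
pose K : set (R2 R * R2 R * R22 R) :=
  (unit_square `*` unit_square) `*` (unit_square `*` unit_square).
have cK : compact K.
  by apply: compact_setX; apply: compact_setX; exact: compact_unit_square.
have null (A : set (R2 R * R2 R * R22 R)) :
    (forall s, cylinder s -> ~ A (lift_disc s)) -> disc_measure A = 0%E.
  move=> nA; rewrite -[LHS]/(vol (lift_disc @^-1` A `&` cylinder)).
  rewrite (_ : _ `&` _ = set0) ?measure0// -subset0 => s [As cs].
  exact: nA cs As.
split.
- move=> C cC; have mC : measurable C.
    rewrite -[C]setCK; apply: measurableC; apply: open_measurable_R8.
    by apply: closed_openC; apply: compact_closed cC; exact: norm_hausdorff.
  apply: (@le_lt_trans _ _ (vol cylinder)).
    rewrite -[X in (X <= _)%E]/(vol (lift_disc @^-1` C `&` cylinder)).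
    apply: le_measure; rewrite ?inE //.
    + apply: measurableI; last exact: measurable_cylinder.
      by rewrite -[_ @^-1` _]setTI; exact: measurable_lift_disc.
    + exact: measurable_cylinder.
  rewrite [X in (X < _)%E](vol_cylinder : _ = _); exact: area_disc_fin.
- apply: null => s [ds _]; apply; split=> //; split=> //.
  exact: subset_closure.
- apply: compact_measure_support cK _; first exact: norm_hausdorff.
  apply: null => -[x t] [dx _]; apply.
  have [x1 x2] := closed_disc_sub (unit_disc_closed_disc dx).
  have [c s] := circle_square (2 * pi * t).
  split=> /=; first by split.
  move: x1 c s; rewrite /= !in_itv/= -!ler_norml => x1 c s.
  split; split; rewrite /= in_itv/= -ler_norml ?normr0 ?ler01//.
    by rewrite normrN normrM mulr_ile1.
  by rewrite normrM mulr_ile1.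
Qed.

Lemma circle_measure_support :
  compactly_supported_radon_on (boundary (@unit_disc R) `*` setT)
    (@circle_measure R).
Proof.
pose K : set (R2 R * R2 R) := unit_square `*` unit_square.
have cK : compact K by apply: compact_setX; exact: compact_unit_square.
have null (A : set (R2 R * R2 R)) :
    (forall s, ~ A (lift_circle s)) -> circle_measure A = 0%E.
  move=> nA; rewrite -[LHS]/(area (lift_circle @^-1` A `&` torus_chart)).
  by rewrite (_ : _ `&` _ = set0) ?measure0// -subset0 => s [As _]; exact: nA As.
split.
- move=> C cC; have mC : measurable C.
    rewrite -[C]setCK; apply: measurableC; apply: open_measurable_R4.
    by apply: closed_openC; apply: compact_closed cC; exact: norm_hausdorff.
  apply: (@le_lt_trans _ _ (area torus_chart)).
    rewrite -[X in (X <= _)%E]/(area (lift_circle @^-1` C `&` torus_chart)).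
    apply: le_measure; rewrite ?inE //.
    + apply: measurableI; last exact: measurable_torus_chart.
      by rewrite -[_ @^-1` _]setTI; exact: measurable_lift_circle.
    + exact: measurable_torus_chart.
  have := continuous_torus_integrable (@cst_continuous _ R (1 : R)).
  move=> /integrableP[_]; under eq_integral do rewrite /= normr1.
  by rewrite integral_cst ?mul1e//; exact: measurable_torus_chart.
- apply: null => s; apply; split=> //.
  by rewrite boundary_unit_disc /= cos2Dsin2.
- apply: compact_measure_support cK _; first exact: norm_hausdorff.
  by apply: null => s; apply; split; exact: circle_square.
Qed.

End supports.

Section pair_continuity.
Context {R : realType} {T : topologicalType}.
Variables (f : T -> R2 R) (z : T).
Hypothesis cf : {for z, continuous f}.

Lemma continuous_at_fst : {for z, continuous (fun z => (f z).1)}.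
Proof.
have cfst (p : R2 R) : {for p, continuous fst} by case: p => a b; exact: cvg_fst.
exact: (@continuous_comp _ _ _ f fst z cf (cfst (f z))).
Qed.

Lemma continuous_at_snd : {for z, continuous (fun z => (f z).2)}.
Proof.
have csnd (p : R2 R) : {for p, continuous snd} by case: p => a b; exact: cvg_snd.
exact: (@continuous_comp _ _ _ f snd z cf (csnd (f z))).
Qed.

End pair_continuity.

Section measurable_entries.
Context {R : realType}.

Lemma measurable_coord l :
  measurable_fun setT (Defs.coord l : R2 R -> R).
Proof.
by rewrite /Defs.coord; case: (l == ord0); [exact: measurable_fst|exact: measurable_snd].
Qed.

Lemma measurable_entry i l :
  measurable_fun setT (fun z : R22 R => entry z i l).
Proof.
apply: (measurableT_comp (@measurable_coord l)).
by rewrite /Defs.coord; case: (i == ord0); [exact: measurable_fst|exact: measurable_snd].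
Qed.

End measurable_entries.

(** The columns of the rotating field: the first one is zero, the second one is
tangent to the circle of the [y]. *)
Lemma sum_entry_lift_disc (R : realType) (D : 'I_2 -> R) s l :
  \sum_(i < 2) D i * entry (@lift_disc R s).2 i l =
  if l == ord0 then 0
  else s.1.1 * (D ord0 * - (turn s.2).2 + D ord_max * (turn s.2).1).
Proof.
rewrite big_ord_recl big_ord1 (_ : lift ord0 ord0 = ord_max :> 'I_2); last exact: val_inj.
rewrite /lift_disc; move: (turn s.2) => y; rewrite /entry /Defs.coord /=.
by case: (l == ord0); ring.
Qed.

Section holonomy.
Context {R : realType}.
Local Notation lam := (@lebesgue_measure R).
Local Notation MR := (measurableTypeR R).
Local Notation X := (R2 MR).
Local Notation vol := (@area R \x @lebesgue_measure R)%E.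
Local Notation I01 := (`[0, 1]%classic : set R).

Variables (U : set (R2 R * R2 R)) (phi : R2 R * R2 R -> R).
Hypotheses (DU : closure (@unit_disc R) `*` setT `<=` U)
  (sphi : smooth U phi).

Let inU x y : closed_disc x -> U (x, y).
Proof. by move=> dx; apply: DU; split => //; rewrite closure_unit_disc. Qed.

Let dphi p : U p -> differentiable phi p.
Proof. by have [h _] := sphi 1%N; exact: h. Qed.

Let cDphi v p : U p -> {for p, continuous ('D_v phi)}.
Proof. by move=> Up; have [_ h] := sphi 1%N; exact: (h v p Up). Qed.

(** The two derivatives are limits of the same difference quotient. *)
Lemma derive_slice (v x y : R2 R) :
  'D_v (fun x => phi (x, y)) x = 'D_(v, 0) phi (x, y).
Proof.
have E : (fun h : R => h^-1 *: (phi (h *: v + x, y) - phi (x, y))) =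
    (fun h : R => h^-1 *: (phi (h *: ((v, 0) : R2 R * R2 R) + (x, y)) - phi (x, y))).
  apply/funext => h.
  rewrite -[h *: (v, 0) + (x, y)]/(h *: v + x, h *: (0 : R2 R) + y).
  by rewrite scaler0 add0r.
exact: (congr1 (fun F : R -> R => lim (F @ 0^')) E).
Qed.

Let cslice (v : R2 R) y x : closed_disc x ->
  {for x, continuous ('D_v (fun x => phi (x, y)))}.
Proof.
move=> dx; rewrite (_ : 'D_v _ = ('D_(v, 0) phi) \o (fun x => (x, y))); last first.
  by apply/funext => x'; exact: derive_slice.
apply: continuous_comp; first exact: cvg_pair cvg_id (cvg_cst y).
exact/cDphi/inU.
Qed.

Let dslice y x : closed_disc x -> differentiable (fun x => phi (x, y)) x.
Proof.
move=> dx; apply: (@differentiable_comp _ _ _ _ (fun x : R2 R => (x, y)) phi).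
  by apply: differentiable_pair; [exact: ex_diff|exact: differentiable_cst].
exact/dphi/inU.
Qed.

Let cturn (f : R2 R * R2 R -> R) (z : R2 R * R) :
  {for (z.1, turn z.2), continuous f} ->
  {for z, continuous (fun z : R2 R * R => f (z.1, turn z.2))}.
Proof.
move=> cf; apply: (@continuous_comp _ _ _ (fun z : R2 R * R => (z.1, turn z.2)) f) => //.
have c2 : {for z, continuous (fun z : R2 R * R => turn z.2)}.
  apply: (@continuous_comp _ _ _ (snd : R2 R * R -> R) turn); first exact: cvg_snd.
  exact: continuous_turn.
have c1 : {for z, continuous (fun z : R2 R * R => z.1)} by exact: cvg_fst.
exact: cvg_pair c1 c2.
Qed.

(** The part of the holonomy identity that contains the derivatives in [x] is
the divergence theorem for each point of the circle of the [y]. *)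
Let F1 (l : 'I_2) (z : R2 R * R) : R := 'D_(basis2 R l, 0) phi (z.1, turn z.2).

Let cF1 l z : closed_disc z.1 -> {for z, continuous (F1 l)}.
Proof.
by move=> dz; apply: (@cturn ('D_(basis2 R l, 0) phi)); apply: cDphi; exact: inU.
Qed.

Let Gphi (l : 'I_2) (s : R2 R) : R := phi (circle s.1, turn s.2) * Defs.coord l (circle s.1).

Let cG l : continuous (Gphi l).
Proof.
have c1 s : {for s, continuous (fun s : R2 R => circle s.1)}.
  apply: (@continuous_comp _ _ _ (fst : R2 R -> R) circle); first exact: cvg_fst.
  exact: continuous_circle.
have c2 s : {for s, continuous (fun s : R2 R => turn s.2)}.
  apply: (@continuous_comp _ _ _ (snd : R2 R -> R) turn); first exact: cvg_snd.
  exact: continuous_turn.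
move=> s; apply: cvgM.
  apply: (@continuous_comp _ _ _ (fun s : R2 R => (circle s.1, turn s.2)) phi).
    exact: cvg_pair (c1 s) (c2 s).
  by apply: differentiable_continuous; apply/dphi/inU; exact: circle_closed_disc.
rewrite /Defs.coord; case: (l == ord0).
  apply: (@continuous_comp _ _ _ (fun s : R2 R => circle s.1) fst).
    exact: c1.
  exact: cvg_fst.
apply: (@continuous_comp _ _ _ (fun s : R2 R => circle s.1) snd); first exact: c1.
exact: cvg_snd.
Qed.

Let green l y : \int[area]_(x in @unit_disc R) 'D_(basis2 R l) (fun x => phi (x, y)) x =
  \int[lam]_(t in `[- pi, pi]%classic) (phi (circle t, y) * Defs.coord l (circle t)).
Proof.
have dy x := @dslice y x.
case: l => -[|[|//]] l2.
  rewrite (_ : Ordinal l2 = ord0) ?basis2_ord0; last exact: val_inj.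
  by apply: disc_green1 => // x dx; exact: cslice.
rewrite (_ : Ordinal l2 = ord_max) ?basis2_ord_max; last exact: val_inj.
by apply: disc_green2 => // x dx; exact: cslice.
Qed.

Let integral_F1 l : (\int[vol]_(z in cylinder) (F1 l z)%:E =
  \int[area]_(s in torus_chart) (Gphi l s)%:E)%E.
Proof.
have iF : vol.-integrable cylinder (EFin \o F1 l).
  by apply: continuous_cylinder_integrable => z; exact: cF1.
have iG := continuous_torus_integrable (@cG l).
have mC := @measurable_cylinder R; have mT := @measurable_torus_chart R.
rewrite [LHS]integral_mkcond [RHS]integral_mkcond.
have iF' : vol.-integrable setT ((EFin \o F1 l) \_ cylinder).
  by apply/(integrable_mkcond _ mC).1.
have iG' : area.-integrable setT ((EFin \o Gphi l) \_ torus_chart).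
  by apply/(integrable_mkcond _ mT).1.
rewrite -(integral21_prod_meas1 iF') -(integral21_prod_meas1 iG') /fubini_G.
apply: eq_integral => t _.
have [t01|t01] := boolP (t \in I01); last first.
  transitivity (0 : \bar R).
    rewrite integral0_eq// => x _; rewrite patchE memNset// => -[_ /mem_set].
    exact/negP.
  rewrite integral0_eq// => x _; rewrite patchE memNset// => -[_ /mem_set].
  exact/negP.
have sl : (@area R).-integrable (@unit_disc R)
    (EFin \o 'D_(basis2 R l) (fun x => phi (x, turn t))).
  by apply: continuous_closed_disc_integrable => x; exact: cslice.
have sg : lam.-integrable `[- pi, pi]%classic
    (EFin \o (fun u => phi (circle u, turn t) * Defs.coord l (circle u))).
  apply: segment_integrable => u _.
  apply: (@continuous_comp _ _ _ (fun u : R => (u, t) : R2 R) (Gphi l)).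
    exact: cvg_pair cvg_id (cvg_cst t).
  exact: cG.
transitivity ((\int[area]_(x in @unit_disc R)
    'D_(basis2 R l) (fun x => phi (x, turn t)) x)%:E).
  rewrite /Rintegral fineK; last by apply: integrable_fin_num => //; exact: measurable_unit_disc.
  rewrite [RHS]integral_mkcond; apply: eq_integral => x _.
  rewrite !patchE; have -> : ((x, t) \in cylinder) = (x \in @unit_disc R).
    apply/idP/idP => [/set_mem[dx _]|/set_mem dx]; apply/mem_set => //.
    by split=> //; exact: set_mem.
  by case: ifP => // _; rewrite /F1 /= derive_slice.
rewrite green /Rintegral fineK; last first.
  by apply: integrable_fin_num => //; exact: measurable_itv.
rewrite [LHS]integral_mkcond; apply: eq_integral => u _.
rewrite !patchE; have -> : ((u, t) \in torus_chart) = (u \in `[- pi, pi]%classic).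
  apply/idP/idP => [/set_mem[dx _]|/set_mem dx]; apply/mem_set => //.
  by split=> //; exact: set_mem.
by [].
Qed.

(** The part that contains the derivatives in [y] is the derivative along a
closed orbit of the rotation, for each point [x]. *)
Let F2 (z : R2 R * R) : R := z.1.1 *
  ('D_(0, basis2 R ord0) phi (z.1, turn z.2) * - (turn z.2).2 +
   'D_(0, basis2 R ord_max) phi (z.1, turn z.2) * (turn z.2).1).

Let cF2 z : closed_disc z.1 -> {for z, continuous F2}.
Proof.
move=> dz.
have ct : {for z, continuous (fun z : R2 R * R => turn z.2)}.
  apply: (@continuous_comp _ _ _ (snd : R2 R * R -> R) turn); first exact: cvg_snd.
  exact: continuous_turn.
have ct1 : {for z, continuous (fun z : R2 R * R => (turn z.2).1)}.
  exact: continuous_at_fst ct.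
have ct2 : {for z, continuous (fun z : R2 R * R => (turn z.2).2)}.
  exact: continuous_at_snd ct.
have cD v : {for z, continuous (fun z : R2 R * R => 'D_v phi (z.1, turn z.2))}.
  by apply: (@cturn ('D_v phi)); apply: cDphi; exact: inU.
have cx : {for z, continuous (fun z : R2 R * R => z.1.1)}.
  by apply: (@continuous_at_fst _ _ fst); exact: cvg_fst.
apply: cvgM; first exact: cx.
apply: cvgD; apply: cvgM; [exact: cD|exact: cvgN|exact: cD|exact: ct1].
Qed.

Let integral_F2 : (\int[vol]_(z in cylinder) (F2 z)%:E = 0)%E.
Proof.
have iF : vol.-integrable cylinder (EFin \o F2).
  by apply: continuous_cylinder_integrable => z; exact: cF2.
have mC := @measurable_cylinder R.
have iF' : vol.-integrable setT ((EFin \o F2) \_ cylinder).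
  by apply/(integrable_mkcond _ mC).1.
rewrite integral_mkcond -(integral12_prod_meas1 iF') /fubini_F.
rewrite integral0_eq// => x _.
have [dx|dx] := boolP (x \in @unit_disc R); last first.
  rewrite integral0_eq// => t _; rewrite patchE memNset// => -[/mem_set dx' _].
  by move/negP : dx.
have cdx : closed_disc x by apply: unit_disc_closed_disc; exact: set_mem dx.
pose Q (t : R) : R := x.1 / (2 * pi) * phi (x, turn t).
have pi2 : 2 * pi != 0 :> R by rewrite mulf_neq0// gt_eqF// pi_gt0.
have dQ (t : R) : derivable Q t 1 /\ derive1 Q t = F2 (x, t).
  have [d e] := derive_along_turn (dphi (inU (turn t) cdx)).
  split; first exact: (derivableM (derivable_cst _ _ _) d).
  rewrite derive1E deriveZ// -derive1E e /F2 /GRing.scale/=.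
  by rewrite mulrA divfK.
transitivity ((\int[lam]_(t in I01) (F2 (x, t))%:E)%E).
  rewrite [RHS]integral_mkcond; apply: eq_integral => t _.
  rewrite !patchE; have -> : ((x, t) \in cylinder) = (t \in I01).
    apply/idP/idP => [/set_mem[_ t01]|/set_mem t01]; apply/mem_set => //.
    by split=> //; exact: set_mem.
  by [].
have cQ : continuous Q.
  move=> t; apply: differentiable_continuous; apply/derivable1_diffP.
  by have [] := dQ t.
rewrite (@continuous_FTC2 R _ Q)//.
- by rewrite /Q turn01 -EFinB subrr.
- apply: continuous_in_subspaceT => t _.
  apply: (@continuous_comp _ _ _ (fun t : R => (x, t) : R2 R * R) F2).
    exact: cvg_pair (cvg_cst x) cvg_id.
  exact: cF2.
- split; first by move=> t _; have [] := dQ t.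
    by apply: cvg_at_right_filter; exact: cQ.
  by apply: cvg_at_left_filter; exact: cQ.
- by move=> t _; have [] := dQ t.
Qed.

(** The field [x1 J y] is the velocity of the rotation by the angle [x1 x2] in
[y], up to normalization of time; its orbits through the circle of the [y] are
closed, so that moving along them contributes nothing, and the boundary term
comes from the divergence theorem alone. *)
Lemma holonomy_identity (l : 'I_2) :
  (\int[@disc_measure R]_(p in @unit_disc R `*` setT `*` setT)
     ('D_(basis2 R l, 0) phi p.1 +
      \sum_(i < 2) 'D_(0, basis2 R i) phi p.1 * entry p.2 i l)%:E =
   \int[@circle_measure R]_(q in boundary (@unit_disc R) `*` setT)
     (phi q * Defs.coord l (@unit_disc_normal R q.1))%:E)%E.
Proof.
have mE : measurable (@unit_disc R `*` setT `*` setT : set (R2 R * R2 R * R22 R)).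
  apply: measurableX => //; apply: measurableX => //.
  exact: measurable_unit_disc.
have mE4 : measurable (boundary (@unit_disc R) `*` setT : set (R2 R * R2 R)).
  by apply: measurableX => //; exact: measurable_boundary_disc.
have EF s : 'D_(basis2 R l, 0) phi (lift_disc s).1 +
      \sum_(i < 2) 'D_(0, basis2 R i) phi (lift_disc s).1 * entry (lift_disc s).2 i l =
    F1 l s + (if l == ord0 then 0 else F2 s).
  by rewrite (sum_entry_lift_disc (fun i => 'D_(0, basis2 R i) phi (lift_disc s).1)).
have iF1 : vol.-integrable cylinder (EFin \o F1 l).
  by apply: continuous_cylinder_integrable => z; exact: cF1.
have iF2 : vol.-integrable cylinder (EFin \o (fun s => if l == ord0 then 0 else F2 s)).
  apply: continuous_cylinder_integrable => z dz.
  by case: (l == ord0); [exact: cvg_cst|exact: cF2].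
have mC := @measurable_cylinder R; have mT := @measurable_torus_chart R.
rewrite (@integral_restricted_image _ _ _ _ _ _ _ mC _ (@measurable_lift_disc R))//; last first.
- apply: eq_integrable (integrableD mC iF1 iF2) => // s _.
  by rewrite /= -EFinD -EF.
- have mD v : measurable_fun (@unit_disc R `*` setT `*` setT)
      (fun p : R2 R * R2 R * R22 R => 'D_v phi p.1).
    apply: (@continuous_at_measurable R _ _ _
      (fst : R2 R * R2 R * R22 R -> R2 R * R2 R) _ ('D_v phi)).
      move=> V oV; apply: measurableI => //.
      rewrite -[_ @^-1` _]setTI; apply: measurable_fst => //.
      exact: open_measurable_R4.
    move=> [[x y] z] [[dx _] _]; apply: cDphi; apply: inU.
    exact: unit_disc_closed_disc.
  apply/measurable_EFinP; apply: measurable_funD; first exact: mD.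
  apply: measurable_sum => i; apply: measurable_funM; first exact: mD.
  apply: measurable_funTS.
  apply: (measurableT_comp (@measurable_entry R i l)).
  exact: measurable_snd.
- by move=> s [ds _].
rewrite (@integral_restricted_image _ _ _ _ _ _ _ mT _ (@measurable_lift_circle R))//; last first.
- exact: eq_integrable (continuous_torus_integrable (@cG l)).
- apply/measurable_EFinP; apply: measurable_funM.
    apply: (@continuous_at_measurable R _ _ _ (id : R2 R * R2 R -> _) _ phi).
      by move=> V oV; apply: measurableI => //; exact: open_measurable_R4.
    move=> [x y] [dx _]; apply: differentiable_continuous; apply/dphi/inU.
    by move: dx; rewrite boundary_unit_disc /closed_disc /= => ->.
  apply: measurable_funTS.
  apply: (measurableT_comp (@measurable_coord R l)).
  exact: measurable_fst.
- move=> s _; split=> //.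
  by rewrite boundary_unit_disc /= cos2Dsin2.
transitivity ((\int[vol]_(s in cylinder) ((F1 l s)%:E + (if l == ord0 then 0 else F2 s)%:E))%E).
  by apply: eq_integral => s _; rewrite EF.
rewrite integralD//.
rewrite integral_F1 [X in (_ + X)%E](_ : _ = 0%E) ?adde0//.
by case: (l == ord0); [rewrite integral0|exact: integral_F2].
Qed.

End holonomy.

(** * The gap *)

Lemma gapL_lift_disc (R : realType) s : gapL (@lift_disc R s) = 0.
Proof.
rewrite /gapL /lift_disc /=.
have := cos2Dsin2 (2 * pi * s.2); rewrite -/(turn s.2) => e.
by rewrite e; ring.
Qed.

Lemma measurable_gapL (R : realType) D :
  measurable D -> measurable_fun D (@gapL R : R2 R * R2 R * R22 R -> R).
Proof.
move=> mD.
apply: (@continuous_at_measurable R _ _ _ (id : R2 R * R2 R * R22 R -> _) _ (@gapL R)).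
  by move=> V oV; apply: measurableI => //; exact: open_measurable_R8.
move=> p _; apply: differentiable_continuous.
by have [[h _] _] := @gapL_C11loc R setT; exact: h.
Qed.

Lemma disc_measure_occupation (R : realType) :
  relaxed_occupation (@unit_disc R) (@unit_disc_normal R)
    (@disc_measure R) (@circle_measure R).
Proof.
split.
- exact: disc_measure_support.
- exact: circle_measure_support.
- transitivity ((@area R \x @lebesgue_measure R)%E (@cylinder R)).
    rewrite -[LHS]/((@area R \x @lebesgue_measure R)%E
      (@lift_disc R @^-1` (@unit_disc R `*` setT `*` setT) `&` cylinder)).
    by rewrite setIidr// => s [ds _].
  exact: vol_cylinder.
- by move=> U phi l oU DU sphi; exact: holonomy_identity DU sphi l.
Qed.

Lemma relaxed_min (R : realType) :
  is_min (relaxed_values (@unit_disc R) (@unit_disc_normal R) (@gapL R)) 0.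
Proof.
have mE : measurable (@unit_disc R `*` setT `*` setT : set (R2 R * R2 R * R22 R)).
  by apply: measurableX => //; apply: measurableX => //; exact: measurable_unit_disc.
split.
  exists (@disc_measure R), (@circle_measure R).
  split; first exact: disc_measure_occupation.
  rewrite (@integral_restricted_image _ _ _ _ _ _ _ (@measurable_cylinder R)
    _ (@measurable_lift_disc R))//.
  - by rewrite integral0_eq// => s _; rewrite gapL_lift_disc.
  - by move=> s [ds _].
  - by apply/measurable_EFinP; exact: measurable_gapL.
  - apply: eq_integrable (integrable0 _ _) => //; first exact: measurable_cylinder.
    by move=> s _; exact/esym/(congr1 EFin (gapL_lift_disc s)).
move=> _ [mu [mub [_ ->]]]; apply: integral_ge0 => p _.
by rewrite lee_fin; exact: gapL_ge0.
Qed.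

Theorem theorem3p1 (R : realType) :
  exists L : R2 R * R2 R * R22 R -> R,
    [/\ C11loc (@unit_disc R `*` setT `*` setT) L,
        (forall x y : R2 R, unit_disc x ->
           strictly_convex (fun z : R22 R => L (x, y, z))) &
        exists2 m : R,
          is_min (relaxed_values (@unit_disc R) (@unit_disc_normal R) L) m &
          (m%:E < ereal_inf (classical_values (@unit_disc R) L))%E].
Proof.
exists (@gapL R); split.
- exact: gapL_C11loc.
- by move=> x y _; exact: gapL_strictly_convex.
- exists 0; first exact: relaxed_min.
  have [c c0 lb] := @classical_lower_bound R.
  apply: (@lt_le_trans _ _ c%:E); first by rewrite lte_fin.
  exact: le_ereal_inf_tmp.
Qed.
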